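(* Assume the $D$-Hurwitz assumption holds. Then: (1) For every $\tau>0$, $$\lambda(\bar\Sigma_\tau)\le \liminf_{\varepsilon\searrow 0}\lambda(\Sigma^\varepsilon_{\mathcal K,\tau}),$$ and if $\bar\Sigma_\tau$ is EU then there is $\varepsilon_0>0$ such that $\Sigma^\varepsilon_{\mathcal K,\tau}$ is EU for every $\varepsilon\in(0,\varepsilon_0)$. (2) If $\tau=0$ and both $\Xi_{\mathcal R}$ and $\Xi_{\bar{\mathcal R}}$ are bounded, then $\lambda(\bar\Sigma)\le \liminf_{\varepsilon\searrow 0}\lambda(\Sigma^\varepsilon_{\mathcal K})$, and if moreover $\bar\Sigma$ is EU then $\Sigma^\varepsilon_{\mathcal K}$ is EU for every $\varepsilon>0$ small enough. (3) If $\Xi_{\mathcal R}$ is bounded, then $$\lambda(\hat\Sigma)\le \max\Big\{0,\liminf_{\varepsilon\searrow 0}\varepsilon\,\lambda(\Sigma^\varepsilon_{\mathcal K})\Big\}.$$ In particular, if $\hat\Sigma$ is EU, then there exist $c>0$ and $\varepsilon_0>0$ such that for every $\varepsilon\in(0,\varepsilon_0)$ the system $\Sigma^\varepsilon_{\mathcal K}$ is EU and $\lambda(\Sigma^\varepsilon_{\mathcal K})\ge c/\varepsilon$.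
   Context: Setup. Fix an integer $d\ge 2$ and a compact set $\mathcal K\subset\{1,\dots,d-1\}\times \mathrm{GL}(d,\mathbb R)\times M_d(\mathbb R)\times M_d(\mathbb R)$, whose elements are written $\sigma=(\ell,P,\Lambda,R)$. For $\ell\in\{1,\dots,d\}$ and $\varepsilon\ge 0$, $E^\varepsilon_\ell$ is the $d\times d$ diagonal matrix whose first $\ell$ diagonal entries are $1$ and the others $\varepsilon$, and $E^\varepsilon_{\ell^c}$ is the $d\times d$ diagonal matrix whose first $\ell$ diagonal entries are $\varepsilon$ and the others $1$. For a set $\mathcal Z$ and $\tau\ge 0$, $\mathcal S_{\mathcal Z,\tau}$ is the set of right-continuous piecewise-constant functions $Z:\mathbb R_{\ge 0}\to\mathcal Z$ whose switching times $0=t_0<t_1<t_2<\cdots$ (finitely or infinitely many, without finite accumulation point) satisfy $t_{k+1}-t_k\ge\tau$; $Z_k$ denotes the value of $Z$ on $[t_k,t_{k+1})$, and $\mathcal S_{\mathcal Z}=\mathcal S_{\mathcal Z,0}$. For $\varepsilon>0$, $\tau\ge0$, the system $\Sigma^\varepsilon_{\mathcal K,\tau}$ is: for $\sigma=(\ell,P,\Lambda,R)\in\mathcal S_{\mathcal K,\tau}$, $E^\varepsilon_{\ell_k}P_k\dot X(t)=\Lambda_k X(t)$ for $t\in[t_k,t_{k+1})$, and $X(t_k)=R_{k-1}X(t_k^-)$ at each switching time $t_k$, $k\ge 1$; $\Sigma^\varepsilon_{\mathcal K}:=\Sigma^\varepsilon_{\mathcal K,0}$. For any (possibly dimension-varying)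 linear switched system $\Sigma$ with admissible signal class $\mathcal S$ and flow matrices $\Phi_\sigma(t,0)$ (mapping the initial state to the state at time $t$), $\lambda(\Sigma)=\limsup_{t\to\infty}\sup_{\sigma\in\mathcal S}\frac{\log\|\Phi_\sigma(t,0)\|}{t}$ (with $\log 0=-\infty$, $\|\cdot\|$ the operator norm induced by Euclidean norms); $\Sigma$ is ES (exponentially stable) if there exist $c,\delta>0$ with $\|\Phi_\sigma(t,0)\|\le ce^{-\delta t}$ for all $t\ge0$ and all $\sigma\in\mathcal S$; $\Sigma$ is EU (exponentially unstable) if there exist $c,\delta>0$, $\sigma\in\mathcal S$ and $x_0\neq0$ with $|\Phi_\sigma(t,0)x_0|\ge ce^{\delta t}|x_0|$ for all $t\ge 0$. For $\mathcal Y\subset M_d(\mathbb R)$, the discrete-time system $\Xi_{\mathcal Y}$ ($x(k)=Y_kx(k-1)$, $Y_k\in\mathcal Y$) is bounded if there is $C$ with $\|Y_k\cdots Y_1\|\le C$ for all $k\in\mathbb N$ and all $Y_1,\dots,Y_k\in\mathcal Y$, unbounded otherwise. $\mathcal R=\{R:(\ell,P,\Lambda,R)\in\mathcal K\}$. Block notation. For $\sigma=(\ell,P,\Lambda,R)\in\mathcal K$ write $\Lambda P^{-1}=\begin{pmatrix}A&B\\ C&D\end{pmatrix}$ with $A=A(\sigma)\in M_\ell(\mathbb R)$, $D=D(\sigma)\in M_{d-\ell}(\mathbb R)$. The $D$-Hurwitz assumption: $D(\sigma)$ is Hurwitz for every $\sigma\in\mathcal K$. Under it set $M(\sigma)=A-BD^{-1}C\in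 M_\ell(\mathbb R)$, $M^\mu=M+\mu I_\ell$ for $\mu\in\mathbb R$, and $T(\sigma)=\begin{pmatrix}I_\ell&0\\ D^{-1}C&I_{d-\ell}\end{pmatrix}P$. For a matrix $Q$, $(Q)_{\ell,c}$ denotes its upper-left $\ell\times c$ block. Subscript $k$ means evaluation at $\sigma_k$. Auxiliary systems. $\bar\Sigma_\tau$ ($\tau\ge0$): for $\sigma\in\mathcal S_{\mathcal K,\tau}$, the state $\bar x(t)\in\mathbb R^{\ell_k}$ on $[t_k,t_{k+1})$ evolves by $\dot{\bar x}=M_k\bar x$, with jumps $\bar x(t_k)=(T_kR_{k-1}T_{k-1}^{-1})_{\ell_k,\ell_{k-1}}\bar x(t_k^-)$; its flow is an $\ell_k\times\ell_0$ matrix; $\bar\Sigma:=\bar\Sigma_0$. $\bar{\mathcal R}=\{RT^{-1}\mathrm{diag}(I_\ell,0)T:\sigma\in\mathcal K\}$. $\hat\Sigma$: for $\sigma\in\mathcal S_{\mathcal K}$ with switching times $s_k$, state $y(s)\in\mathbb R^d$ with $\dot y=\mathrm{diag}(0_{\ell_k},D_k)y$ on $[s_k,s_{k+1})$ and $y(s_k)=T_kR_{k-1}T_{k-1}^{-1}y(s_k^-)$. *)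

(* Defs.v *)
From mathcomp Require Import all_boot all_order all_algebra all_classical all_reals all_analysis.
From mathcomp Require Import complex.
Set Implicit Arguments.
Unset Strict Implicit.
Unset Printing Implicit Defensive.
Import Order.TTheory GRing.Theory Num.Theory.
Import numFieldNormedType.Exports.
Local Open Scope ring_scope.
Local Open Scope classical_set_scope.

Section Defs.
Variable R : realType.

Definition mget m n (A : 'M[R]_(m, n)) (i j : nat) : R :=
  match @insub _ (fun k => (k < m)%N) 'I_m i, @insub _ (fun k => (k < n)%N) 'I_n j with
  | Some i', Some j' => A i' j'
  | _, _ => 0
  end.

Definition subblk m n (A : 'M[R]_(m, n)) (r0 c0 p q : nat) : 'M[R]_(p, q) :=
  \matrix_(i < p, j < q) mget A (r0 + i) (c0 + j).

Definition ulblk m n (A : 'M[R]_(m, n)) (p q : nat) : 'M[R]_(p, q) :=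
  subblk A 0 0 p q.

Definition vnorm n (v : 'cV[R]_n) : R := Num.sqrt (\sum_i (v i 0) ^+ 2).

Definition opnorm m n (A : 'M[R]_(m, n)) : \bar R :=
  ereal_sup [set (vnorm (A *m v))%:E | v in [set v : 'cV[R]_n | vnorm v <= 1]].

Definition hurwitz n (A : 'M[R]_n) : Prop :=
  forall z : R[i], root (map_poly (fun x : R => (x%:C)%C) (char_poly A)) z ->
    complex.Re z < 0.

Definition elog (x : \bar R) : \bar R :=
  match x with
  | EFin r => if r == 0 then -oo%E else (ln r)%:E
  | +oo%E => +oo%E
  | -oo%E => -oo%E
  end.

Variable d : nat.

Local Notation mode := (nat * 'M[R]_d * 'M[R]_d * 'M[R]_d)%type.
Definition m_l (s : mode) : nat := s.1.1.1.
Definition m_P (s : mode) : 'M[R]_d := s.1.1.2.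
Definition m_Lam (s : mode) : 'M[R]_d := s.1.2.
Definition m_R (s : mode) : 'M[R]_d := s.2.

Definition Eeps (eps : R) (l : nat) : 'M[R]_d :=
  \matrix_(i < d, j < d) (if i == j then (if (i < l)%N then 1 else eps) else 0).

Definition LPinv (s : mode) : 'M[R]_d := m_Lam s *m invmx (m_P s).
Definition blkA (s : mode) : 'M[R]_(m_l s, m_l s) := subblk (LPinv s) 0 0 (m_l s) (m_l s).
Definition blkB (s : mode) : 'M[R]_(m_l s, d - m_l s) := subblk (LPinv s) 0 (m_l s) (m_l s) (d - m_l s).
Definition blkC (s : mode) : 'M[R]_(d - m_l s, m_l s) := subblk (LPinv s) (m_l s) 0 (d - m_l s) (m_l s).
Definition blkD (s : mode) : 'M[R]_(d - m_l s, d - m_l s) :=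
  subblk (LPinv s) (m_l s) (m_l s) (d - m_l s) (d - m_l s).

Definition Mred (s : mode) : 'M[R]_(m_l s) :=
  blkA s - blkB s *m invmx (blkD s) *m blkC s.

(* T(sigma) = [[I, 0], [D^{-1} C, I]] P *)
Definition Tmat (s : mode) : 'M[R]_d :=
  (\matrix_(i < d, j < d)
     (if (i < m_l s)%N then (i == j)%:R
      else if (j < m_l s)%N then mget (invmx (blkD s) *m blkC s) (i - m_l s) j
      else (i == j)%:R)) *m m_P s.

Definition diag0D (s : mode) : 'M[R]_d :=
  \matrix_(i < d, j < d)
     (if ((m_l s <= i)%N && (m_l s <= j)%N) then mget (blkD s) (i - m_l s) (j - m_l s) else 0).

Definition diagI0 (l : nat) : 'M[R]_d :=
  \matrix_(i < d, j < d) (if (i == j) && (i < l)%N then 1 else 0).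

(* nsw = None: infinitely many switching times; nsw = Some N: exactly  *)
(* N switching times t_1 < ... < t_N after t_0 = 0.                    *)
(* The signal takes value sg k on [ts k, ts (k+1)) (or [ts N, +oo)).   *)

Definition active (nsw : option nat) (k : nat) : Prop :=
  match nsw with None => True | Some N => (k <= N)%N end.
Definition hasnext (nsw : option nat) (k : nat) : Prop :=
  match nsw with None => True | Some N => (k < N)%N end.

Definition admissible (K : set mode) (tau : R)
    (nsw : option nat) (ts : nat -> R) (sg : nat -> mode) : Prop :=
  [/\ ts 0%N = 0,
      (forall k, active nsw k -> K (sg k)),
      (forall k, hasnext nsw k ->
          [/\ ts k < ts k.+1, ts k + tau <= ts k.+1 & sg k.+1 <> sg k]) &
      (nsw = None -> forall M : R, exists k, M < ts k)].

Definition inpiece (nsw : option nat) (ts : nat -> R) (k : nat) (t : R) : Prop :=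
  [/\ active nsw k, ts k <= t & (hasnext nsw k -> t < ts k.+1)].

(* Generic (dimension-varying) linear switched systems with jumps:     *)
(* on the k-th interval the state lives in R^(dim (sg k)) and solves    *)
(*     Lm (sg k) x' = Am (sg k) x,                                     *)
(* and at t_{k+1}: x(t_{k+1}) = Jm (sg (k+1)) (sg k) x(t_{k+1}^-).      *)

Unset Implicit Arguments.
Record swsys := SwSys {
  sdim : mode -> nat;
  sLm : forall s, 'M[R]_(sdim s);
  sAm : forall s, 'M[R]_(sdim s);
  sJm : forall s' s, 'M[R]_(sdim s', sdim s) }.

Definition dvec n (y : R -> 'cV[R]_n) (t : R) : 'cV[R]_n :=
  \col_i (fun u => y u i 0)^`() t.

Definition solves n (L A : 'M[R]_n) (y : R -> 'cV[R]_n) : Prop :=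
  forall t, (forall i, derivable (fun u => y u i 0) t 1) /\ L *m dvec n y t = A *m y t.

(* A trajectory is given by its pieces x k : R -> R^(dim (sg k)).  Each piece
   is the (global) solution of the k-th linear ODE; the actual trajectory is
   X(t) = x k t for t in [ts k, ts (k+1)). *)
Definition is_traj (S : swsys) (nsw : option nat) (ts : nat -> R) (sg : nat -> mode)
    (x : forall k, R -> 'cV[R]_(sdim S (sg k))) : Prop :=
  (forall k, active nsw k -> solves _ (sLm S (sg k)) (sAm S (sg k)) (x k)) /\
  (forall k, hasnext nsw k ->
     x k.+1 (ts k.+1) = sJm S (sg k.+1) (sg k) *m x k (ts k.+1)).

Definition flownorm (S : swsys) (nsw : option nat) (ts : nat -> R) (sg : nat -> mode)
    (t : R) : \bar R :=
  ereal_sup [set r : \bar R | exists (x : forall k, R -> 'cV[R]_(sdim S (sg k))) (k : nat),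
     [/\ is_traj S nsw ts sg x, vnorm (x 0%N 0) <= 1, inpiece nsw ts k t &
          r = (vnorm (x k t))%:E]].

Definition lyap (S : swsys) (K : set mode) (tau : R) : \bar R :=
  let g := fun t : R =>
    ereal_sup [set r : \bar R | exists nsw ts sg, admissible K tau nsw ts sg /\
                 r = (elog (flownorm S nsw ts sg t) * (t^-1)%:E)%E] in
  ereal_inf [set ereal_sup [set g t | t in [set t | T <= t]] | T in [set T : R | 0 < T]].

Definition EU (S : swsys) (K : set mode) (tau : R) : Prop :=
  exists c delta : R, [/\ 0 < c, 0 < delta &
    exists nsw ts sg, admissible K tau nsw ts sg /\
    exists x : forall k, R -> 'cV[R]_(sdim S (sg k)),
      [/\ is_traj S nsw ts sg x, x 0%N 0 != 0 &
          forall k t, 0 <= t -> inpiece nsw ts k t ->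
            c * expR (delta * t) * vnorm (x 0%N 0) <= vnorm (x k t)]].

Definition Sigma_eps (eps : R) : swsys :=
  @SwSys (fun _ => d) (fun s => Eeps eps (m_l s) *m m_P s) (fun s => m_Lam s)
         (fun _ s => m_R s).

Definition Sigma_bar : swsys :=
  @SwSys m_l (fun s => 1%:M) Mred
         (fun s' s => ulblk (Tmat s' *m m_R s *m invmx (Tmat s)) (m_l s') (m_l s)).

Definition Sigma_hat : swsys :=
  @SwSys (fun _ => d) (fun s => 1%:M) diag0D
         (fun s' s => Tmat s' *m m_R s *m invmx (Tmat s)).

Definition Xi_bounded (Y : set 'M[R]_d) : Prop :=
  exists C : R, forall s : seq 'M[R]_d, (forall Y0, Y0 \in s -> Y Y0) ->
    (opnorm (foldr (fun A B => A *m B) 1%:M s) <= C%:E)%E.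

Definition Rset (K : set mode) : set 'M[R]_d := [set m_R s | s in K].
Definition Rbarset (K : set mode) : set 'M[R]_d :=
  [set m_R s *m invmx (Tmat s) *m diagI0 (m_l s) *m Tmat s | s in K].

Definition liminf0 (h : R -> \bar R) : \bar R :=
  ereal_sup [set ereal_inf [set h e | e in [set e | 0 < e < delta]]
            | delta in [set delta : R | 0 < delta]].

Definition good_K (K : set mode) : Prop :=
  compact K /\
  forall s, K s -> [/\ (1 <= m_l s)%N, (m_l s <= d - 1)%N & m_P s \in unitmx].

Definition D_Hurwitz (K : set mode) : Prop := forall s, K s -> hurwitz (blkD s).

End Defs.

Arguments lyap {R d}.
Arguments EU {R d}.
Arguments Sigma_eps {R} d eps.
Arguments Sigma_bar {R} d.
Arguments Sigma_hat {R} d.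
Arguments liminf0 {R}.
Arguments good_K {R d}.
Arguments D_Hurwitz {R d}.
Arguments Xi_bounded {R d}.
Arguments Rset {R d}.
Arguments Rbarset {R d}.

(* Main.v *)
(* Both limit systems live in R^d after conjugation by T: the flow of a mode becomes
   T^-1 diag(e^(M t), 0) T, resp. T^-1 diag(1, e^(D t)) T in the fast time t / eps, the
   jump becomes R, and by a Tikhonov argument (resp. by continuity of the exponential) the
   flow of a single mode of the perturbed system converges to it at every fixed t > 0.
   The convergence is not uniform in the signal, so that only finitely many switching
   patterns can be used. Hence the key point: if products over words of modes and
   durations are unbounded at every rate below rho, then for mu < rho there are finitely
   many words such that any perturbation of the matrices, small on these words only, has an
   infinite concatenation of them along which some trajectory grows at rate mu at all
   times. To see this, take the space V of vectors whose orbits are bounded at a well chosen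
   rate: modulo V every vector grows strictly along some word, by compactness of the sphere
   finitely many words suffice, and a cone around a complement of V is invariant under
   perturbation. One growing trajectory bounds the Lyapunov exponent from below and, if
   mu > 0, gives exponential instability. Zero dwell time enters only through the
   products over words of total duration at most 1, which the boundedness of the jump
   products controls. *)
Require Import Defs.
From mathcomp Require Import all_boot all_order all_algebra all_classical all_reals all_analysis.
From mathcomp Require Import complex spectral ring lra.
Set Implicit Arguments.
Unset Strict Implicit.
Unset Printing Implicit Defensive.
Import Order.TTheory GRing.Theory Num.Theory.
Import numFieldNormedType.Exports.
Local Open Scope ring_scope.
Local Open Scope classical_set_scope.

(** * Matrix norms and subspaces *)

(** The well chosen rate comes from a dimension count. The vectors bounded at rate r form a subspace
    that increases with r, so at a rate where its dimension is maximal a slightly larger rate adds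
    nothing; this gap absorbs every factor that is polynomial in the length of a word. The main
    obstacle is that consecutive modes of a signal must differ: words do not concatenate freely, and
    the space of bounded vectors might depend on the mode that ended the previous word. Words
    therefore carry labels, and they are cut only in front of letters whose mode lies outside a set
    H of modes over which growth is already controlled. Either some H leads to words that never
    conflict, or a conflicting mode can be added to H at no cost in dimension. A second obstacle is
    that a letter may last arbitrarily long, whereas only words of duration at most 1 are bounded a
    priori. Single modes are therefore treated beforehand, through the powers of their time-one
    flow: either a constant signal grows already, or these flows are bounded uniformly over the
    modes. *)

Section MatrixNorm.
Variable R : realType.

(** The sum norm is real-valued, dominates single entries and is submultiplicative for all
    rectangular shapes; the Euclidean norm is compared with it at the interface only, at the price
    of dimensional constants. *)
Definition nrm m n (A : 'M[R]_(m, n)) : R := \sum_i \sum_j `|A i j|.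

Lemma nrm_ge0 m n (A : 'M[R]_(m, n)) : 0 <= nrm A.
Proof. by apply: sumr_ge0 => i _; apply: sumr_ge0. Qed.

Lemma nrm_entry m n (A : 'M[R]_(m, n)) i j : `|A i j| <= nrm A.
Proof.
rewrite /nrm (bigD1 i) //= (bigD1 j) //= -addrA lerDl addr_ge0 //.
  by apply: sumr_ge0.
by apply: sumr_ge0 => k _; apply: sumr_ge0.
Qed.

Lemma nrm0 m n : nrm (0 : 'M[R]_(m, n)) = 0.
Proof. by rewrite /nrm big1 // => i _; rewrite big1 // => j _; rewrite mxE normr0. Qed.

Lemma nrm_eq0 m n (A : 'M[R]_(m, n)) : (nrm A == 0) = (A == 0).
Proof.
apply/eqP/eqP => [A0|->]; last exact: nrm0.
by apply/matrixP => i j; rewrite mxE; apply/eqP; rewrite -normr_le0 -A0 nrm_entry.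
Qed.

Lemma nrm_gt0 m n (A : 'M[R]_(m, n)) : (0 < nrm A) = (A != 0).
Proof. by rewrite lt_neqAle nrm_ge0 andbT eq_sym nrm_eq0. Qed.

Lemma nrmD m n (A B : 'M[R]_(m, n)) : nrm (A + B) <= nrm A + nrm B.
Proof.
rewrite /nrm -big_split; apply: ler_sum => i _; rewrite -big_split /=.
by apply: ler_sum => j _; rewrite mxE ler_normD.
Qed.

Lemma nrmZ m n (a : R) (A : 'M[R]_(m, n)) : nrm (a *: A) = `|a| * nrm A.
Proof.
rewrite /nrm mulr_sumr; apply: eq_bigr => i _; rewrite mulr_sumr.
by apply: eq_bigr => j _; rewrite mxE normrM.
Qed.

Lemma nrmN m n (A : 'M[R]_(m, n)) : nrm (- A) = nrm A.
Proof. by rewrite -scaleN1r nrmZ normrN1 mul1r. Qed.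

Lemma nrmBC m n (A B : 'M[R]_(m, n)) : nrm (A - B) = nrm (B - A).
Proof. by rewrite -nrmN opprB. Qed.

Lemma nrmB m n (A B : 'M[R]_(m, n)) : nrm (A - B) <= nrm A + nrm B.
Proof. by rewrite -(nrmN B) nrmD. Qed.

Lemma nrm_tri m n (A B : 'M[R]_(m, n)) : nrm A <= nrm B + nrm (A - B).
Proof. by rewrite -{1}(subrK B A) addrC nrmD. Qed.

Lemma nrmM m n p (A : 'M[R]_(m, n)) (B : 'M[R]_(n, p)) :
  nrm (A *m B) <= nrm A * nrm B.
Proof.
rewrite /nrm mulr_suml; apply: ler_sum => i _.
have rB j : \sum_k `|B j k| <= nrm B.
  rewrite /nrm (bigD1 j) //= lerDl.
  by apply: sumr_ge0 => k _; apply: sumr_ge0.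
apply: (@le_trans _ _ (\sum_k \sum_j `|A i j| * `|B j k|)).
  apply: ler_sum => k _; rewrite mxE (le_trans (ler_norm_sum _ _ _)) //.
  by apply: ler_sum => j _; rewrite normrM.
rewrite exchange_big /= mulr_suml; apply: ler_sum => j _.
by rewrite -mulr_sumr ler_wpM2l.
Qed.

Lemma nrmMle m n p (A : 'M[R]_(m, n)) (B : 'M[R]_(n, p)) a b :
  nrm A <= a -> nrm B <= b -> nrm (A *m B) <= a * b.
Proof. by move=> ha hb; apply: le_trans (nrmM _ _) _; apply: ler_pM; rewrite ?nrm_ge0. Qed.

Lemma nrm_le_entry m n (A : 'M[R]_(m, n)) c :
  (forall i j, `|A i j| <= c) -> nrm A <= (m * n)%:R * c.
Proof.
move=> h; apply: (@le_trans _ _ (\sum_(i < m) \sum_(j < n) c)).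
  by apply: ler_sum => i _; apply: ler_sum.
by rewrite !sumr_const !card_ord -mulrnA mulr_natl mulnC.
Qed.

Lemma nrm_cV n (v : 'cV[R]_n) : nrm v = \sum_i `|v i 0|.
Proof. by apply: eq_bigr => i _; rewrite big_ord1. Qed.

Lemma nrm_le_apply m n (A : 'M[R]_(m, n)) c :
  (forall v : 'cV[R]_n, nrm (A *m v) <= c * nrm v) -> nrm A <= n%:R * c.
Proof.
move=> h; rewrite /nrm exchange_big /=.
have -> : n%:R * c = \sum_(j < n) c by rewrite sumr_const card_ord mulr_natl.
apply: ler_sum => j _.
have d1 : nrm (delta_mx j 0 : 'cV[R]_n) = 1.
  rewrite nrm_cV (bigD1 j) //= big1 ?addr0 => [|i ij]; first by rewrite mxE !eqxx normr1.
  by rewrite mxE (negbTE ij) normr0.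
have := h (delta_mx j 0); rewrite d1 mulr1 -colE; apply: le_trans.
by rewrite nrm_cV; apply: ler_sum => i _; rewrite mxE.
Qed.

Lemma nrm_mxvec m n (A : 'M[R]_(m, n)) : nrm (mxvec A) = nrm A.
Proof.
rewrite /nrm big_ord1 pair_big /= (reindex (uncurry (@mxvec_index m n))) /=.
  by apply: eq_bigr => -[i j] _; rewrite /= mxvecE.
exact: curry_mxvec_bij.
Qed.

Lemma vnorm_ge0 n (v : 'cV[R]_n) : 0 <= vnorm v.
Proof. exact: sqrtr_ge0. Qed.

Lemma vnorm_entry n (v : 'cV[R]_n) i : `|v i 0| <= vnorm v.
Proof.
rewrite -sqrtr_sqr ler_wsqrtr // (bigD1 i) //= lerDl.
by apply: sumr_ge0 => j _; rewrite sqr_ge0.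
Qed.

Lemma nrm_le_vnorm n (v : 'cV[R]_n) : nrm v <= n%:R * vnorm v.
Proof.
by rewrite -[n in n%:R]muln1; apply: nrm_le_entry => i j; rewrite ord1 vnorm_entry.
Qed.

Lemma vnorm_le_nrm n (v : 'cV[R]_n) : vnorm v <= nrm v.
Proof.
rewrite -(ger0_norm (nrm_ge0 v)) -sqrtr_sqr ler_wsqrtr // expr2 {1}nrm_cV mulr_suml.
apply: ler_sum => i _; rewrite -real_normK ?num_real // expr2.
by apply: ler_wpM2l => //; apply: nrm_entry.
Qed.

Lemma vnorm_eq0 n (v : 'cV[R]_n) : (vnorm v == 0) = (v == 0).
Proof.
rewrite -nrm_eq0; apply/eqP/eqP => h; apply/eqP; rewrite eq_le.
  by rewrite nrm_ge0 (le_trans (nrm_le_vnorm v)) // h mulr0.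
by rewrite vnorm_ge0 -h vnorm_le_nrm.
Qed.

Lemma vnormZ n (a : R) (v : 'cV[R]_n) : vnorm (a *: v) = `|a| * vnorm v.
Proof.
rewrite /vnorm -sqrtr_sqr -sqrtrM ?sqr_ge0 // mulr_sumr; congr Num.sqrt.
by apply: eq_bigr => i _; rewrite mxE exprMn.
Qed.

Lemma rV_finite_net n (delta : 'rV[R]_n -> R) (c : R) :
  (forall y, 0 < delta y) ->
  exists s : seq 'rV[R]_n, forall x, nrm x <= c ->
    exists2 y, y \in s & nrm (x - y) < delta y.
Proof.
move=> d0; pose B := [set x : 'rV[R]_n | `|x| <= c].
have cB : compact B.
  apply: bounded_closed_compact.
    by exists c; split; [exact: num_real|move=> M cM x /= Bx; exact: le_trans (ltW cM)].
  apply: (@closed_comp _ _ (fun x : 'rV[R]_n => `|x|) [set x | x <= c]); last exact: closed_le.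
  by move=> x _; exact: norm_continuous.
have nn (x : 'rV[R]_n) : nrm x <= n%:R * `|x|.
  rewrite -[n in n%:R]mul1n; apply: nrm_le_entry => i j.
  rewrite [leRHS]/Num.Def.normr /= mx_normrE.
  by apply: (@le_bigmax _ _ _ 0 (fun ij : 'I_1 * 'I_n => `|x ij.1 ij.2|) (i, j)).
have nn' (x : 'rV[R]_n) : `|x| <= nrm x.
  rewrite [leLHS]/Num.Def.normr /= mx_normrE.
  by apply: bigmax_le => [|ij _]; [exact: nrm_ge0|exact: nrm_entry].
(* The balls are those of the max norm, which [nrm] exceeds by a factor at most n; dividing by
   [n.+1] also covers n = 0. *)
move: cB; rewrite compact_cover => /(_ 'rV[R]_n setT
  (fun y => ball y (delta y / n.+1%:R))) [].
- by move=> y _; apply: ball_open; rewrite divr_gt0.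
- by move=> x _; exists x => //; apply: ballxx; rewrite divr_gt0.
move=> D _ BD; exists (finmap.enum_fset D) => x xc.
have [|y /= yD] := BD x; first exact: le_trans (nn' x) xc.
rewrite -ball_normE /= => h; exists y => //.
rewrite nrmBC; apply: le_lt_trans (nn _) _.
apply: (@le_lt_trans _ _ (n.+1%:R * `|y - x|)).
  by rewrite ler_wpM2r // ler_nat.
by rewrite mulrC -ltr_pdivlMr.
Qed.

Lemma mx_finite_net m n (delta : 'M[R]_(m, n) -> R) (c : R) :
  (forall y, 0 < delta y) ->
  exists s : seq 'M[R]_(m, n), forall x, nrm x <= c ->
    exists2 y, y \in s & nrm (x - y) < delta y.
Proof.
move=> d0; have [s hs] := @rV_finite_net (m * n) (delta \o vec_mx) c (fun y => d0 _).
exists (map vec_mx s) => x xc.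
have [|y ys h] := hs (mxvec x); first by rewrite nrm_mxvec.
exists (vec_mx y); first by apply/mapP; exists y.
by rewrite -(nrm_mxvec (x - _)) linearB /= vec_mxK.
Qed.

End MatrixNorm.

Section Subspaces.
Variable F : fieldType.

(** A subspace of largest dimension inside [V] is all of [V], since any further vector of [V] would
    enlarge it. *)
Lemma linear_pred_vspace (vT : vectType F) (V : vT -> Prop) :
  V 0 -> (forall a u v, V u -> V v -> V (a *: u + v)) ->
  exists U : {vspace vT}, forall v, (v \in U) <-> V v.
Proof.
move=> V0 VD.
pose P k := `[< exists U : {vspace vT}, (\dim U = k) /\ forall v, v \in U -> V v >].
have P0 : exists k, P k.
  exists 0%N; apply/asboolP; exists 0%VS; rewrite dimv0; split=> // v.
  by rewrite memv0 => /eqP ->.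
have Pb k : P k -> (k <= \dim {:vT})%N.
  by move=> /asboolP[U [<- _]]; apply: dimvS (subvf U).
case: (ex_maxnP P0 Pb) => k /asboolP[U [dU UV]] kmax.
exists U => v; split=> [|Vv]; first exact: UV.
apply: contrapT => /negP vU.
have : P (\dim (U + <[v]>)%VS).
  apply/asboolP; exists (U + <[v]>)%VS; split=> // w /memv_addP[u uU [x /vlineP[a ->] ->]].
  by rewrite addrC; apply: VD => //; apply: UV.
move=> /kmax; rewrite -dU => h; move/negP: vU; apply.
have /eqP -> : U == (U + <[v]>)%VS by rewrite eqEdim addvSl h.
by rewrite memvE addvSr.
Qed.

Lemma linear_fun_mx m n (f : {linear 'cV[F]_m -> 'cV[F]_n}) :
  exists M : 'M[F]_(n, m), forall v, f v = M *m v.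
Proof.
exists (\matrix_(i, j) f (delta_mx j 0) i 0) => v.
have ev : v = \sum_j v j 0 *: delta_mx j 0.
  apply/matrixP => i j; rewrite ord1 summxE (bigD1 i) //= big1 ?addr0 => [|k ki].
    by rewrite !mxE !eqxx mulr1.
  by rewrite !mxE eq_sym (negbTE ki) mulr0.
rewrite {1}ev linear_sum; apply/matrixP => i j; rewrite ord1 summxE mxE.
by apply: eq_bigr => k _; rewrite linearZ !mxE mulrC.
Qed.

(** [Q] projects along [U] onto a complement, so [Q *m v] represents the class of [v] modulo [U] and
    its norm measures growth in the quotient. *)
Lemma vspace_proj n (U : {vspace 'cV[F]_n}) :
  exists Q : 'M[F]_n, (forall v, (v \in U) = (Q *m v == 0)) /\ Q *m Q = Q.
Proof.
have [M MP0] := linear_fun_mx (projv U).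
have MP v : projv U v = M *m v by exact: MP0.
have MM : M *m M = M.
  apply/matrixP => i j.
  have : M *m M *m delta_mx j (0 : 'I_1) = M *m delta_mx j 0.
    by rewrite -mulmxA -!MP projv_proj.
  by rewrite -!colE => /matrixP/(_ i 0); rewrite !mxE.
exists (1%:M - M); split; last first.
  by rewrite mulmxBl mul1mx mulmxBr mulmx1 MM subrr subr0.
move=> v; rewrite mulmxBl mul1mx subr_eq0 -MP.
by apply/idP/eqP => [/projv_id ->//|->]; exact: memv_proj.
Qed.

End Subspaces.

(** * Robust growth along words *)

Section LabelledWords.
Variables (X Lab : Type) (ls le : X -> Lab).

(* [wok f w]: in the word [w], preceded by the label [f], no letter starts with
   the label on which the previous one ends. *)
Fixpoint wok (f : Lab) (w : seq X) : Prop :=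
  if w is a :: w' then f <> ls a /\ wok (le a) w' else True.

Definition wlast (f : Lab) (w : seq X) : Lab := foldl (fun _ a => le a) f w.

Lemma wok_cat f w1 w2 : wok f (w1 ++ w2) <-> wok f w1 /\ wok (wlast f w1) w2.
Proof. by elim: w1 f => [|a w1 IH] f /=; [tauto|rewrite IH /wlast /=; tauto]. Qed.

Lemma wok_catI f w1 w2 : wok f w1 -> wok (wlast f w1) w2 -> wok f (w1 ++ w2).
Proof. by move=> h1 h2; apply/wok_cat. Qed.

Lemma wlast_cat f w1 w2 : wlast f (w1 ++ w2) = wlast (wlast f w1) w2.
Proof. exact: foldl_cat. Qed.

End LabelledWords.

Section WeightedWords.
Variables (R : realType) (n : nat) (X : Type) (wt : X -> R).

(* The matrix of a word: its first letter acts first. *)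
Fixpoint wmat (A : X -> 'M[R]_n) (w : seq X) : 'M[R]_n :=
  if w is a :: w' then wmat A w' *m A a else 1%:M.

Fixpoint wlen (w : seq X) : R := if w is a :: w' then wt a + wlen w' else 0.

Lemma wmat_cat A w1 w2 : wmat A (w1 ++ w2) = wmat A w2 *m wmat A w1.
Proof. by elim: w1 => [|a w1 IH] /=; rewrite ?mulmx1 // IH mulmxA. Qed.

Lemma wlen_cat w1 w2 : wlen (w1 ++ w2) = wlen w1 + wlen w2.
Proof. by elim: w1 => [|a w1 IH] /=; rewrite ?add0r // IH addrA. Qed.

Lemma wlen_ge0 w : (forall a, 0 <= wt a) -> 0 <= wlen w.
Proof. by move=> h; elim: w => //= a w; apply: addr_ge0. Qed.

End WeightedWords.

Section Robust.
Variables (R : realType) (n : nat) (X : eqType) (Lab : Type).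
Variables (ls le : X -> Lab) (wt : X -> R) (A : X -> 'M[R]_n).
Notation word := (seq X).
Notation mat := (wmat A).
Notation len := (wlen wt).
Notation ok := (wok ls le).
Notation last_lab := (wlast le).

Definition rate_bdd (C : word -> Prop) (r : R) (f : Lab) (z : 'cV[R]_n) : Prop :=
  exists c, forall w, C w -> ok f w -> nrm (mat w *m z) <= c * expR (r * len w).

Lemma rate_bdd_lin C r f a u v :
  rate_bdd C r f u -> rate_bdd C r f v -> rate_bdd C r f (a *: u + v).
Proof.
move=> [c hc] [c' hc']; exists (`|a| * c + c') => w Cw okw.
rewrite mulmxDr -scalemxAr (le_trans (nrmD _ _)) // nrmZ mulrDl -mulrA.
by apply: lerD; [apply: ler_wpM2l => //; apply: hc|apply: hc'].
Qed.

Lemma rate_bdd0 C r f : rate_bdd C r f 0.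
Proof. by exists 0 => w _ _; rewrite mulmx0 nrm0 mul0r. Qed.

(** [C] holds the building blocks and [E] the labels after which a block may be started. By [V1] and
    [V2] the bounded vectors are the same after every label of [E] and at both rates. [C_split] cuts
    a block into blocks of controlled norm, at most linearly many in its length; the gap between
    [r1] and [r2] pays for their number. *)
Variables (C : word -> Prop) (E : Lab -> Prop) (V : 'cV[R]_n -> Prop) (r1 r2 c0 c1 cV : R) (f0 : Lab).
Hypothesis r12 : r1 < r2.
Hypothesis c0_ge0 : 0 <= c0.
Hypothesis c1_ge0 : 0 <= c1.
Hypothesis cV_ge0 : 0 <= cV.
Hypothesis wt_ge0 : forall a, 0 <= wt a.
Hypothesis C_nil : forall w, C w -> w <> [::].
Hypothesis C_last : forall f w, C w -> E (last_lab f w).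
Hypothesis C_cat : forall f w w', E f -> C w -> C w' -> ok f w -> ok (last_lab f w) w' ->
  C (w ++ w').
Hypothesis C_split : forall f w, E f -> C w -> ok f w -> exists qs : seq word,
  [/\ w = flatten qs, (forall q, q \in qs -> C q /\ nrm (mat q) <= c0 * expR (r1 * len q)) &
      (size qs)%:R <= c1 * (len w + 1)].
Hypothesis V1 : forall f z, E f -> rate_bdd C r1 f z <-> V z.
Hypothesis V2 : forall f z, E f -> rate_bdd C r2 f z -> V z.
Hypothesis V_unif : forall f w z, E f -> C w -> ok f w -> V z ->
  nrm (mat w *m z) <= cV * expR (r1 * len w) * nrm z.
Hypothesis V_proper : exists z, ~ V z.
Hypothesis Ef0 : E f0.

Lemma V_proj : exists Q : 'M[R]_n, (forall v, V v <-> Q *m v = 0) /\ Q *m Q = Q.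
Proof.
have [||U hU] := @linear_pred_vspace R 'cV[R]_n V.
- by apply/(V1 _ Ef0)/rate_bdd0.
- by move=> a u v /(V1 _ Ef0) hu /(V1 _ Ef0) hv; apply/(V1 _ Ef0)/rate_bdd_lin.
have [Q [hQ QQ]] := vspace_proj U; exists Q; split=> // v.
rewrite -hU hQ; split=> [/eqP //|->]; exact/eqP.
Qed.


(** A continuation [w'] of [w] gives the block [w ++ w'], so passing to the image costs only the
    factor [expR (r1 * len w)]. *)
Lemma V_inv f w v : E f -> C w -> ok f w -> V v -> V (mat w *m v).
Proof.
move=> Ef Cw okw Vv; apply/(V1 _ (C_last f Cw)).
move/(V1 _ Ef): Vv => [c hc]; exists (c * expR (r1 * len w)) => w' Cw' okw'.
rewrite mulmxA -wmat_cat -mulrA -expRD -mulrDr -wlen_cat.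
by apply: hc; [exact: (C_cat Ef Cw Cw' okw okw')|exact: wok_catI].
Qed.

Lemma C_flatten f qs : E f -> qs != [::] -> (forall q, q \in qs -> C q) ->
  ok f (flatten qs) -> C (flatten qs).
Proof.
move=> Ef; elim: qs f Ef => [//|q [|q' qs] IH] f Ef _ hq okq.
  by rewrite /= cats0; apply: hq; rewrite inE.
have Cq : C q by apply: hq; rewrite inE eqxx.
have [ok1 ok2] := (wok_cat _ _ _ _ _).1 okq.
apply: (C_cat Ef) => //; apply: (IH (last_lab f q)) => //; first exact: C_last.
by move=> p ps; apply: hq; rewrite inE ps orbT.
Qed.

Section WithProjection.
Variable Q : 'M[R]_n.
Hypothesis VQ : forall v, V v <-> Q *m v = 0.
Hypothesis QQ : Q *m Q = Q.

Let kap : R := 1 + (1 + cV) * (c0 + 1).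

(* The jumps between the quotient and [V] are summed along the splitting of the
   word into groups: they contribute one term of order [expR (r1 * len w)] each. *)
Lemma quotient_bdd_aux qs f c (z : 'cV[R]_n) : E f -> 0 <= c ->
  (forall q, q \in qs -> C q /\ nrm (mat q) <= c0 * expR (r1 * len q)) ->
  ok f (flatten qs) ->
  (forall w, C w -> ok f w -> nrm (Q *m (mat w *m z)) <= c * expR (r1 * len w)) ->
  nrm z <= c ->
  nrm (mat (flatten qs) *m z) <= kap * c * ((size qs)%:R + 1) * expR (r1 * len (flatten qs)).
Proof.
have k1 : 1 <= kap by rewrite lerDl mulr_ge0 // addr_ge0.
elim: qs f c z => [|q qs IH] f c z Ef c_ge0 hq okq hz zc.
  rewrite /= mul1mx mulr0 expR0 mulr1 add0r mulr1; apply: le_trans zc _.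
  by rewrite ler_peMl.
have [Cq nq] : C q /\ nrm (mat q) <= c0 * expR (r1 * len q).
  by apply: hq; rewrite inE eqxx.
have hqs p : p \in qs -> C p /\ nrm (mat p) <= c0 * expR (r1 * len p).
  by move=> ps; apply: hq; rewrite inE ps orbT.
have [ok1 ok2] := (wok_cat _ _ _ _ _).1 okq.
have El := C_last f Cq.
set e := expR (r1 * len q) in nq *.
(* The part [y] modulo [V] is handed to the induction with the constant [c * e]; the part [v] lies
   in [V] and is controlled along the whole rest of the word by [V_unif]. *)
set z1 := mat q *m z; pose y := Q *m z1; pose v := z1 - y.
have e_gt0 : 0 < e by exact: expR_gt0.
have yc : nrm y <= c * e by exact: hz.
have Vv : V v by apply/VQ; rewrite /v /y mulmxBr [Q *m (Q *m _)]mulmxA QQ subrr.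
have z1c : nrm z1 <= c0 * e * c by apply: nrmMle.
have vc : nrm v <= (c0 + 1) * c * e.
  apply: le_trans (nrmB _ _) _; apply: le_trans (lerD z1c yc) _.
  by rewrite le_eqVlt; apply/orP; left; apply/eqP; ring.
have yh w : C w -> ok (last_lab f q) w ->
    nrm (Q *m (mat w *m y)) <= c * e * expR (r1 * len w).
  move=> Cw okw.
  have -> : y = z1 - v by rewrite /v opprB addrC subrK.
  rewrite mulmxBr mulmxBr; have /VQ -> := V_inv El Cw okw Vv.
  rewrite subr0 /z1 [mat w *m _]mulmxA -wmat_cat -mulrA -expRD -mulrDr -wlen_cat.
  by apply: hz; [exact: (C_cat Ef Cq Cw ok1 okw)|exact: (wok_catI ok1 okw)].
have := IH _ (c * e) y El (mulr_ge0 c_ge0 (ltW e_gt0)) hqs ok2 yh yc.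
set w := flatten qs => IHy.
have hv : nrm (mat w *m v) <= (1 + cV) * expR (r1 * len w) * nrm v.
  case: (eqVneq qs [::]) => [qs0|qs0].
    rewrite /w qs0 /= mul1mx mulr0 expR0 mulr1 ler_peMl ?nrm_ge0 //.
    by rewrite lerDl.
  apply: le_trans (V_unif El (C_flatten El qs0 (fun q h => (hqs q h).1) ok2) ok2 Vv) _.
  rewrite ler_wpM2r ?nrm_ge0 // ler_wpM2r ?expR_ge0 //.
  by rewrite lerDr.
rewrite /= wmat_cat wlen_cat [r1 * (_ + _)]mulrDr expRD -/e -mulmxA -/z1 -/w.
have -> : z1 = y + v by rewrite addrC subrK.
rewrite mulmxDr; apply: le_trans (nrmD _ _) _.
have hv2 : nrm (mat w *m v) <= (1 + cV) * expR (r1 * len w) * ((c0 + 1) * c * e).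
  by apply: le_trans hv _; rewrite ler_wpM2l // mulr_ge0 ?expR_ge0 // addr_ge0.
apply: le_trans (lerD IHy hv2) _.
have -> : kap * c * ((size qs).+1%:R + 1) * (e * expR (r1 * len w)) =
  kap * (c * e) * ((size qs)%:R + 1) * expR (r1 * len w) + kap * (c * e * expR (r1 * len w)).
  by rewrite -[(size qs).+1]addn1 natrD; ring.
rewrite lerD2l; have -> : (1 + cV) * expR (r1 * len w) * ((c0 + 1) * c * e) =
  ((1 + cV) * (c0 + 1)) * (c * e * expR (r1 * len w)) by ring.
apply: ler_wpM2r; last by rewrite lerDr.
by rewrite !mulr_ge0 // ?expR_ge0 // ltW.
Qed.

(** The full orbit exceeds its quotient part by a factor linear in the number of groups, hence in
    the length; the larger rate [r2] absorbs this factor and [V2] concludes. *)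
Lemma quotient_bdd f c (z : 'cV[R]_n) : E f ->
  (forall w, C w -> ok f w -> nrm (Q *m (mat w *m z)) <= c * expR (r1 * len w)) -> V z.
Proof.
move=> Ef hz; apply: (V2 Ef).
pose c' := `|c| + nrm z.
have c'0 : 0 <= c' by rewrite addr_ge0 // nrm_ge0.
have k0 : 0 <= kap by rewrite /kap !addr_ge0 // mulr_ge0 // addr_ge0.
have hz' w : C w -> ok f w -> nrm (Q *m (mat w *m z)) <= c' * expR (r1 * len w).
  move=> Cw okw; apply: le_trans (hz _ Cw okw) _; apply: ler_wpM2r; first exact: expR_ge0.
  by apply: le_trans (ler_norm c) _; rewrite lerDl nrm_ge0.
pose dl := r2 - r1; have dl0 : 0 < dl by rewrite subr_gt0.
exists (kap * c' * (c1 / dl + c1 + 1)) => w Cw okw.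
have [qs [wE hq sq]] := C_split Ef Cw okw.
have := quotient_bdd_aux Ef c'0 hq; rewrite -wE => /(_ z okw hz').
have zc : nrm z <= c' by rewrite lerDr.
move=> /(_ zc) /le_trans; apply.
have l0 : 0 <= len w by exact: wlen_ge0.
have -> : r2 * len w = dl * len w + r1 * len w by rewrite /dl; ring.
rewrite expRD mulrA; apply: ler_wpM2r; first exact: expR_ge0.
rewrite -!mulrA; do 2!(apply: ler_wpM2l => //).
have x0 : 0 <= dl * len w by rewrite mulr_ge0 // ltW.
have h1 : 1 <= expR (dl * len w) by rewrite -expR0 ler_expR.
have h2 : len w <= expR (dl * len w) / dl.
  rewrite ler_pdivlMr // mulrC; apply: le_trans (expR_ge1Dx _).
  by rewrite lerDr.
have h3 : c1 * (len w + 1) <= c1 * (expR (dl * len w) / dl + expR (dl * len w)).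
  by apply: ler_wpM2l => //; apply: lerD.
apply: le_trans (_ : _ <= c1 * (expR (dl * len w) / dl + expR (dl * len w)) + expR (dl * len w)) _.
  by apply: lerD => //; apply: le_trans sq h3.
by rewrite le_eqVlt; apply/orP; left; apply/eqP; ring.
Qed.

Lemma quotient_growth f z G : E f -> ~ V z ->
  exists w, [/\ C w, ok f w & G * expR (r1 * len w) < nrm (Q *m (mat w *m z))].
Proof.
move=> Ef nVz; apply: contrapT => h; apply: nVz; apply: (@quotient_bdd f G) => // w Cw okw.
by rewrite leNgt; apply/negP => hw; apply: h; exists w.
Qed.

(** Two words serve all labels: a growing word [a :: w] may follow every label except [ls a], and a
    second one, chosen to be allowed after [ls a], serves that label. *)
Lemma growth_words z G : ~ V z ->
  exists ws : seq word, (forall w, w \in ws -> C w) /\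
    forall f, E f -> exists w, [/\ w \in ws, ok f w &
      G * expR (r1 * len w) < nrm (Q *m (mat w *m z))].
Proof.
move=> nVz; have [w [Cw okw hw]] := quotient_growth G Ef0 nVz.
case: w Cw okw hw => [|a w] Cw okw hw; first by have := C_nil Cw.
have [Ea|nEa] := pselect (E (ls a)); last first.
  exists [:: a :: w]; split=> [u|f Ef]; first by rewrite inE => /eqP ->.
  exists (a :: w); rewrite inE eqxx; split=> //=; split; last by case: okw.
  by move=> fa; apply: nEa; rewrite -fa.
have [w' [Cw' okw' hw']] := quotient_growth G Ea nVz.
case: w' Cw' okw' hw' => [|b w'] Cw' okw' hw'; first by have := C_nil Cw'.
exists [:: a :: w; b :: w']; split=> [u|f Ef].
  by rewrite !inE => /orP[] /eqP ->.
have [fa|fa] := pselect (f = ls a).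
  by exists (b :: w'); rewrite !inE eqxx orbT fa; split.
exists (a :: w); rewrite !inE eqxx; split=> //=; split=> //.
by case: okw.
Qed.

(* Compactness of the unit sphere of the complement of [V]. *)
Lemma finite_growth G : 0 <= G -> exists ws : seq word, (forall w, w \in ws -> C w) /\
  forall f (z : 'cV[R]_n), E f -> Q *m z = z -> z != 0 -> exists w,
    [/\ w \in ws, ok f w & G * expR (r1 * len w) * nrm z <= nrm (Q *m (mat w *m z))].
Proof.
move=> G0.
have /choice [g hg] : forall y : 'cV[R]_n, exists p : R * seq word,
    [/\ 0 < p.1, (forall w, w \in p.2 -> C w) & forall f (z : 'cV[R]_n), E f -> Q *m z = z ->
     nrm z = 1 -> nrm (z - y) < p.1 -> exists w,
     [/\ w \in p.2, ok f w & G * expR (r1 * len w) <= nrm (Q *m (mat w *m z))]].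
  move=> y; have [Vy|nVy] := pselect (V y).
    (* Near a vector of [V] there is no unit vector fixed by [Q], so the empty list of words is
       enough there. *)
    have q0 : 0 < nrm Q + 1 by rewrite ltr_wpDl ?nrm_ge0.
    exists ((nrm Q + 1)^-1, [::]); split=> /=; first by rewrite invr_gt0.
      by [].
    move=> f z Ef Qz z1 zy; exfalso.
    have zQ : z = Q *m (z - y) by rewrite mulmxBr Qz (VQ y).1 // subr0.
    have : 1 <= nrm Q * nrm (z - y) by rewrite -{1}z1 {1}zQ nrmM.
    apply/negP; rewrite -ltNge.
    apply: (@le_lt_trans _ _ ((nrm Q + 1) * nrm (z - y))).
      by rewrite ler_wpM2r ?nrm_ge0 // lerDl.
    by rewrite mulrC -ltr_pdivlMr // mul1r.
  (* Growth by [G + 1] at [y] leaves growth by [G] at every [z] close enough to [y]. *)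
  have [ws [wsC hws]] := growth_words (G + 1) nVy.
  have [dl dl0 hdl] : exists2 dl : R, 0 < dl & forall w, w \in ws ->
      nrm (Q *m mat w) * dl <= expR (r1 * len w).
    elim: ws {wsC hws} => [|w ws [dl dl0 IH]]; first by exists 1.
    pose d := expR (r1 * len w) / (nrm (Q *m mat w) + 1).
    have q0 : 0 < nrm (Q *m mat w) + 1 by rewrite ltr_wpDl ?nrm_ge0.
    have d0 : 0 < d by rewrite divr_gt0 // expR_gt0.
    exists (Num.min d dl) => [|u]; first by rewrite lt_min d0.
    rewrite inE => /orP[/eqP ->|/IH h].
      apply: (@le_trans _ _ ((nrm (Q *m mat w) + 1) * d)); last first.
        by rewrite mulrCA divff ?mulr1 ?gt_eqF.
      by apply: ler_pM; rewrite ?nrm_ge0 ?le_min ?(ltW d0) ?(ltW dl0) ?lerDl ?ge_min ?lexx.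
    apply: le_trans h; apply: ler_wpM2l; first exact: nrm_ge0.
    by rewrite ge_min lexx orbT.
  exists (dl, ws); split=> //= f z Ef Qz z1 zy.
  have [w [wws okw hw]] := hws f Ef; exists w; split=> //.
  rewrite -(lerD2r (expR (r1 * len w))).
  have -> : G * expR (r1 * len w) + expR (r1 * len w) = (G + 1) * expR (r1 * len w) by ring.
  apply: le_trans (ltW hw) _; apply: le_trans (nrm_tri _ (Q *m (mat w *m z))) _.
  rewrite lerD2l; apply: le_trans (hdl _ wws).
  rewrite -!mulmxBr mulmxA; apply: nrmMle => //.
  by rewrite nrmBC ltW.
have [ys hys] := @mx_finite_net R n 1 (fun y => (g y).1) 1 (fun y => let: And3 h _ _ := hg y in h).
exists (flatten [seq (g y).2 | y <- ys]); split.
  move=> w /flattenP[s /mapP[y _ ->]] ws.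
  by have [_ h _] := hg y; apply: h.
move=> f z Ef Qz z0; have nz : 0 < nrm z by rewrite nrm_gt0.
pose u := (nrm z)^-1 *: z.
have nu : nrm u = 1 by rewrite nrmZ ger0_norm ?invr_ge0 ?ltW // mulVf // gt_eqF.
have [|y yys uy] := hys u; first by rewrite nu.
have [_ _ h] := hg y; have [|//|//|w [wg okw hw]] := h f u Ef.
  by rewrite /u -scalemxAr Qz.
exists w; split=> //; first by apply/flattenP; exists (g y).2 => //; apply/mapP; exists y.
rewrite -ler_pdivlMr // [_ / nrm z]mulrC; move: hw.
by rewrite /u -!scalemxAr nrmZ ger0_norm // invr_ge0 nrm_ge0.
Qed.

(** Relative to [expR (r1 * len w)], a vector modulo [V] grows by [cV + 2] along a suitable word
    while vectors of [V] grow by at most [cV]. The cone is therefore mapped strictly into itself,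
    with a margin for the perturbation. *)
Lemma cone_step : exists (ws : seq word) (eta L : R), [/\ 0 < eta, 0 <= L,
  (forall w, w \in ws -> C w) &
  forall A' : X -> 'M[R]_n, (forall w, w \in ws -> nrm (wmat A' w - mat w) <= eta) ->
  forall f (x : 'cV[R]_n), E f -> Q *m x != 0 -> nrm (x - Q *m x) <= L * nrm (Q *m x) ->
  exists w, let x' := wmat A' w *m x in [/\ w \in ws, ok f w,
    expR (r1 * len w) * nrm (Q *m x) <= nrm (Q *m x') &
    nrm (x' - Q *m x') <= L * nrm (Q *m x')]].
Proof.
have G0 : 0 <= cV + 2 by rewrite addr_ge0.
have [ws [wsC hws]] := finite_growth G0.
have [C' [m [C'0 m0 hC']]] : exists C' m : R, [/\ 0 <= C', 0 < m & forall w, w \in ws ->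
    nrm (mat w) <= C' * expR (r1 * len w) /\ m <= expR (r1 * len w)].
  elim: ws {wsC hws} => [|w ws [C' [m [C'0 m0 IH]]]]; first by exists 0, 1.
  pose d := nrm (mat w) / expR (r1 * len w).
  exists (Num.max d C'), (Num.min (expR (r1 * len w)) m); split.
  - by rewrite le_max C'0 orbT.
  - by rewrite lt_min expR_gt0.
  - move=> u; rewrite inE => /orP[/eqP ->|/IH [h1 h2]].
      split; last by rewrite ge_min lexx.
      by rewrite -ler_pdivrMr ?expR_gt0 // le_max lexx.
    split; last by rewrite ge_min h2 orbT.
    by apply: le_trans h1 _; apply: ler_wpM2r; rewrite ?expR_ge0 // le_max lexx orbT.
pose q := nrm Q; pose p := nrm (1%:M - Q).
have q0 : 0 <= q by exact: nrm_ge0.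
have p0 : 0 <= p by exact: nrm_ge0.
(* [p * C'] bounds what the image of [Q *m x] contributes inside [V], and [L] exceeds it. [S]
   gathers the perturbation terms of both conclusions, so that a relative error [e0] costs at most
   1; the factor [m] turns it into an absolute error. *)
pose L := p * C' + 1; have L0 : 0 <= L by rewrite addr_ge0 // mulr_ge0.
pose S := (L + 1) * (p + q * L + q) + 1.
have S0 : 0 < S.
  by rewrite ltr_wpDl // mulr_ge0 ?addr_ge0 // mulr_ge0.
pose e0 := S^-1; have e00 : 0 < e0 by rewrite invr_gt0.
have e0S : e0 * ((L + 1) * (p + q * L + q)) <= 1.
  have -> : (L + 1) * (p + q * L + q) = S - 1 by rewrite /S addrK.
  by rewrite mulrBr mulVf ?gt_eqF // mulr1 gerBl ltW.
exists ws, (m * e0), L; split=> //; first by rewrite mulr_gt0.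
move=> A' hA' f x Ef Qx0 cone.
pose z := Q *m x; pose v := x - z.
have Qz : Q *m z = z by rewrite /z mulmxA QQ.
have Vv : V v by apply/VQ; rewrite /v mulmxBr Qz subrr.
have [w [wws okw hw]] := hws f z Ef Qz Qx0; exists w.
have Cw := wsC w wws; have [hC hm] := hC' w wws.
set e := expR (r1 * len w) in hw hC hm *.
have e_gt0 : 0 < e by exact: expR_gt0.
pose Dx := (wmat A' w - mat w) *m x.
have nz0 : 0 <= nrm z by exact: nrm_ge0.
have xE : wmat A' w *m x = mat w *m z + mat w *m v + Dx.
  by rewrite /Dx mulmxBl -mulmxDr /v [z + _]addrC subrK addrC subrK.
have nx : nrm x <= (L + 1) * nrm z.
  by rewrite mulrDl mul1r addrC; apply: le_trans (nrm_tri _ z) _; rewrite lerD2l.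
have nD : nrm Dx <= e * e0 * (L + 1) * nrm z.
  rewrite -[leRHS]mulrA; apply: nrmMle => //; apply: le_trans (hA' _ wws) _.
  by apply: ler_wpM2r => //; exact: ltW.
have VAv : Q *m (mat w *m v) = 0 by apply/VQ; exact: (V_inv Ef Cw okw Vv).
have Qx' : Q *m (wmat A' w *m x) = Q *m (mat w *m z) + Q *m Dx.
  by rewrite xE [Q *m (_ + Dx)]mulmxDr [Q *m (mat w *m z + _)]mulmxDr VAv addr0.
have zx' : (cV + 2) * e * nrm z - q * (e * e0 * (L + 1) * nrm z) <=
  nrm (Q *m (wmat A' w *m x)).
  rewrite lerBlDr Qx'; apply: le_trans hw _.
  apply: le_trans (nrm_tri _ (Q *m (mat w *m z) + Q *m Dx)) _.
  by rewrite lerD2l opprD addrA subrr sub0r nrmN; exact: nrmMle.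
have ez0 : 0 <= e * nrm z by rewrite mulr_ge0 // ltW.
have b1 : q * (e0 * (L + 1)) <= 1.
  apply: le_trans e0S; rewrite mulrCA; apply: ler_wpM2l; first exact: ltW.
  rewrite mulrC; apply: ler_wpM2l; first exact: addr_ge0.
  by rewrite lerDr addr_ge0 // mulr_ge0.
split=> //=.
- apply: le_trans zx'.
  have -> : (cV + 2) * e * nrm z - q * (e * e0 * (L + 1) * nrm z) =
    (cV + 2 - q * (e0 * (L + 1))) * (e * nrm z) by ring.
  by rewrite -{1}(mul1r (e * nrm z)); apply: ler_wpM2r => //; move: b1 cV_ge0; move: (q * (e0 * (L + 1))) => t; lra.
- have -> : wmat A' w *m x - Q *m (wmat A' w *m x) =
    (1%:M - Q) *m (mat w *m z) + mat w *m v + (1%:M - Q) *m Dx.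
    rewrite Qx' xE [(1%:M - Q) *m (mat w *m z)]mulmxBl [(1%:M - Q) *m Dx]mulmxBl !mul1mx.
    by rewrite opprD addrACA (addrAC (mat w *m z)).
  have b2 : nrm ((1%:M - Q) *m (mat w *m z)) <= p * (C' * e * nrm z).
    by apply: nrmMle => //; apply: nrmMle.
  have b3 : nrm (mat w *m v) <= cV * e * (L * nrm z).
    apply: le_trans (V_unif Ef Cw okw Vv) _; apply: ler_wpM2l => //.
    by rewrite mulr_ge0 // ltW.
  have b4 : nrm ((1%:M - Q) *m Dx) <= p * (e * e0 * (L + 1) * nrm z) by exact: nrmMle.
  apply: le_trans (nrmD _ _) _; apply: le_trans (lerD (nrmD _ _) b4) _.
  apply: le_trans (lerD (lerD b2 b3) (lexx _)) _.
  apply: le_trans (ler_wpM2l L0 zx').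
  rewrite -subr_ge0.
  have -> : L * ((cV + 2) * e * nrm z - q * (e * e0 * (L + 1) * nrm z)) -
    (p * (C' * e * nrm z) + cV * e * (L * nrm z) + p * (e * e0 * (L + 1) * nrm z)) =
    (2 * L - p * C' - e0 * ((L + 1) * (p + q * L))) * (e * nrm z) by ring.
  apply: mulr_ge0 => //.
  have : e0 * ((L + 1) * (p + q * L)) <= 1.
    apply: le_trans e0S; apply: ler_wpM2l; first exact: ltW.
    by apply: ler_wpM2l; [exact: addr_ge0|rewrite lerDl].
  have : 0 <= p * C' by exact: mulr_ge0.
  move: (e0 * _) => t; rewrite /L; move: (p * C') => s; lra.
Qed.

End WithProjection.

(** Iterating [cone_step] on pairs of a last label and a current vector keeps the vector in the cone
    and multiplies its part modulo [V] by at least [expR (r1 * len w)] for each word used. *)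
Theorem robust_growth : exists (ws : seq word) (eta : R), [/\ 0 < eta,
  (forall w, w \in ws -> C w) &
  forall A' : X -> 'M[R]_n, (forall w, w \in ws -> nrm (wmat A' w - mat w) <= eta) ->
  exists (u : nat -> word) (x : 'cV[R]_n) (c : R), [/\ x != 0, 0 < c,
    (forall k, u k \in ws),
    (forall k, ok f0 (flatten (mkseq u k))) &
    forall k, c * expR (r1 * len (flatten (mkseq u k))) <=
      nrm (wmat A' (flatten (mkseq u k)) *m x)]].
Proof.
have [Q [VQ QQ]] := V_proj.
have [ws [eta [L [eta0 L0 wsC step]]]] := cone_step VQ QQ.
exists ws, eta; split=> // A' /step {}step.
have [z0 nVz0] := V_proper; pose x0 := Q *m z0.
have x00 : x0 != 0 by apply/eqP => /VQ.
have Qx0 : Q *m x0 = x0 by rewrite /x0 mulmxA QQ.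
pose good (p : Lab * 'cV[R]_n) := [/\ E p.1, Q *m p.2 != 0 &
  nrm (p.2 - Q *m p.2) <= L * nrm (Q *m p.2)].
have /choice [g hg] : forall p : Lab * 'cV[R]_n, exists w, good p ->
    let x' := wmat A' w *m p.2 in [/\ w \in ws, ok p.1 w,
    expR (r1 * len w) * nrm (Q *m p.2) <= nrm (Q *m x') &
    nrm (x' - Q *m x') <= L * nrm (Q *m x')].
  move=> [f x]; have [[Ef h1 h2]|ng] := pselect (good (f, x)); last by exists [::].
  by have [w hw] := step f x Ef h1 h2; exists w.
pose next (p : Lab * 'cV[R]_n) := (last_lab p.1 (g p), wmat A' (g p) *m p.2).
pose st k := iter k next (f0, x0).
have gst k : good (st k).
  elim: k => [|k IH]; first by split=> //=; rewrite Qx0 ?subrr ?nrm0 ?mulr_ge0 ?nrm_ge0.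
  have [_ h _] := IH; have [h1 h2 h3 h4] := hg _ IH.
  split=> //=; first by apply: C_last; apply: wsC.
  rewrite -nrm_gt0; apply: lt_le_trans h3; rewrite mulr_gt0 ?expR_gt0 // nrm_gt0 //.
pose u k := g (st k).
have flS k : flatten (mkseq u k.+1) = flatten (mkseq u k) ++ u k.
  by rewrite mkseqS flatten_rcons.
have stE k : st k = (last_lab f0 (flatten (mkseq u k)), wmat A' (flatten (mkseq u k)) *m x0).
  elim: k => [|k IH]; first by rewrite /= mul1mx.
  by rewrite flS wlast_cat wmat_cat (_ : st k.+1 = next (st k)) // /next -/(u k) IH /= mulmxA.
have q0 : 0 < nrm Q + 1 by rewrite ltr_wpDl ?nrm_ge0.
exists u, x0, (nrm x0 / (nrm Q + 1)); split=> //.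
- by rewrite divr_gt0 // nrm_gt0.
- by move=> k; have [] := hg _ (gst k).
- elim=> [//|k IH]; rewrite flS; apply: wok_catI => //.
  by have [_ + _ _] := hg _ (gst k); rewrite {1}stE.
- have key k : expR (r1 * len (flatten (mkseq u k))) * nrm x0 <= nrm (Q *m (st k).2).
    elim: k => [|k IH]; first by rewrite /= mulr0 expR0 mul1r Qx0.
    have [_ _ h _] := hg _ (gst k); apply: le_trans h.
    rewrite flS wlen_cat mulrDr expRD mulrAC mulrC.
    by apply: ler_wpM2l; rewrite ?expR_ge0.
  move=> k; rewrite mulrAC ler_pdivrMr // mulrC; apply: le_trans (key k) _.
  rewrite stE /= mulrC; apply: nrmMle => //.
  by rewrite lerDl.
Qed.

End Robust.

(** * Powers of a single matrix *)

Section LinearPredicates.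
Variables (R : realType) (n : nat).

Definition linear_pred (V : 'cV[R]_n -> Prop) :=
  V 0 /\ forall a u v, V u -> V v -> V (a *: u + v).

(** A predicate of largest dimension in the family cannot be enlarged within it. Applied to bounded
    vectors, which increase with the rate, this selects the rate. *)
Lemma max_linear_pred (I : Type) (P : I -> Prop) (U : I -> 'cV[R]_n -> Prop) :
  (exists i, P i) -> (forall i, P i -> linear_pred (U i)) ->
  exists i, P i /\ forall j, P j -> (forall v, U i v -> U j v) -> forall v, U j v -> U i v.
Proof.
move=> [i0 Pi0] Ulin.
pose D k := `[< exists i (S : {vspace 'cV[R]_n}),
  [/\ P i, \dim S = k & forall v, v \in S <-> U i v] >].
have vs i : P i -> exists S : {vspace 'cV[R]_n}, forall v, v \in S <-> U i v.
  by move=> /Ulin[U0 UD]; exact: linear_pred_vspace.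
have D0 : exists k, D k.
  by have [S hS] := vs _ Pi0; exists (\dim S); apply/asboolP; exists i0, S.
have Db k : D k -> (k <= \dim {:'cV[R]_n})%N.
  by move=> /asboolP[i [S [_ <- _]]]; apply: dimvS (subvf S).
case: (ex_maxnP D0 Db) => k /asboolP[i [S [Pi Sk hS]]] kmax.
exists i; split=> // j Pj ij v.
have [S' hS'] := vs _ Pj.
have SS' : (S <= S')%VS by apply/subvP => u /hS /ij /hS'.
have /eqP eS : S == S'.
  by rewrite eqEdim SS' Sk kmax //; apply/asboolP; exists j, S'.
by move=> /hS'; rewrite -eS => /hS.
Qed.

(** Uniform boundedness in finite dimension: it is enough to bound the images of the basis vectors
    projected into [V]. *)
Lemma linear_pred_unif (T : Type) (D : T -> Prop) (B : T -> 'M[R]_n) (e : T -> R)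
    (V : 'cV[R]_n -> Prop) : linear_pred V -> (forall t, 0 <= e t) ->
  (forall v, V v -> exists c, forall t, D t -> nrm (B t *m v) <= c * e t) ->
  exists2 c, 0 <= c & forall t v, D t -> V v -> nrm (B t *m v) <= c * e t * nrm v.
Proof.
move=> [V0 VD] e0 h.
have [U hU] := @linear_pred_vspace R 'cV[R]_n V V0 VD.
have [Q [hQ QQ]] := vspace_proj U.
pose P := 1%:M - Q.
have PV v : V (P *m v).
  by apply/hU; rewrite hQ mulmxA mulmxBr mulmx1 QQ subrr mul0mx.
have /choice [c hc] : forall j : 'I_n, exists c, forall t, D t ->
    nrm (B t *m (P *m delta_mx j (0 : 'I_1))) <= c * e t by move=> j; apply: h.
exists (\sum_j `|c j|) => [|t v Dt Vv]; first exact: sumr_ge0.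
have vE : v = P *m v.
  by rewrite mulmxBl mul1mx (_ : Q *m v = 0) ?subr0 //; apply/eqP; rewrite -hQ; apply/hU.
have ev : v = \sum_j v j 0 *: delta_mx j 0.
  apply/matrixP => i j; rewrite ord1 summxE (bigD1 i) //= big1 ?addr0 => [|k ki].
    by rewrite !mxE !eqxx mulr1.
  by rewrite !mxE eq_sym (negbTE ki) mulr0.
have -> : B t *m v = \sum_j v j 0 *: (B t *m (P *m delta_mx j 0)).
  rewrite {1}vE {1}ev mulmxA mulmx_sumr; apply: eq_bigr => j _.
  by rewrite -scalemxAr mulmxA.
have nsum (s : seq 'I_n) (F : 'I_n -> 'cV[R]_n) :
    nrm (\sum_(j <- s) F j) <= \sum_(j <- s) nrm (F j).
  elim: s => [|j s IH]; first by rewrite !big_nil nrm0.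
  by rewrite !big_cons; apply: le_trans (nrmD _ _) _; rewrite lerD2l.
apply: le_trans (nsum _ _) _.
rewrite !mulr_suml; apply: ler_sum => j _; rewrite nrmZ mulrC.
apply: ler_pM; rewrite ?nrm_ge0 ?normr_ge0 ?nrm_entry //.
apply: le_trans (hc j t Dt) _.
by apply: ler_wpM2r => //; exact: ler_norm.
Qed.

End LinearPredicates.

Section Powers.
Variables (R : realType) (n : nat).

Definition mpow (A : 'M[R]_n) (k : nat) : 'M[R]_n := iter k (mulmx A) 1%:M.

Lemma mpowS A k : mpow A k.+1 = A *m mpow A k. Proof. by []. Qed.

Lemma mpowD A j k : mpow A (j + k) = mpow A j *m mpow A k.
Proof. by elim: j => [|j IH]; rewrite ?mul1mx // addSn !mpowS IH mulmxA. Qed.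

Definition power_rate_bdd (A : 'M[R]_n) (r : R) :=
  exists c, forall k, nrm (mpow A k) <= c * expR (r * k%:R).

Lemma wmat_unit (A : 'M[R]_n) (w : seq unit) : wmat (fun=> A) w = mpow A (size w).
Proof.
elim: w => [//|a w IH]; rewrite /= IH -/(mpow A _).
elim: (size w) => [|k IHk]; first by rewrite mulmx1 mul1mx.
by rewrite mpowS -mulmxA IHk.
Qed.

Lemma wlen_unit (w : seq unit) : wlen (fun=> 1 : R) w = (size w)%:R.
Proof. by elim: w => [//|a w IH]; rewrite /= IH nat1r. Qed.

(** This is [robust_growth] over a one-letter alphabet. The letter starts with [true] and ends with
    [false], so no concatenation is ever forbidden; words become exponents. *)
Lemma power_growth (A : 'M[R]_n) (r0 r' : R) : r0 < r' -> ~ power_rate_bdd A r' ->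
  exists (N : nat) (eta : R), 0 < eta /\
  forall A', (forall k, (k <= N)%N -> nrm (mpow A' k - mpow A k) <= eta) ->
  exists (u : nat -> nat) (x : 'cV[R]_n) (c : R), [/\ x != 0, 0 < c,
    (forall k, (0 < u k <= N)%N) &
    forall k, c * expR (r0 * (\sum_(i < k) u i)%N%:R) <= nrm (mpow A' (\sum_(i < k) u i)%N *m x)].
Proof.
move=> r0r' nb.
pose C (w : seq unit) := w <> [::].
pose ls (_ : unit) := true; pose le (_ : unit) := false.
pose U r (z : 'cV[R]_n) := rate_bdd ls le (fun=> 1) (fun=> A) C r false z.
(* At a rate [r1] of maximal dimension, every [r2] between [r1] and [r'] yields the same bounded
   vectors. *)
have [||r1 [/andP[r01 r1r'] hr1]] := @max_linear_pred R n R (fun r => r0 <= r < r') U.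
- by exists r0; rewrite lexx.
- by move=> r _; split; [exact: rate_bdd0|exact: rate_bdd_lin].
have okw w : wok ls le false w by elim: w => //= a w IH; split.
have Umono r s z : r <= s -> U r z -> U s z.
  move=> rs [c hc]; exists `|c| => w Cw ok; apply: le_trans (hc w Cw ok) _.
  apply: (@le_trans _ _ (`|c| * expR (r * wlen (fun=> 1) w))).
    by apply: ler_wpM2r; rewrite ?expR_ge0 ?ler_norm.
  apply: ler_wpM2l => //; rewrite ler_expR; apply: ler_wpM2r => //.
  exact: wlen_ge0.
pose r2 := (r1 + r') / 2.
have r12 : r1 < r2 by rewrite /r2; lra.
have r2r' : r2 < r' by rewrite /r2; lra.
have Ulin r : linear_pred (U r) by split; [exact: rate_bdd0|exact: rate_bdd_lin].
have [||cV cV0 hcV] := @linear_pred_unif R n _ (fun w => C w /\ wok ls le false w)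
  (wmat (fun=> A)) (fun w => expR (r1 * wlen (fun=> 1) w)) (U r1) (Ulin r1).
- by move=> w; exact: expR_ge0.
- by move=> v [c hc]; exists c => w [Cw ok]; exact: hc.
pose c0 := nrm A * expR (- r1).
have c00 : 0 <= c0 by rewrite mulr_ge0 ?nrm_ge0 ?expR_ge0.
have [||||||||||ws [eta [eta0 wsC hws]]] := @robust_growth R n _ _ ls le (fun=> 1) (fun=> A)
   C (fun f => f = false) (U r1) r1 r2 c0 1 cV false r12 c00 ler01 cV0.
- by [].
- by [].
- by move=> f w; case/lastP: w => [//|w a _]; rewrite /wlast foldl_rcons.
- by move=> f [|a w] w' //= _ h _ _ _.
- move=> f w _ Cw _; exists [seq [:: a] | a <- w]; split.
  + by elim: (w) => //= a u <-.
  + move=> q /mapP[a _ ->]; split=> //=.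
    by rewrite mul1mx addr0 mulr1 /c0 -mulrA -expRD addNr expR0 mulr1.
  + by rewrite size_map wlen_unit mul1r lerDl.
- by move=> f z ->.
- by move=> f z -> Uz; apply: hr1 Uz; rewrite ?r2r' ?(le_trans r01 (ltW r12)) // => v; apply: Umono; exact: ltW.
- by move=> f w z -> Cw ok Uz; apply: hcV.
- apply: contrapT => /forallNP nV; apply: nb.
  exists (n%:R * (1 + cV)) => k; rewrite -mulrA; apply: nrm_le_apply => v.
  apply: (@le_trans _ _ ((1 + cV) * expR (r1 * k%:R) * nrm v)); last first.
    apply: ler_wpM2r; first exact: nrm_ge0.
    apply: ler_wpM2l; rewrite ?addr_ge0 // ler_expR; apply: ler_wpM2r => //; exact: ltW.
  case: k => [|k].
    rewrite mul1mx mulr0 expR0 mulr1 ler_peMl ?nrm_ge0 //.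
    by rewrite lerDl.
  have := hcV (nseq k.+1 tt) v (conj _ (okw _)); rewrite wmat_unit wlen_unit size_nseq.
  move=> h; apply: le_trans (h _ _) _ => //; first by apply: contrapT; exact: nV.
  by do 2!(apply: ler_wpM2r; rewrite ?nrm_ge0 ?expR_ge0 //); rewrite lerDr.
- by [].
pose N := \max_(w <- ws) size w.
have wsN w : w \in ws -> (size w <= N)%N by move=> wws; apply: leq_bigmax_seq.
exists N, eta; split=> // A' hA'.
have [|u [x [c [x0 c0' uws _ hu]]]] := hws (fun=> A').
  by move=> w wws; rewrite !wmat_unit; apply: hA'; apply: wsN.
have szE k : size (flatten (mkseq u k)) = (\sum_(i < k) size (u i))%N.
  by elim: k => [|k IH]; rewrite ?big_ord0 // mkseqS flatten_rcons size_cat IH big_ord_recr.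
exists (size \o u), x, c; split=> //.
  move=> k; rewrite /= wsN // andbT lt0n; apply/eqP => /size0nil; exact: wsC.
move=> k; have := hu k; rewrite wmat_unit wlen_unit szE; apply: le_trans.
apply: ler_wpM2l; first exact: ltW.
by rewrite ler_expR; apply: ler_wpM2r.
Qed.

(* A bounded family of matrices whose powers are individually bounded at rate [r] is
   uniformly bounded at any larger rate: at a limit point, [power_growth] forbids
   a larger rate, and a contraction of some power at rate [r'] is an open condition. *)
Lemma power_rate_unif (S : 'M[R]_n -> Prop) (b r r' : R) : r < r' ->
  (forall A, S A -> nrm A <= b) -> (forall A, S A -> power_rate_bdd A r) ->
  exists c, forall A, S A -> forall k, nrm (mpow A k) <= c * expR (r' * k%:R).
Proof.
move=> rr' Sb Sr.
have cont (A : 'M[R]_n) N (eta : R) : 0 < eta -> exists2 dl : R, 0 < dl &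
   forall A', nrm (A' - A) < dl -> forall k, (k <= N)%N -> nrm (mpow A' k - mpow A k) <= eta.
  elim: N eta => [|N IH] eta eta0.
    exists 1 => // A' _ [|//] _; rewrite subrr nrm0; exact: ltW.
  pose q := nrm A + 1 + nrm (mpow A N) + 1.
  have q0 : 1 <= q by rewrite /q lerDr !addr_ge0 ?nrm_ge0.
  have q0' : 0 < q by exact: lt_le_trans q0.
  have qq0 : 0 < q + q by exact: addr_gt0.
  pose e := eta / (q + q); have e0 : 0 < e by rewrite divr_gt0.
  have [dl dl0 hdl] := IH e e0.
  exists (Num.min dl (Num.min 1 e)) => [|A' hA'].
    by rewrite !lt_min dl0 ltr01.
  move: hA'; rewrite !lt_min => /and3P[h1 h2 h3] k.
  have eeta : e <= eta.
    rewrite /e ler_pdivrMr //; apply: ler_peMr; first exact: ltW.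
    by apply: le_trans q0 _; rewrite lerDl ltW.
  rewrite leq_eqVlt => /orP[/eqP ->|]; last first.
    by rewrite ltnS => kN; apply: le_trans (hdl _ h1 _ kN) _.
  have -> : mpow A' N.+1 - mpow A N.+1 =
      A' *m (mpow A' N - mpow A N) + (A' - A) *m mpow A N.
    by rewrite mulmxBr mulmxBl -!mpowS addrA subrK.
  apply: le_trans (nrmD _ _) _.
  have -> : eta = q * e + q * e by rewrite -mulrDl /e mulrC divfK // gt_eqF.
  apply: lerD.
    apply: nrmMle; last exact: hdl.
    apply: le_trans (nrm_tri _ A) _; rewrite /q -!addrA; apply: lerD => //.
    by apply: le_trans (ltW h2) _; rewrite lerDl addr_ge0 // nrm_ge0.
  rewrite mulrC; apply: nrmMle; first exact: ltW.
  rewrite /q -addrA [nrm (mpow A N) + 1]addrC addrA lerDr !addr_ge0 ?nrm_ge0 //.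
pose rm := (r + r') / 2.
have rrm : r < rm by rewrite /rm; lra.
have rmr' : rm < r' by rewrite /rm; lra.
have /choice [g hg] : forall A : 'M[R]_n, exists p : R * R, 0 < p.1 /\
    forall A', S A' -> nrm (A' - A) < p.1 -> forall k, nrm (mpow A' k) <= p.2 * expR (r' * k%:R).
  move=> A; have [[c hc]|nb] := pselect (power_rate_bdd A rm); last first.
    have rrm' : (r + rm) / 2 < rm by lra.
    have [N [eta [eta0 hN]]] := power_growth rrm' nb.
    have [dl dl0 hdl] := cont A N eta eta0.
    (* The constant 0 is a default: no member of [S] lies within [dl] of such an [A]. *)
    exists (dl, 0); split=> //= A' SA' AA'; exfalso.
    have [u [x [c [x0 c0 uN hu]]]] := hN A' (hdl A' AA').
    have [c' hc'] := Sr A' SA'.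
    pose s k := (\sum_(i < k) u i)%N.
    have sk k : (k <= s k)%N.
      elim: k => [//|k IH]; rewrite /s big_ord_recr /= -addn1; apply: leq_add => //.
      by have /andP[] := uN k.
    pose d := (rm - r) / 2; have d0 : 0 < d by rewrite /d; lra.
    have key k : c * (d * k%:R) <= `|c'| * nrm x.
      have := le_trans (hu k) (nrmM _ _); rewrite -/(s k) => h.
      have h2 : c * expR ((r + rm) / 2 * (s k)%:R) <= `|c'| * nrm x * expR (r * (s k)%:R).
        apply: le_trans h _; rewrite mulrAC; apply: ler_wpM2r; first exact: nrm_ge0.
        apply: le_trans (hc' _) _; apply: ler_wpM2r; rewrite ?expR_ge0 //; exact: ler_norm.
      have e1 : (r + rm) / 2 * (s k)%:R = d * (s k)%:R + r * (s k)%:R by rewrite /d; field.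
      move: h2; rewrite e1 expRD mulrA ler_pM2r ?expR_gt0 //; apply: le_trans.
      apply: ler_wpM2l; first exact: ltW.
      apply: le_trans (expR_ge1Dx _); apply: le_trans (_ : d * (s k)%:R <= _).
        by apply: ler_wpM2l; [exact: ltW|rewrite ler_nat].
      by rewrite lerDr.
    have cd0 : 0 < c * d by exact: mulr_gt0.
    have := archi_boundP (divr_ge0 (mulr_ge0 (normr_ge0 c') (nrm_ge0 x)) (ltW cd0)).
    set k := Num.bound _; rewrite ltr_pdivrMr // [k%:R * _]mulrC -mulrA => hk.
    by have := lt_le_trans hk (key k); rewrite ltxx.
  have [k0 k0p hk0] : exists2 k, (0 < k)%N & nrm (mpow A k) < expR (r' * k%:R).
    pose d := r' - rm; have d0 : 0 < d by rewrite subr_gt0.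
    have := archi_boundP (divr_ge0 (normr_ge0 c) (ltW d0)).
    set k := Num.bound _; rewrite ltr_pdivrMr // [k%:R * _]mulrC => hk.
    exists k.+1 => //; apply: le_lt_trans (hc _) _.
    have -> : r' * k.+1%:R = d * k.+1%:R + rm * k.+1%:R by rewrite /d; ring.
    rewrite expRD ltr_pM2r ?expR_gt0 //; apply: le_lt_trans (ler_norm _) _.
    apply: lt_le_trans hk _; apply: le_trans (expR_ge1Dx _).
    by apply: le_trans (_ : d * k.+1%:R <= _); rewrite ?lerDr // ler_pM2l // ler_nat.
  pose eta := expR (r' * k0%:R) - nrm (mpow A k0).
  have eta0 : 0 < eta by rewrite subr_gt0.
  have [dl dl0 hdl] := cont A k0 eta eta0.
  pose M := \sum_(j < k0) (nrm (mpow A j) + eta) * expR (- r' * j%:R).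
  exists (dl, M); split=> //= A' SA' AA' k.
  have h0 : nrm (mpow A' k0) <= expR (r' * k0%:R).
    apply: le_trans (nrm_tri _ (mpow A k0)) _; rewrite -lerBrDl; exact: hdl.
  have small j : (j < k0)%N -> nrm (mpow A' j) <= M * expR (r' * j%:R).
    move=> jk; rewrite -ler_pdivrMr ?expR_gt0 // -expRN -mulNr.
    rewrite /M (bigD1 (Ordinal jk)) //=; apply: ler_wpDr.
      apply: sumr_ge0 => i _; apply: mulr_ge0; last exact: expR_ge0.
      by apply: addr_ge0; [exact: nrm_ge0|exact: ltW].
    apply: ler_wpM2r; rewrite ?expR_ge0 //; apply: le_trans (nrm_tri _ (mpow A j)) _.
    by rewrite lerD2l; apply: hdl => //; exact: ltnW.
  elim/ltn_ind: k => k IH; have [kk0|k0k] := ltnP k k0; first exact: small.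
  have -> : k = (k0 + (k - k0))%N by rewrite subnKC.
  rewrite mpowD natrD mulrDr expRD mulrCA; apply: nrmMle => //; apply: IH.
  by rewrite ltn_subrL k0p (leq_trans k0p).
have [As hAs] := @mx_finite_net R n n (fun A => (g A).1) b (fun A => (hg A).1).
exists (\sum_(A <- As) `|(g A).2|) => A SA k.
have [B BAs AB] := hAs A (Sb A SA).
apply: le_trans ((hg B).2 A SA AB k) _; apply: ler_wpM2r; first exact: expR_ge0.
rewrite (big_rem B) //=; apply: le_trans (ler_norm _) _; rewrite lerDl.
exact: sumr_ge0.
Qed.

End Powers.

(** * Growing words over a set of modes *)

Section WordGrowth.
Variables (R : realType) (n : nat) (X : eqType) (M : Type).
Variables (m : X -> M) (wt : X -> R) (B : X -> 'M[R]_n) (Lt : X -> Prop).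
Hypothesis wt_ge0 : forall a, 0 <= wt a.
Notation word := (seq X).
Notation lb := (fun a : X => Some (m a)).
Notation ok := (wok lb lb).
Notation mat := (wmat B).
Notation len := (wlen wt).

Definition inH (H : M -> Prop) (w : word) := forall a, a \in w -> Lt a /\ H (m a).

Lemma inH_cat H w1 w2 : inH H (w1 ++ w2) <-> inH H w1 /\ inH H w2.
Proof.
split=> [h|[h1 h2] a]; last by rewrite mem_cat => /orP[/h1|/h2].
by split=> a aw; apply: h; rewrite mem_cat aw ?orbT.
Qed.

Lemma inH_cons H a w : inH H (a :: w) <-> (Lt a /\ H (m a)) /\ inH H w.
Proof.
split=> [h|[h1 h2] b]; last by rewrite inE => /orP[/eqP ->|/h2].
by split=> [|b bw]; apply: h; rewrite inE ?eqxx ?bw ?orbT.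
Qed.

Lemma inH_sub (H H' : M -> Prop) w : (forall s, H s -> H' s) -> inH H w -> inH H' w.
Proof. by move=> HH' h a /h[h1 h2]; split=> //; exact: HH'. Qed.

Lemma ok_None f w : ok f w -> ok None w.
Proof. by case: w => //= a w [_ h]; split. Qed.

Lemma len_ge0 w : 0 <= len w. Proof. exact: wlen_ge0. Qed.

Definition bddH (H : M -> Prop) (r : R) :=
  exists c, forall w, inH H w -> ok None w -> nrm (mat w) <= c * expR (r * len w).

Lemma rate_mono (r s c t : R) w : r <= s -> 0 <= t ->
  t <= c * expR (r * len w) -> t <= `|c| * expR (s * len w).
Proof.
move=> rs t0 h; apply: le_trans h _.
apply: (@le_trans _ _ (`|c| * expR (r * len w))).
  by apply: ler_wpM2r; rewrite ?expR_ge0 ?ler_norm.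
by apply: ler_wpM2l => //; rewrite ler_expR; apply: ler_wpM2r => //; exact: len_ge0.
Qed.

Lemma bddH_mono H r s : r <= s -> bddH H r -> bddH H s.
Proof.
by move=> rs [c hc]; exists `|c| => w hw okw; apply: (rate_mono rs); rewrite ?nrm_ge0 ?hc.
Qed.

Lemma bddH_ge0 H r : bddH H r ->
  exists2 c, 0 <= c & forall w, inH H w -> ok None w -> nrm (mat w) <= c * expR (r * len w).
Proof.
by move=> [c hc]; exists `|c| => // w hw okw; apply: (rate_mono (lexx _)); rewrite ?nrm_ge0 ?hc.
Qed.

Definition starts_out (H : M -> Prop) (w : word) :=
  if w is a :: _ then ~ H (m a) else False.

Definition ends_in (End : M -> Prop) (w : word) :=
  if w is a :: w' then End (m (last a w')) else False.

Definition grows_words (K : M -> Prop) (r : R) :=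
  exists (ws : seq word) (eta : R), [/\ 0 < eta,
    (forall w, w \in ws -> w <> [::] /\ inH K w) &
  forall A' : X -> 'M[R]_n, (forall w, w \in ws -> nrm (wmat A' w - mat w) <= eta) ->
  exists (u : nat -> word) (x : 'cV[R]_n) (c : R), [/\ x != 0, 0 < c,
    (forall k, u k \in ws),
    (forall k, ok None (flatten (mkseq u k))) &
    forall k, c * expR (r * len (flatten (mkseq u k))) <=
      nrm (wmat A' (flatten (mkseq u k)) *m x)]].

(** * Cutting words in front of the letters outside a controlled set of modes *)

Section Extract.
(** Words over the part [H] of the ambient set [amb] are already bounded at rate [r1]. [E] collects
    the labels that may precede a block and [End] the modes on which it may end; [End_cond] ensures
    that a cut in front of a letter outside [H] leaves a piece that ends in [End]. *)
Variables (amb H End : M -> Prop) (E : option M -> Prop) (r0 r1 r2 c1 csw : R).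
Hypothesis r01 : r0 <= r1.
Hypothesis r12 : r1 < r2.
Hypothesis c1_ge0 : 0 <= c1.
Hypothesis csw_ge0 : 0 <= csw.
Hypothesis letter_bdd : forall a, Lt a -> amb (m a) -> nrm (B a) <= c1 * expR (r0 * wt a).
Hypothesis short_bdd : forall w, inH amb w -> ok None w -> len w <= 1 -> nrm (mat w) <= csw.
Hypothesis H_bdd : bddH H r1.
Hypothesis End_cond : forall s s', amb s -> amb s' -> ~ H s' -> s <> s' -> End s.
Hypothesis E_end : forall s, End s -> amb s -> E (Some s).
Hypothesis E_None : E None.

Definition extC (w : word) := [/\ inH amb w, starts_out H w & ends_in End w].

Definition chunk (c : word) := exists a h, [/\ c = a :: h, ~ H (m a) & inH H h].

Lemma chunks w : inH amb w -> exists (h : word) (cs : seq word),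
  [/\ w = h ++ flatten cs, inH H h & forall c, c \in cs -> chunk c].
Proof.
elim: w => [|a w IH]; first by exists [::], [::]; split.
move=> /inH_cons[[La am] /IH [h [cs [wE hH hcs]]]].
have [Ha|nHa] := pselect (H (m a)).
  by exists (a :: h), cs; rewrite wE; split=> //; apply/inH_cons.
exists [::], ((a :: h) :: cs); rewrite wE; split=> // c.
by rewrite inE => /orP[/eqP ->|/hcs //]; exists a, h.
Qed.

Lemma start_chunks w : inH amb w -> w = [::] \/ starts_out H w -> exists cs : seq word,
  w = flatten cs /\ forall c, c \in cs -> chunk c.
Proof.
move=> /chunks[h [cs [wE hH hcs]]] st; exists cs; split=> //.
case: h wE hH => [//|a h] wE /inH_cons[[_ Ha] _].
by case: st; rewrite wE // => /(_ Ha).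
Qed.

(** Chunks are collected until the length exceeds 1. A group is then a prefix of length at most 1,
    bounded by [csw] whatever its number of letters, followed by one chunk; every group but possibly
    the last is longer than 1, which bounds their number. *)
Lemma groups : exists2 c0 : R, 0 <= c0 & forall w, inH amb w -> ok None w ->
  w = [::] \/ starts_out H w -> exists qs : seq word,
  [/\ w = flatten qs, (forall q, q \in qs -> starts_out H q /\ nrm (mat q) <= c0 * expR (r1 * len q)) &
      (size qs)%:R <= len w + 1].
Proof.
have [cH cH0 hcH] := bddH_ge0 H_bdd.
pose cc := cH * c1; have cc0 : 0 <= cc by exact: mulr_ge0.
(* The factor [expR |r1|] compensates for [expR (r1 * len p)], which may be below 1 for a piece [p]
   of length at most 1. *)
pose c0 := csw * (1 + cc) * expR `|r1|.
have c00 : 0 <= c0 by rewrite !mulr_ge0 ?addr_ge0 ?expR_ge0.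
exists c0 => //.
have chunkB c : inH amb c -> ok None c -> chunk c -> nrm (mat c) <= cc * expR (r1 * len c).
  move=> ac okc [a [h [cE _ hH]]]; rewrite cE in ac okc *.
  have [[La am] _] := (inH_cons _ _ _).1 ac; have [_ okh] := okc; rewrite /=.
  rewrite mulrDr expRD [expR (r1 * wt a) * _]mulrC mulrACA; apply: nrmMle.
    by apply: hcH => //; exact: ok_None okh.
  apply: le_trans (letter_bdd La am) _; apply: ler_wpM2l => //.
  by rewrite ler_expR; apply: ler_wpM2r.
have exp1 t : 0 <= t <= 1 -> 1 <= expR `|r1| * expR (r1 * t).
  move=> /andP[t0 t1]; rewrite -expRD -expR0 ler_expR -lerBlDr sub0r.
  apply: le_trans (ler_norm _) _; rewrite normrN normrM (ger0_norm t0).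
  exact: ler_piMr.
suff main : forall cs p, inH amb (p ++ flatten cs) -> ok None (p ++ flatten cs) ->
    p = [::] \/ starts_out H p -> len p <= 1 -> (forall c, c \in cs -> chunk c) ->
    exists qs : seq word, [/\ p ++ flatten cs = flatten qs,
    (forall q, q \in qs -> starts_out H q /\ nrm (mat q) <= c0 * expR (r1 * len q)) &
      (size qs)%:R <= len (p ++ flatten cs) + 1].
  move=> w aw okw st; have [cs [wE hcs]] := start_chunks aw st.
  by rewrite wE in aw okw *; apply: (main cs [::]) => //=; left.
have shortB p : inH amb p -> ok None p -> len p <= 1 -> nrm (mat p) <= c0 * expR (r1 * len p).
  move=> ap okp p1; apply: le_trans (short_bdd ap okp p1) _.
  rewrite /c0 -mulrA -[leLHS]mulr1; apply: ler_pM => //.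
    by apply: ler_peMr => //; rewrite lerDl.
  by apply: exp1; rewrite len_ge0.
elim=> [|c cs IH] p ap okp st p1 hcs.
  rewrite /= cats0 in ap okp *; have [p0|p0] := eqVneq p [::].
    by exists [::]; rewrite p0; split=> //; rewrite /= add0r.
  exists [:: p]; rewrite /= cats0; split=> //; last by rewrite lerDr len_ge0.
  move=> q; rewrite inE => /eqP ->; split; last exact: shortB.
  by case: st => // pE; rewrite pE in p0.
rewrite /= catA in ap okp *.
have [apc acs] := (inH_cat _ _ _).1 ap.
have [okpc okcs] := (wok_cat _ _ _ _ _).1 okp.
have [ap1 ac] := (inH_cat _ _ _).1 apc.
have [okp1 okc] := (wok_cat _ _ _ _ _).1 okpc.
have hc : chunk c by apply: hcs; rewrite inE eqxx.
have hcs' c' : c' \in cs -> chunk c' by move=> h; apply: hcs; rewrite inE h orbT.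
have stpc : starts_out H (p ++ c).
  case: st => [->|]; last by case: (p).
  by case: hc => a [h [-> nHa _]].
have [pc1|pc1] := leP (len (p ++ c)) 1; first by apply: IH => //; right.
have [|||||qs [qsE hqs sqs]] := IH [::].
- exact: acs.
- exact: ok_None okcs.
- by left.
- exact: ler01.
- exact: hcs'.
exists ((p ++ c) :: qs); split=> /=; first by rewrite -qsE.
  move=> q; rewrite inE => /orP[/eqP ->|/hqs //]; split=> //.
  rewrite wmat_cat wlen_cat mulrDr expRD.
  apply: le_trans (nrmMle (chunkB _ ac (ok_None okc) hc) (short_bdd ap1 okp1 p1)) _.
  have e1 : 1 <= expR `|r1| * expR (r1 * len p) by apply: exp1; rewrite len_ge0.
  have -> : c0 * (expR (r1 * len p) * expR (r1 * len c)) =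
    (1 + cc) * (csw * expR (r1 * len c)) * (expR `|r1| * expR (r1 * len p)) by rewrite /c0; ring.
  rewrite -[leLHS]mulr1; apply: ler_pM => //; first by rewrite !mulr_ge0 ?expR_ge0.
  rewrite mulrAC -mulrA; apply: ler_wpM2r; first by rewrite mulr_ge0 ?expR_ge0.
  by rewrite lerDr.
rewrite wlen_cat -natr1 lerD2r; apply: le_trans sqs _.
by rewrite addrC; apply: lerD => //; exact: ltW.
Qed.

Lemma ends_in_last f w : inH amb w -> ends_in End w ->
  exists s, [/\ wlast lb f w = Some s, End s & amb s].
Proof.
case: w => //= a w aw h; exists (m (last a w)).
split=> //; last by have [] := aw _ (mem_last a w).
by case/lastP: w {aw h} => [//|w b]; rewrite /wlast /= foldl_rcons last_rcons.
Qed.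

(** The group after [q] starts outside [H] and with a mode different from the last one of [q], so
    [End_cond] applies. *)
Lemma groups_end qs f : inH amb (flatten qs) -> ok f (flatten qs) ->
  (forall q, q \in qs -> starts_out H q) -> ends_in End (flatten qs) ->
  forall q, q \in qs -> ends_in End q.
Proof.
elim: qs f => [//|q qs IH] f /= aq okq hq eq p.
have [aq1 aqs] := (inH_cat _ _ _).1 aq.
have [okq1 okqs] := (wok_cat _ _ _ _ _).1 okq.
have hq1 : starts_out H q by apply: hq; rewrite inE eqxx.
have hqs p' : p' \in qs -> starts_out H p' by move=> h; apply: hq; rewrite inE h orbT.
case: qs IH aq okq hq eq aqs okqs hqs => [|q' qs] IH aq okq hq eq aqs okqs hqs.
  by rewrite inE => /eqP ->; rewrite /= cats0 in eq.
have hq' : starts_out H q' by apply: hqs; rewrite inE eqxx.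
rewrite inE => /orP[/eqP -> {p}|pqs]; last first.
  apply: (IH _ aqs okqs hqs) => //; move: eq.
  case: (q) hq1 => //= a w _; rewrite last_cat /=.
  by case: (q') hq' => //= b v _; rewrite last_cat.
have [b [v q'E]] : exists b v, q' = b :: v by case: (q') hq' => //= b v _; exists b, v.
have [a [w qE]] : exists a w, q = a :: w by case: (q) hq1 => //= b' w _; exists b', w.
subst q q'; have [[_ ab] _] := (inH_cons _ _ _).1 aqs.
have [h _] := okqs; move: hq' aq1 => /= nHb aw.
apply: (@End_cond _ (m b)) => //; first by have [] := aw _ (mem_last a w).
move=> e; apply: h; rewrite -e.
by case/lastP: (w) => [//|u c]; rewrite /wlast /= foldl_rcons last_rcons.
Qed.

Hypothesis E_V : forall f r z, E f -> r = r1 \/ r = r2 ->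
  rate_bdd lb lb wt B extC r f z -> rate_bdd lb lb wt B extC r1 None z.
Hypothesis V_proper : exists z, ~ rate_bdd lb lb wt B extC r1 None z.

(** [E_V] identifies the bounded vectors after all labels of [E] and at both rates, which is what
    [robust_growth] asks of its space; [groups] supplies the splitting. *)
Lemma extract_growth (K : M -> Prop) : (forall s, amb s -> K s) -> grows_words K r0.
Proof.
move=> ambK.
pose V := rate_bdd lb lb wt B extC r1 None.
have Vlin : linear_pred V by split; [exact: rate_bdd0|exact: rate_bdd_lin].
have [||cV cV0 hcV] := @linear_pred_unif R n _ (fun w => extC w /\ ok None w)
  mat (fun w => expR (r1 * len w)) V Vlin.
- by move=> w; exact: expR_ge0.
- by move=> v [c hc]; exists c => w [Cw okw]; exact: hc.
have [c0 c00 hgr] := groups.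
have [||||||||||ws [eta [eta0 wsC hws]]] := @robust_growth R n X _ lb lb wt B
   extC E V r1 r2 c0 1 cV None r12 c00 ler01 cV0.
- exact: wt_ge0.
- by move=> [|//] [].
- by move=> f w [aw _ ew]; have [s [-> Es amb_s]] := ends_in_last f aw ew; exact: E_end.
- move=> f w w' _ [aw sw _] [aw' _ ew'] _ _; split.
  + by apply/inH_cat.
  + by case: (w) sw.
  + by case: (w) sw => //= a v _; case: (w') ew' => //= b v' h; rewrite last_cat.
- move=> f w Ef [aw sw ew] okw.
  have [|qs [wE hqs sqs]] := hgr w aw (ok_None okw); first by right.
  exists qs; split=> //; last by rewrite mul1r.
  move=> q qqs; have [sq nq] := hqs q qqs; split=> //.
  rewrite wE in aw okw ew; split=> //.
    by move=> a aq; apply: aw; apply/flattenP; exists q.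
  by apply: (groups_end aw okw _ ew qqs) => p /hqs[].
- move=> f z Ef; split; first by apply: E_V => //; left.
  move=> [c hc]; exists c => w Cw okw; apply: hc => //; exact: ok_None okw.
- by move=> f z Ef; apply: E_V => //; right.
- by move=> f w z Ef Cw okw Vz; apply: hcV => //; split=> //; exact: ok_None okw.
- exact: V_proper.
- exact: E_None.
exists ws, eta; split=> //.
  move=> w /wsC[aw sw _]; split; first by case: (w) sw.
  by apply: inH_sub aw.
move=> A' /hws[u [x [c [x0 c_gt0 uws hok hu]]]]; exists u, x, c; split=> // k.
apply: le_trans (hu k); apply: ler_wpM2l; first exact: ltW.
by rewrite ler_expR; apply: ler_wpM2r => //; exact: len_ge0.
Qed.

End Extract.

(** Serves to show that the space of bounded vectors is proper: if it were everything, the blocks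
    would be bounded as matrices. *)
Lemma extC_bdd amb H End r : (forall z, rate_bdd lb lb wt B (extC amb H End) r None z) ->
  exists2 c, 0 <= c & forall w, extC amb H End w -> ok None w ->
    nrm (mat w) <= c * expR (r * len w).
Proof.
move=> hV; pose V := rate_bdd lb lb wt B (extC amb H End) r None.
have Vlin : linear_pred V by split; [exact: rate_bdd0|exact: rate_bdd_lin].
have [||cV cV0 hcV] := @linear_pred_unif R n _ (fun w => extC amb H End w /\ ok None w)
  mat (fun w => expR (r * len w)) V Vlin.
- by move=> w; exact: expR_ge0.
- by move=> v [c hc]; exists c => w [Cw okw]; exact: hc.
exists (n%:R * cV) => [|w Cw okw]; first by rewrite mulr_ge0.
by rewrite -mulrA; apply: nrm_le_apply => v; apply: hcV; [split|exact: hV].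
Qed.

Lemma ok_start (f : option M) w : ok None w ->
  (if w is a :: _ then f <> Some (m a) else True) -> ok f w.
Proof. by case: w => //= a w [_ h] fa; split. Qed.

Variables (K : M -> Prop) (r0 r' c1 csw : R).
Hypothesis r0r' : r0 < r'.
Hypothesis c1_ge0 : 0 <= c1.
Hypothesis csw_ge0 : 0 <= csw.
Hypothesis letter_bdd : forall a, Lt a -> K (m a) -> nrm (B a) <= c1 * expR (r0 * wt a).
Hypothesis short_bdd : forall w, inH K w -> ok None w -> len w <= 1 -> nrm (mat w) <= csw.

Let J (H : M -> Prop) := exists r, r0 <= r < r' /\ bddH H r.
Let addp (H : M -> Prop) f := fun s => H s \/ s = f.

(* The words that start at [f] and end in [H] concatenate freely, since [f] is not
   in [H]; if they were all bounded at some rate, so would be the words over [H + f]. *)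
Lemma growth_free H f : (forall s, H s -> K s) -> K f -> J H -> ~ H f -> ~ J (addp H f) ->
  grows_words K r0.
Proof.
move=> HK Kf [rs [/andP[rs0 rsr'] hbd]] nHf nJ.
pose C := extC (addp H f) H H.
pose U r z := rate_bdd lb lb wt B C r None z.
have [||r1 [/andP[r01 r1r'] hr1]] := @max_linear_pred R n R (fun r => rs <= r < r') U.
- by exists rs; rewrite lexx.
- by move=> r _; split; [exact: rate_bdd0|exact: rate_bdd_lin].
have Umono r s z : r <= s -> U r z -> U s z.
  move=> rle [c hc]; exists `|c| => w Cw okw.
  by apply: (rate_mono rle); rewrite ?nrm_ge0 ?hc.
pose r2 := (r1 + r') / 2.
have r12 : r1 < r2 by rewrite /r2; lra.
have r2r' : r2 < r' by rewrite /r2; lra.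
have r0r1 : r0 <= r1 by exact: le_trans r01.
have ambK s : addp H f s -> K s by move=> [/HK|->].
have startf a : addp H f (m a) -> ~ H (m a) -> m a = f by case.
apply: (@extract_growth (addp H f) H H (fun g => g <> Some f) r0 r1 r2 c1 csw) => //.
- by move=> a La /ambK; apply: letter_bdd.
- by move=> w aw; apply: short_bdd; apply: inH_sub aw.
- exact: bddH_mono hbd.
- by move=> s s' [//|->] [//|->].
- by move=> s Hs _ [sf]; apply: nHf; rewrite -sf.
- move=> g r z gf rr hz.
  have : U r z.
    case: hz => c hc; exists c => w Cw okw; apply: hc => //; apply: ok_start => //.
    case: w Cw {okw} => //= a w [aw /= nHa _].
    by rewrite (startf a) //; have [] := aw a (mem_head _ _).
  case: rr => -> // U2; apply: hr1 U2; first by rewrite r2r' (le_trans r01) // ltW.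
  by move=> v; apply: Umono; exact: ltW.
(* Otherwise a word over [H] and [f] splits into a leading word over [H], a block or empty word, and
   possibly a last letter of mode [f]. The letter before that last one has another mode, hence a
   mode in [H], so the middle piece does end in [H]. All three factors are bounded at rate [r1]. *)
- apply: contrapT => /forallNP nV; apply: nJ; exists r1; rewrite r0r1 r1r'; split=> //.
  have [|cC cC0 hC] := @extC_bdd (addp H f) H H r1.
    by move=> z; apply: contrapT; exact: nV.
  have [cH cH0 hcH] := bddH_ge0 (bddH_mono r01 hbd).
  pose c2 := cC + nrm (1%:M : 'M[R]_n).
  have c20 : 0 <= c2 by rewrite addr_ge0 ?nrm_ge0.
  have hC2 w : w = [::] \/ C w -> ok None w -> nrm (mat w) <= c2 * expR (r1 * len w).
    move=> [->|Cw] okw; first by rewrite /= mulr0 expR0 mulr1 lerDr.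
    apply: le_trans (hC w Cw okw) _; apply: ler_wpM2r; rewrite ?expR_ge0 //.
    by rewrite lerDl nrm_ge0.
  have hC3 w : inH (addp H f) w -> ok None w -> w = [::] \/ starts_out H w ->
      nrm (mat w) <= (1 + c1) * c2 * expR (r1 * len w).
    move=> aw okw st; have le12 : c2 <= (1 + c1) * c2 by apply: ler_peMl => //; rewrite lerDl.
    case/lastP: w aw okw st => [|w a] aw okw st.
      by apply: le_trans (hC2 _ (or_introl erefl) okw) _; apply: ler_wpM2r; rewrite ?expR_ge0.
    have [Ha|nHa] := pselect (H (m a)).
      apply: le_trans (hC2 _ _ okw) _; last by apply: ler_wpM2r; rewrite ?expR_ge0.
      right; case: st => [|st]; first by case: (w).
      split=> //; case: (w) => //= b v; by rewrite last_rcons.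
    rewrite -cats1 in aw okw st *.
    have [aw1 /inH_cons[[La am] _]] := (inH_cat _ _ _).1 aw.
    have [okw1 oka] := (wok_cat _ _ _ _ _).1 okw.
    have c12 : c1 * c2 <= (1 + c1) * c2 by apply: ler_wpM2r => //; rewrite lerDr.
    rewrite wmat_cat wlen_cat /= mul1mx addr0 [r1 * (_ + _)]mulrDr expRD.
    apply: (@le_trans _ _ (c1 * c2 * (expR (r1 * len w) * expR (r1 * wt a)))); last first.
      by apply: ler_wpM2r; rewrite ?mulr_ge0 ?expR_ge0.
    have -> : c1 * c2 * (expR (r1 * len w) * expR (r1 * wt a)) =
      c1 * expR (r1 * wt a) * (c2 * expR (r1 * len w)) by ring.
    apply: nrmMle.
      apply: le_trans (letter_bdd La (ambK _ am)) _; apply: ler_wpM2l => //.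
      by rewrite ler_expR; apply: ler_wpM2r.
    apply: hC2 => //; case: w aw okw st aw1 okw1 oka => [|b w] aw okw st aw1 okw1 oka; [by left|right].
    split=> //=; first by case: st.
    have [_ [//|lf]] := aw1 _ (mem_last b w).
    case: oka => oka _; exfalso; apply: oka; rewrite (startf a) // -lf.
    by case/lastP: (w) => [//|v d]; rewrite /wlast /= foldl_rcons last_rcons.
  exists (cH * ((1 + c1) * c2)) => w aw okw.
  have [h [cs [wE hH hcs]]] := chunks H aw.
  rewrite wE in aw okw *.
  have [ah acs] := (inH_cat _ _ _).1 aw; have [okh okcs] := (wok_cat _ _ _ _ _).1 okw.
  rewrite wmat_cat wlen_cat [r1 * (_ + _)]mulrDr expRD.
  have -> : cH * ((1 + c1) * c2) * (expR (r1 * len h) * expR (r1 * len (flatten cs))) =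
    (1 + c1) * c2 * expR (r1 * len (flatten cs)) * (cH * expR (r1 * len h)) by ring.
  apply: nrmMle; last exact: hcH.
  apply: hC3 => //; first exact: ok_None okcs.
  by case: (cs) hcs => [_|c cs' hcs]; [left|right; case: (hcs c (mem_head _ _)) => a [h' [-> ]]].
Qed.

(* Here the words that start outside [H] must not start at the mode which ends the
   previous word. Adding that mode to [H] lifts the constraint, at no cost when the
   space of vectors bounded for [H] is chosen of maximal dimension. *)
Lemma growth_generic : (forall r, r < r' -> ~ bddH K r) ->
  (forall H f, (forall s, H s -> K s) -> J H -> K f -> J (addp H f)) -> grows_words K r0.
Proof.
move=> unb Jadd.
pose C H := extC K H (fun=> True).
pose P (i : R * (M -> Prop)) := [/\ r0 <= i.1 < r', (forall s, i.2 s -> K s) & bddH i.2 i.1].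
pose U (i : R * (M -> Prop)) z := rate_bdd lb lb wt B (C i.2) i.1 None z.
have P0 : P (r0, fun=> False).
  split=> //=; first by rewrite lexx.
  exists (nrm (1%:M : 'M[R]_n)) => -[|a w] hw _; last by case: (hw a (mem_head _ _)).
  by rewrite /= mulr0 expR0 mulr1.
(* The maximum runs over rates and sets of modes together: a larger rate enlarges the space, and so
   does a larger set, which leaves fewer blocks to test. *)
have [||[r1 H0] [[/= /andP[r01 r1r'] H0K H0b] hmax]] := @max_linear_pred R n _ P U.
- by eexists; exact: P0.
- by move=> i _; split; [exact: rate_bdd0|exact: rate_bdd_lin].
pose r2 := (r1 + r') / 2.
have r12 : r1 < r2 by rewrite /r2; lra.
have r2r' : r2 < r' by rewrite /r2; lra.
have Umono r s H1 H2 z : r <= s -> (forall t, H1 t -> H2 t) -> U (r, H1) z -> U (s, H2) z.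
  move=> rle H12 [c hc]; exists `|c| => w [aw sw ew] okw.
  apply: (rate_mono rle); rewrite ?nrm_ge0 ?hc //; split=> //.
  by case: (w) sw => //= a _ nH2 /H12.
pose E (g : option M) := forall s, g = Some s -> K s.
have ended r z f : E f -> r = r1 \/ r = r2 ->
    rate_bdd lb lb wt B (C H0) r f z -> U (r1, H0) z.
  move=> Ef rr hz.
  have [rle rr'] : r1 <= r /\ r < r' by case: rr => ->; split=> //; exact: ltW.
  case: f Ef hz => [s|] Ef hz; last first.
    apply: (hmax (r, H0)) hz; last by move=> v; exact: Umono.
    by split=> //=; [rewrite rr' (le_trans r01)|exact: bddH_mono H0b].
  have Ks : K s by exact: Ef.
  have [rs [/andP[rs0 rsr'] hbd]] := Jadd H0 s H0K (ex_intro _ r1 (conj (introT andP (conj r01 r1r')) H0b)) Ks.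
  pose r3 := Num.max r rs.
  have rr3 : r <= r3 by rewrite le_max lexx.
  (* Blocks that start outside [H0] and [s] may all follow the label [s], so for them the bound
     after [s] is a bound without label; maximality carries it back to [H0]. *)
  apply: (hmax (r3, addp H0 s)).
  - split=> /=; first by rewrite (le_trans r01) ?(le_trans rle) //= gt_max rr' rsr'.
      by move=> t [/H0K|->].
    by apply: bddH_mono hbd; rewrite le_max lexx orbT.
  - by move=> v; apply: Umono; [exact: le_trans rr3|left].
  - case: hz => c hc; exists `|c| => w [aw sw ew] okw; apply: (rate_mono rr3); rewrite ?nrm_ge0 //.
    apply: hc; first by split=> //; case: (w) sw => //= a _ nH H0a; apply: nH; left.
    by apply: ok_start => //; case: (w) sw => //= a _ nH [sa]; apply: nH; right.
apply: (@extract_growth K H0 (fun=> True) E r0 r1 r2 c1 csw) => //.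
- by move=> s _ Ks t [<-].
- by move=> f r z Ef rr; exact: ended.
- apply: contrapT => /forallNP nV; apply: (unb r1 r1r').
  have [|cC cC0 hC] := @extC_bdd K H0 (fun=> True) r1.
    by move=> z; apply: contrapT; exact: nV.
  have [cH cH0 hcH] := bddH_ge0 H0b.
  exists (cH * (cC + nrm (1%:M : 'M[R]_n))) => w aw okw.
  have [h [cs [wE hH hcs]]] := chunks H0 aw.
  rewrite wE in aw okw *.
  have [ah acs] := (inH_cat _ _ _).1 aw; have [okh okcs] := (wok_cat _ _ _ _ _).1 okw.
  rewrite wmat_cat wlen_cat [r1 * (_ + _)]mulrDr expRD.
  rewrite mulrACA mulrC; apply: nrmMle; last exact: hcH.
  case: cs hcs acs okcs {wE aw okw} => [|c cs] hcs acs okcs.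
    by rewrite /= mulr0 expR0 mulr1 lerDr.
  apply: le_trans (hC _ _ (ok_None okcs)) _.
    split=> //.
      by case: (hcs c (mem_head _ _)) => a [h' [-> ]].
    by case: (hcs c (mem_head _ _)) => a [h' [-> ]].
  by apply: ler_wpM2r; rewrite ?expR_ge0 // lerDl nrm_ge0.
Qed.

(** Dichotomy: either adding some mode to some controlled set destroys the control, and
    [growth_free] applies to that pair, or every conflicting mode can be added, as [growth_generic]
    requires. *)
Theorem word_growth : (forall r, r < r' -> ~ bddH K r) -> grows_words K r0.
Proof.
move=> unb.
have [[H [f [HK Kf JH nJ]]]|h] := pselect (exists H f,
   [/\ forall s, H s -> K s, K f, J H & ~ J (addp H f)]).
  apply: (@growth_free H f) => // Hf; apply: nJ.
  move: JH => [r [hr [c hc]]]; exists r; split=> //; exists c => w aw; apply: hc.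
  by apply: inH_sub aw => s [//|->].
apply: growth_generic => // H f HK JH Kf; apply: contrapT => nJ.
by apply: h; exists H, f.
Qed.

End WordGrowth.

(** * Matrix exponential and linear equations *)

Section RealDerivatives.
Variable R : realType.
Implicit Types f g : R -> R.

Lemma isdD f g (x a b : R) : is_derive x (1 : R) f a -> is_derive x (1 : R) g b ->
  is_derive x (1 : R) (fun u => f u + g u) (a + b).
Proof. exact: is_deriveD. Qed.

Lemma isdM f g (x a b : R) : is_derive x (1 : R) f a -> is_derive x (1 : R) g b ->
  is_derive x (1 : R) (fun u => f u * g u) (f x * b + g x * a).
Proof. exact: is_deriveM. Qed.

Lemma isdC (c x : R) : is_derive x (1 : R) (fun=> c) 0.
Proof. exact: is_derive_cst. Qed.

Lemma isdZ f (c x a : R) : is_derive x (1 : R) f a ->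
  is_derive x (1 : R) (fun u => c * f u) (c * a).
Proof.
move=> h; have := isdM (isdC c x) h; rewrite mulr0 addr0; exact.
Qed.

Lemma isdB f g (x a b : R) : is_derive x (1 : R) f a -> is_derive x (1 : R) g b ->
  is_derive x (1 : R) (fun u => f u - g u) (a - b).
Proof. exact: is_deriveB. Qed.

Lemma isd_sum n (h : 'I_n -> R -> R) (x : R) (dh : 'I_n -> R) :
  (forall i, is_derive x (1 : R) (h i) (dh i)) ->
  is_derive x (1 : R) (fun u => \sum_i h i u) (\sum_i dh i).
Proof.
move=> hd; have -> : (fun u => \sum_i h i u) = \sum_i h i.
  by apply/funext => u; rewrite fct_sumE.
exact: is_derive_sum.
Qed.

Lemma isd_shift f (s x a : R) : is_derive (x + s) (1 : R) f a ->
  is_derive x (1 : R) (fun u => f (u + s)) a.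
Proof.
move=> h; have hs : is_derive x (1 : R) (fun u => u + s) 1.
  by have := isdD (is_derive_id x (1 : R)) (isdC s x); rewrite addr0.
by have := @is_derive1_comp R f (fun u => u + s) x a 1 h hs; rewrite mulr1.
Qed.

Lemma isd_exp (c x : R) : is_derive x (1 : R) (fun u => expR (c * u)) (c * expR (c * x)).
Proof.
have hs : is_derive x (1 : R) (fun u => c * u) c.
  by have := isdZ c (is_derive_id x (1 : R)); rewrite mulr1.
by have := @is_derive1_comp R expR (fun u => c * u) x _ c (is_derive_expR (c * x)) hs; rewrite mulrC.
Qed.

(** The function [expR (- c * t) * f t - b * t] is nonincreasing on [0, T], because its exponential
    factor is at most 1. *)
Lemma gronwall f (f' : R -> R) (c b T : R) : 0 <= T -> 0 <= c -> 0 <= b ->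
  (forall t, is_derive t (1 : R) f (f' t)) ->
  (forall t, 0 <= t <= T -> f' t <= c * f t + b) ->
  f T <= expR (c * T) * (f 0 + b * T).
Proof.
move=> T0 c0 b0 hf hle.
pose h t := expR (- c * t) * f t - b * t.
have hd t : is_derive t (1 : R) h (expR (- c * t) * f' t + f t * (- c * expR (- c * t)) - b).
  apply: isdB; first exact: isdM (isd_exp _ _) (hf t).
  by have := isdZ b (is_derive_id t (1 : R)); rewrite mulr1.
have : h T <= h 0.
  apply: (@ler0_derive1_nincr R h 0 T) => //.
  - move=> x; rewrite in_itv /= => /andP[x0 xT]; rewrite derive1E derive_val.
    have -> : expR (- c * x) * f' x + f x * (- c * expR (- c * x)) - b =
      expR (- c * x) * (f' x - c * f x) - b by ring.
    rewrite subr_le0; apply: (@le_trans _ _ (expR (- c * x) * b)).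
      apply: ler_wpM2l; first exact: expR_ge0.
      by rewrite lerBlDr addrC; apply: hle; rewrite !ltW.
    apply: ler_piMl => //; rewrite -expR0 ler_expR mulNr oppr_le0.
    by rewrite mulr_ge0 // ltW.
  - by apply: derivable_within_continuous => x _; exact: ex_derive.
rewrite /h mulr0 expR0 mul1r mulr0 subr0 lerBlDr => hh.
rewrite -ler_pdivrMl ?expR_gt0 //.
by rewrite -expRN -mulNr.
Qed.

End RealDerivatives.

Section MatrixExponential.
Variables (R : realType) (n : nat).
Implicit Types (A L : 'M[R]_n) (v w : 'cV[R]_n) (x y : R -> 'cV[R]_n).

Lemma nrm_mpow A k : nrm (mpow A k) <= nrm (1%:M : 'M[R]_n) * nrm A ^+ k.
Proof.
elim: k => [|k IH]; first by rewrite expr0 mulr1.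
by rewrite mpowS exprS mulrCA; exact: nrmMle.
Qed.

(** The shift [p] covers the derived series: differentiation raises [p] by one, and differentiating
    term by term calls for convergence with p = 0, 1, 2. *)
Lemma mexp_cvg A p i j (x : R) :
  cvgn (pseries (fun k => mpow A (k + p) i j / k`!%:R) x).
Proof.
apply: normed_cvg.
pose c := nrm (1%:M : 'M[R]_n) * nrm A ^+ p.
have c0 : 0 <= c by rewrite mulr_ge0 ?nrm_ge0 ?exprn_ge0 ?nrm_ge0.
apply: (@series_le_cvg _ _ (fun k => c * exp_coeff (nrm A * `|x|) k)) => //.
- by move=> k; exact: normr_ge0.
- move=> k; apply: mulr_ge0 => //; apply: exp_coeff_ge0; apply: mulr_ge0 => //; exact: nrm_ge0.
- move=> k /=; rewrite !normrM normfV (ger0_norm (ler0n _ _)) normrX /exp_coeff /=.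
  have -> : c * ((nrm A * `|x|) ^+ k / k`!%:R) =
    nrm (1%:M : 'M[R]_n) * nrm A ^+ (k + p) / k`!%:R * `|x| ^+ k.
    by rewrite exprMn exprD /c; ring.
  apply: ler_wpM2r; first exact: exprn_ge0.
  apply: ler_wpM2r; first by rewrite invr_ge0.
  by apply: le_trans (nrm_entry _ _ _) _; exact: nrm_mpow.
- by apply: is_cvg_seriesZ; exact: is_cvg_series_exp_coeff.
Qed.

Definition mexp A (t : R) : 'M[R]_n :=
  \matrix_(i, j) limn (pseries (fun k => mpow A k i j / k`!%:R) t).

Lemma pseries_diffs_mpow A p i j :
  pseries_diffs (fun k => mpow A (k + p) i j / k`!%:R) =
  (fun k => mpow A (k + p.+1) i j / k`!%:R).
Proof.
apply/funext => k; rewrite /pseries_diffs factS natrM invfM addSnnS.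
by rewrite mulrCA mulVKf // pnatr_eq0.
Qed.

Lemma mexp0 A : mexp A 0 = 1%:M.
Proof.
apply/matrixP => i j; rewrite mxE; apply: cvg_lim => //.
apply: (@cvg_near_cst _ _ _ _ _ eventually_filter); near=> k.
have k0 : (0 < k)%N by near: k; exists 1%N.
rewrite /pseries /series /= -(prednK k0) big_nat_recl // big1 ?addr0.
  by rewrite expr0 mulr1 fact0 divr1.
by move=> l _; rewrite expr0n /= mulr0.
Unshelve. all: by end_near. Qed.

Lemma mexp_derive A t i j :
  is_derive t (1 : R) (fun u => mexp A u i j) ((A *m mexp A t) i j).
Proof.
pose c p k := mpow A (k + p) i j / k`!%:R.
have c0 : (fun k => mpow A k i j / k`!%:R) = c 0%N.
  by apply/funext => k; rewrite /c addn0.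
have -> : (fun u => mexp A u i j) = (fun u => limn (pseries (c 0%N) u)).
  by apply/funext => u; rewrite mxE c0.
have -> : (A *m mexp A t) i j = limn (pseries (pseries_diffs (c 0%N)) t).
  rewrite pseries_diffs_mpow mxE; apply/esym/cvg_lim => //.
  have -> : pseries (fun k => mpow A (k + 1) i j / k`!%:R) t =
    (fun N => \sum_l A i l * pseries (fun k => mpow A k l j / k`!%:R) t N).
    apply/funext => N; rewrite /pseries /series /=.
    under [RHS]eq_bigr do rewrite mulr_sumr.
    rewrite exchange_big /=; apply: eq_bigr => k _.
    rewrite addn1 mpowS mxE !mulr_suml; apply: eq_bigr => l _; ring.
  apply: (@cvg_big _ _ _ _ _ _ _ _ _ _ (fun l => A i l * mexp A t l j)) => [|l _].
    exact: add_continuous.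
  rewrite mxE; apply: cvgM; first exact: cvg_cst.
  have := @mexp_cvg A 0 l j t; rewrite (_ : (fun k => mpow A (k + 0) l j / k`!%:R) =
    (fun k => mpow A k l j / k`!%:R)) //.
  by apply/funext => k; rewrite addn0.
apply: (@pseries_snd_diffs _ _ (`|t| + 1)).
- exact: mexp_cvg.
- by rewrite pseries_diffs_mpow; exact: mexp_cvg.
- by rewrite !pseries_diffs_mpow; exact: mexp_cvg.
- by rewrite [ltRHS]ger0_norm ?addr_ge0 // ltrDl.
Qed.

Definition ode A (x : R -> 'cV[R]_n) :=
  forall t i, is_derive t (1 : R) (fun u => x u i 0) ((A *m x t) i 0).

Lemma ode_mexp A s (v : 'cV[R]_n) : ode A (fun t => mexp A (t - s) *m v).
Proof.
move=> t i.
have -> : (fun u => (mexp A (u - s) *m v) i 0) = (fun u => \sum_j mexp A (u - s) i j * v j 0).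
  by apply/funext => u; rewrite mxE.
have -> : (A *m (mexp A (t - s) *m v)) i 0 = \sum_j (A *m mexp A (t - s)) i j * v j 0.
  by rewrite mulmxA mxE.
apply: isd_sum => j.
have -> : (fun u => mexp A (u - s) i j * v j 0) = (fun u => v j 0 * mexp A (u - s) i j).
  by apply/funext => u; rewrite mulrC.
by rewrite mulrC; apply: isdZ; apply: (@isd_shift _ (fun u => mexp A u i j)); exact: mexp_derive.
Qed.

Lemma odeB A x y : ode A x -> ode A y -> ode A (fun t => x t - y t).
Proof.
move=> hx hy t i; have := isdB (hx t i) (hy t i).
rewrite mulmxBr !mxE; congr is_derive.
by apply/funext => u; rewrite !mxE.
Qed.

Definition sqn (v : 'cV[R]_n) : R := \sum_i v i 0 ^+ 2.

Lemma sqn_ge0 v : 0 <= sqn v.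
Proof. by apply: sumr_ge0 => i _; exact: sqr_ge0. Qed.

Lemma vnormE v : vnorm v = Num.sqrt (sqn v). Proof. by []. Qed.

Lemma sqnE v : sqn v = vnorm v ^+ 2.
Proof. by rewrite vnormE sqr_sqrtr // sqn_ge0. Qed.

Lemma quad_le A (v : 'cV[R]_n) : \sum_i v i 0 * (A *m v) i 0 <= nrm A * sqn v.
Proof.
rewrite sqnE /nrm mulr_suml; apply: ler_sum => i _.
rewrite mxE mulr_sumr mulr_suml; apply: ler_sum => j _.
rewrite mulrCA; apply: le_trans (ler_norm _) _; rewrite !normrM expr2.
by apply: ler_wpM2l => //; apply: ler_pM; rewrite ?vnorm_entry.
Qed.

Lemma sqn_derive A x t : ode A x ->
  is_derive t (1 : R) (fun u => sqn (x u)) (2 * \sum_i x t i 0 * (A *m x t) i 0).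
Proof.
move=> hx; rewrite mulr_sumr; apply: isd_sum => i.
rewrite (_ : (fun u => x u i 0 ^+ 2) = (fun u => x u i 0 * x u i 0)); last exact/funext.
by rewrite mulr_natl mulr2n; exact: isdM.
Qed.

Lemma ode_growth A x T : ode A x -> 0 <= T -> sqn (x T) <= expR (2 * nrm A * T) * sqn (x 0).
Proof.
move=> hx T0; rewrite -[sqn (x 0)]addr0 -[X in _ + X](mul0r T).
apply: (@gronwall _ (fun u => sqn (x u)) _ (2 * nrm A) 0 T T0 _ (lexx 0)
  (fun t => sqn_derive t hx)).
  by rewrite mulr_ge0 ?nrm_ge0.
by move=> t _; rewrite addr0 -mulrA ler_pM2l // quad_le.
Qed.

Lemma ode_shift A x s : ode A x -> ode A (fun t => x (t + s)).
Proof. by move=> hx t i; apply: (@isd_shift _ (fun u => x u i 0)); exact: hx. Qed.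

Lemma sqn_eq0 v : sqn v <= 0 -> v = 0.
Proof.
move=> h; apply/eqP; rewrite -vnorm_eq0 -sqrf_eq0 -sqnE eq_le h; exact: sqn_ge0.
Qed.

(** Uniqueness: the difference of the two solutions vanishes at [s], and [ode_growth] keeps its
    squared norm at zero afterwards. *)
Lemma ode_mexpE A x s t : ode A x -> s <= t -> x t = mexp A (t - s) *m x s.
Proof.
move=> hx st; apply/eqP; rewrite -subr_eq0; apply/eqP/sqn_eq0.
have hy := ode_shift s (odeB hx (ode_mexp A s (x s))).
have := @ode_growth A _ (t - s) hy; rewrite subr_ge0 subrK add0r => /(_ st).
rewrite subrr mexp0 mul1mx subrr (_ : sqn 0 = 0) ?mulr0 //.
by rewrite /sqn big1 // => i _; rewrite mxE expr0n.
Qed.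

Lemma ode_solves A L x : ode (invmx L *m A) x -> L \in unitmx -> solves R n L A x.
Proof.
move=> hx Lu t; split=> [i|]; first exact: ex_derive.
have -> : dvec R n x t = (invmx L *m A) *m x t.
  apply/matrixP => i j; rewrite ord1 mxE derive1E.
  by have := hx t i => h; rewrite derive_val.
by rewrite -mulmxA mulKVmx.
Qed.

Lemma solves_ode A L x : solves R n L A x -> L \in unitmx -> ode (invmx L *m A) x.
Proof.
move=> hx Lu t i; have [hd he] := hx t.
have -> : (invmx L *m A *m x t) i 0 = 'D_1 (fun u => x u i 0) t.
  by rewrite -mulmxA -he mulKmx // mxE derive1E.
exact: derivableP.
Qed.

Lemma mexp_bound A t : 0 <= t -> nrm (mexp A t) <= n%:R ^+ 2 * expR (nrm A * t).
Proof.
move=> t0; rewrite expr2 -mulrA; apply: nrm_le_apply => v.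
have := ode_growth (ode_mexp A 0 v) t0; rewrite subr0 subrr mexp0 mul1mx => h.
apply: le_trans (nrm_le_vnorm _) _; rewrite -mulrA; apply: ler_wpM2l => //.
apply: (@le_trans _ _ (expR (nrm A * t) * vnorm v)); last first.
  by apply: ler_wpM2l; [exact: expR_ge0|exact: vnorm_le_nrm].
rewrite -ler_sqr ?nnegrE ?mulr_ge0 ?vnorm_ge0 ?expR_ge0 // exprMn -!sqnE.
by rewrite -expRM_natl mulrA.
Qed.

Lemma mexpD A s t : 0 <= s -> 0 <= t -> mexp A (s + t) = mexp A t *m mexp A s.
Proof.
move=> s0 t0; apply/matrixP => i j.
have := @ode_mexpE A _ s (s + t) (ode_mexp A 0 (delta_mx j 0)).
rewrite !subr0 lerDl [s + t]addrC addrK => /(_ t0).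
by rewrite mulmxA -!colE => /matrixP/(_ i 0); rewrite !mxE.
Qed.

End MatrixExponential.

(** * Lyapunov functions of Hurwitz matrices *)

Section Lyapunov.
Variable R : realType.
Notation C := R[i].
Notation cRe := (@complex.Re R).
Notation cIm := (@complex.Im R).
Notation toC := (real_complex R).

Lemma cReM (a b : C) : cRe (a * b) = cRe a * cRe b - cIm a * cIm b.
Proof. by case: a b => [a1 a2] [b1 b2]. Qed.

Lemma cImM (a b : C) : cIm (a * b) = cRe a * cIm b + cIm a * cRe b.
Proof. by case: a b => [a1 a2] [b1 b2]. Qed.

Lemma cRe_sum (I : Type) (r : seq I) (F : I -> C) :
  cRe (\sum_(i <- r) F i) = \sum_(i <- r) cRe (F i).
Proof. by apply: (big_morph cRe) => // -[a1 a2] [b1 b2]. Qed.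

Lemma cIm_sum (I : Type) (r : seq I) (F : I -> C) :
  cIm (\sum_(i <- r) F i) = \sum_(i <- r) cIm (F i).
Proof. by apply: (big_morph cIm) => // -[a1 a2] [b1 b2]. Qed.

Definition mRe m n (A : 'M[C]_(m, n)) : 'M[R]_(m, n) := map_mx cRe A.
Definition mIm m n (A : 'M[C]_(m, n)) : 'M[R]_(m, n) := map_mx cIm A.

Lemma mReM m n p (A : 'M[C]_(m, n)) (B : 'M[C]_(n, p)) :
  mRe (A *m B) = mRe A *m mRe B - mIm A *m mIm B.
Proof.
apply/matrixP => i j; rewrite !mxE cRe_sum -sumrB.
by apply: eq_bigr => k _; rewrite !mxE cReM.
Qed.

Lemma mImM m n p (A : 'M[C]_(m, n)) (B : 'M[C]_(n, p)) :
  mIm (A *m B) = mRe A *m mIm B + mIm A *m mRe B.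
Proof.
apply/matrixP => i j; rewrite !mxE cIm_sum -big_split.
by apply: eq_bigr => k _; rewrite !mxE cImM.
Qed.

Lemma mReC m n (A : 'M[R]_(m, n)) : mRe (map_mx toC A) = A.
Proof. by apply/matrixP => i j; rewrite !mxE. Qed.

Lemma mImC m n (A : 'M[R]_(m, n)) : mIm (map_mx toC A) = 0.
Proof. by apply/matrixP => i j; rewrite !mxE. Qed.

(* Schur triangularization over [R[i]]; conjugating by a diagonal matrix of powers of
   [delta] makes the off-diagonal entries small, so that the real and imaginary parts
   of the resulting coordinates give a quadratic Lyapunov function. *)
Lemma scaled_triangular n (D : 'M[R]_n) : hurwitz D -> exists (W : 'M[C]_n) (T : 'M[C]_n) (al : R),
  [/\ W \in unitmx, W *m map_mx toC D = T *m W, 0 < al,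
      (forall i, cRe (T i i) <= - (2 * al)) &
      (forall i j, i != j -> 4 * n%:R * `|cRe (T i j)| <= al /\ 4 * n%:R * `|cIm (T i j)| <= al)].
Proof.
move=> hD; pose DC := map_mx toC D.
have [|P Pu /= /andP[trig _]] := @cotrigonalization C n [:: DC].
  by move=> A B; rewrite !inE => /eqP -> /eqP ->.
have {}Pu : P \in unitmx by exact: unitarymx_unit.
pose T := P *m DC *m invmx P.
have TE : conjmx P DC = T by rewrite conjumx.
have {}trig : is_trig_mx T by rewrite -TE.
have PT : P *m DC = T *m P by rewrite /T -!mulmxA mulVmx // mulmx1.
have Tdiag i : cRe (T i i) < 0.
  apply: hD; have -> : map_poly (fun x : R => x%:C%C) (char_poly D) = char_poly DC.
    by rewrite /DC -map_char_poly.
  rewrite -eigenvalue_root_char.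
  apply: (eigenvalue_conjmx (V := P)); first exact: stablemx_unit.
    by rewrite row_free_unit.
  rewrite TE -[_ \in _]/(eigenvalue T (T i i)) eigenvalue_root_char char_poly_trig //.
  by rewrite rootE horner_prod (bigD1 i) //= hornerXsubC subrr mul0r.
clearbody T.
have [al al0 hal] : exists2 al : R, 0 < al & forall i, cRe (T i i) <= - (2 * al).
  (* The inverse of a sum of inverses lies below each [- cRe (T i i) / 2]; the added 1 keeps it
     positive when n = 0. *)
  pose f i := (- cRe (T i i) / 2)^-1.
  have f0 i : 0 < f i by rewrite invr_gt0 divr_gt0 // oppr_gt0.
  have S0 : 0 < \sum_i f i + 1 by rewrite ltr_wpDl // sumr_ge0 // => i _; exact: ltW.
  exists (\sum_i f i + 1)^-1 => [|i]; first by rewrite invr_gt0.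
  have fi : f i <= \sum_i f i + 1.
    by rewrite (bigD1 i) //= -addrA lerDl addr_ge0 // sumr_ge0 // => j _; exact: ltW.
  have : (\sum_i f i + 1)^-1 <= (f i)^-1 by rewrite lef_pV2 ?posrE ?f0.
  by rewrite invrK ler_pdivlMr // lerNr mulrC.
pose b := 4 * n%:R * (nrm (mRe T) + nrm (mIm T)).
have b0 : 0 <= b by rewrite !mulr_ge0 // addr_ge0 ?nrm_ge0.
(* The conjugation multiplies the entry (i, j), for j < i, by [dl ^+ (i - j)], at most [dl]; this
   choice makes [b * dl <= al]. *)
pose dl := al / (b + al).
have bal0 : 0 < b + al by rewrite ltr_wpDl.
have dl0 : 0 < dl by rewrite divr_gt0.
have dl1 : dl <= 1 by rewrite ler_pdivrMr // mul1r lerDr.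
have bdl : b * dl <= al.
  by rewrite mulrCA ler_piMr // ?(ltW al0) // ler_pdivrMr // mul1r lerDl ltW.
have toC0 (x : R) : x != 0 -> toC x != 0 by rewrite fmorph_eq0.
pose W := diag_mx (\row_i toC (dl ^+ i)) *m P.
pose T' := \matrix_(i, j) (toC (dl ^+ i / dl ^+ j) * T i j) : 'M[C]_n.
have dli i : dl ^+ i != 0 by rewrite expf_neq0 // gt_eqF.
exists W, T', al; split=> //.
- rewrite unitmx_mul Pu andbT unitmxE det_diag unitfE prodf_seq_neq0.
  by apply/allP => i _; rewrite mxE toC0.
- rewrite /W -mulmxA PT !mulmxA; congr (_ *m _).
  apply/matrixP => i j; rewrite mul_diag_mx mul_mx_diag !mxE.
  by rewrite mulrAC -rmorphM /= divfK.
- move=> i; rewrite mxE divff // rmorph1 mul1r; exact: hal.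
- move=> i j ij; rewrite mxE !cReM !cImM /= !mul0r subr0 addr0.
  rewrite [`|_ * complex.Re _|]normrM [`|_ * complex.Im _|]normrM.
  have [lij|lji] := ltnP i j.
    have -> : T i j = 0 by apply/(is_trig_mxP _).
    by rewrite /= normr0 !mulr0 ltW.
  have {ij}lji : (j < i)%N by rewrite ltn_neqAle lji andbT eq_sym.
  have e : `|dl ^+ i / dl ^+ j| <= dl.
    rewrite -(subnKC (ltnW lji)) exprD mulrC mulKf // ger0_norm ?exprn_ge0 ?(ltW dl0) //.
    have : dl ^+ (i - j) <= dl ^+ 1 by rewrite ler_wiXn2l ?subn_gt0 // ltW.
    by rewrite expr1.
  split; apply: le_trans bdl; rewrite /b -[leRHS]mulrA; apply: ler_wpM2l.
  all: rewrite ?mulr_ge0 // mulrC; apply: ler_pM => //.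
    apply: le_trans (_ : nrm (mRe T) <= _); last by rewrite lerDl nrm_ge0.
    by apply: le_trans (nrm_entry (mRe T) i j); rewrite mxE.
  apply: le_trans (_ : nrm (mIm T) <= _); last by rewrite lerDr nrm_ge0.
  by apply: le_trans (nrm_entry (mIm T) i j); rewrite mxE.
Qed.

(** [sqn (Z *m x)] is the squared Hermitian norm of [W x] in real and imaginary parts, and the left
    inverse [Zl] makes it definite. Off-diagonal entries of size at most al / (4 n) cost al / 2 out
    of the decay 2 al given by the diagonal. *)
Theorem lyapunov n (D : 'M[R]_n) : hurwitz D ->
  exists (Z : 'M[R]_(n + n, n)) (Zl : 'M[R]_(n, n + n)) (al : R),
  [/\ 0 < al, Zl *m Z = 1%:M &
   forall x : 'cV[R]_n, \sum_k (Z *m x) k 0 * (Z *m (D *m x)) k 0 <= - al * sqn (Z *m x)].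
Proof.
move=> /scaled_triangular[W [T [al [Wu WT al0 Td To]]]].
pose Wi := invmx W.
exists (col_mx (mRe W) (mIm W)), (row_mx (mRe Wi) (- mIm Wi)), al; split=> //.
  by rewrite mul_row_col mulNmx -mReM mulVmx //; apply/matrixP => i j; rewrite !mxE /=; case: eqP.
move=> x.
pose a := mRe W *m x; pose b := mIm W *m x.
have WD1 : mRe W *m (D *m x) = mRe T *m a - mIm T *m b.
  rewrite /a /b !mulmxA -mulmxBl -mReM -WT mReM mReC mImC mulmx0 subr0; by [].
have WD2 : mIm W *m (D *m x) = mRe T *m b + mIm T *m a.
  rewrite /a /b !mulmxA -mulmxDl -mImM -WT mImM mReC mImC mulmx0 add0r; by [].
rewrite !mul_col_mx WD1 WD2 -/a -/b /sqn big_split_ord /= big_split_ord /=.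
under eq_bigr do rewrite !col_mxEu.
under [X in _ + X]eq_bigr do rewrite !col_mxEd.
under [X in _ <= _ * (X + _)]eq_bigr do rewrite !col_mxEu.
under [X in _ <= _ * (_ + X)]eq_bigr do rewrite !col_mxEd.
rewrite -!big_split /= {WD1 WD2}; clearbody a b.
pose N k := a k 0 ^+ 2 + b k 0 ^+ 2.
have N0 k : 0 <= N k by rewrite addr_ge0 ?sqr_ge0.
pose term k j := a k 0 * (cRe (T k j) * a j 0 - cIm (T k j) * b j 0) +
  b k 0 * (cRe (T k j) * b j 0 + cIm (T k j) * a j 0).
pose c := al / (4 * n%:R).
have c0 : 0 <= c by rewrite divr_ge0 ?(ltW al0) // mulr_ge0.
have tm k j : term k j <= (if j == k then - (2 * al) * N k else 0) + c * (N k + N j).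
  have cN : 0 <= c * (N k + N j) by rewrite mulr_ge0 // addr_ge0.
  have [->|jk] := eqVneq j k.
    have -> : term k k = cRe (T k k) * N k by rewrite /term /N; ring.
    apply: ler_wpDr; first by rewrite mulr_ge0 // addr_ge0.
    exact: ler_wpM2r.
  have n0 : (0 : R) < 4 * n%:R by rewrite mulr_gt0 // ltr0n (leq_ltn_trans _ (ltn_ord k)).
  have kj : k != j by rewrite eq_sym.
  have [] := To k j kj; rewrite ![4 * n%:R * _]mulrC -!ler_pdivlMr // -/c => h1 h2.
  have {h1} /andP[h1 h1'] : - c <= cRe (T k j) <= c by rewrite -ler_norml.
  have {h2} /andP[h2 h2'] : - c <= cIm (T k j) <= c by rewrite -ler_norml.
  rewrite add0r /term /N; clear -h1 h1' h2 h2'.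
  move: (cRe _) (cIm _) (a k 0) (a j 0) (b k 0) (b j 0) h1 h1' h2 h2' => u v a1 a2 b1 b2 h1 h1' h2 h2'.
  (* Four nonnegative combinations of squares, valid for [u] and [v] between -c and c, whose sum
     bounds the cross terms. *)
  have p1 : 0 <= (c - u) * ((a1 + a2) ^+ 2 + (b1 + b2) ^+ 2).
    by rewrite mulr_ge0 ?subr_ge0 // addr_ge0 // sqr_ge0.
  have p2 : 0 <= (u + c) * ((a1 - a2) ^+ 2 + (b1 - b2) ^+ 2).
    by apply: mulr_ge0; [lra|rewrite addr_ge0 // sqr_ge0].
  have p3 : 0 <= (c - v) * ((b1 + a2) ^+ 2 + (a1 - b2) ^+ 2).
    by rewrite mulr_ge0 ?subr_ge0 // addr_ge0 // sqr_ge0.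
  have p4 : 0 <= (v + c) * ((b1 - a2) ^+ 2 + (a1 + b2) ^+ 2).
    by apply: mulr_ge0; [lra|rewrite addr_ge0 // sqr_ge0].
  lra.
apply: (@le_trans _ _ (\sum_k \sum_j term k j)).
  apply: ler_sum => k _; rewrite !mxE -sumrB -big_split !mulr_sumr -big_split /=.
  by rewrite le_eqVlt; apply/orP; left; apply/eqP/eq_bigr => j _; rewrite !mxE.
apply: (@le_trans _ _ (\sum_k (- (2 * al) * N k + \sum_j c * (N k + N j)))).
  apply: ler_sum => k _; apply: le_trans (ler_sum _ (fun j _ => tm k j)) _.
  by rewrite big_split /= -big_mkcond /= big_pred1_eq.
rewrite big_split /= -mulr_sumr.
have -> : \sum_i \sum_j c * (N i + N j) = c * (n%:R + n%:R) * \sum_k N k.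
  under eq_bigr do rewrite -mulr_sumr big_split /= sumr_const card_ord.
  rewrite -mulr_sumr big_split /= sumr_const card_ord -mulrA; congr (_ * _).
  by rewrite mulrDl sumrMnl !mulr_natl.
have S0 : 0 <= \sum_k N k by exact: sumr_ge0.
rewrite -mulrDl; apply: ler_wpM2r => //.
have [n0|n0] := posnP n; first by rewrite n0 mulr0n addr0 mulr0 addr0; lra.
rewrite /c; have n0' : (n%:R : R) != 0 by rewrite pnatr_eq0 -lt0n.
have -> : al / (4 * n%:R) * (n%:R + n%:R) = al / 2 by field.
lra.
Qed.

End Lyapunov.

(** * Singular perturbation of a single mode *)

Section VectorDerivatives.
Variable R : realType.

Definition der n (x x' : R -> 'cV[R]_n) :=
  forall t i, is_derive t (1 : R) (fun u => x u i 0) (x' t i 0).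

Lemma scalemxE m n (c : R) (A : 'M[R]_(m, n)) i j : (c *: A) i j = c * A i j.
Proof. by rewrite mxE. Qed.

Lemma addmxE m n (A B : 'M[R]_(m, n)) i j : (A + B) i j = A i j + B i j.
Proof. by rewrite mxE. Qed.

Lemma der_eq n (x x' y' : R -> 'cV[R]_n) : x' =1 y' -> der x x' -> der x y'.
Proof. by move=> /funext ->. Qed.

Lemma derB n (x x' y y' : R -> 'cV[R]_n) :
  der x x' -> der y y' -> der (fun t => x t - y t) (fun t => x' t - y' t).
Proof.
move=> hx hy t i; rewrite !mxE.
rewrite (_ : (fun u => (x u - y u) i 0) = (fun u => x u i 0 - y u i 0)); first exact: isdB.
by apply/funext => u; rewrite !mxE.
Qed.

Lemma derM m n (A : 'M[R]_(m, n)) (x x' : R -> 'cV[R]_n) :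
  der x x' -> der (fun t => A *m x t) (fun t => A *m x' t).
Proof.
move=> hx t i; rewrite mxE.
rewrite (_ : (fun u => (A *m x u) i 0) = (fun u => \sum_j A i j * x u j 0)).
  by apply: isd_sum => j; apply: isdZ.
by apply/funext => u; rewrite mxE.
Qed.

Lemma der_sqn n (x x' : R -> 'cV[R]_n) t : der x x' ->
  is_derive t (1 : R) (fun u => sqn (x u)) (2 * \sum_i x t i 0 * x' t i 0).
Proof.
move=> hx; rewrite mulr_sumr; apply: isd_sum => i.
rewrite (_ : (fun u => x u i 0 ^+ 2) = (fun u => x u i 0 * x u i 0)); last exact/funext.
by rewrite mulr_natl mulr2n; exact: isdM.
Qed.

Lemma sqn_mul m n (A : 'M[R]_(m, n)) (x : 'cV[R]_n) :
  sqn (A *m x) <= (nrm A * n%:R) ^+ 2 * sqn x.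
Proof.
rewrite !sqnE -exprMn ler_sqr ?nnegrE ?mulr_ge0 ?nrm_ge0 ?vnorm_ge0 //.
apply: le_trans (vnorm_le_nrm _) _; apply: le_trans (nrmM _ _) _.
by rewrite -mulrA; apply: ler_wpM2l; [exact: nrm_ge0|exact: nrm_le_vnorm].
Qed.

Lemma sqnD n (x y : 'cV[R]_n) : sqn (x + y) <= 2 * (sqn x + sqn y).
Proof.
rewrite /sqn -big_split mulr_sumr; apply: ler_sum => i _; rewrite mxE /=.
by have := sqr_ge0 (x i 0 - y i 0); nra.
Qed.

Lemma dot_amgm n (x y : 'cV[R]_n) (c : R) : 0 < c ->
  2 * \sum_i x i 0 * y i 0 <= c * sqn x + c^-1 * sqn y.
Proof.
move=> c0; rewrite /sqn !mulr_sumr -big_split; apply: ler_sum => i _ /=.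
have h : 0 <= c^-1 * (c * x i 0 - y i 0) ^+ 2 by rewrite mulr_ge0 ?invr_ge0 ?sqr_ge0 // ltW.
rewrite -subr_ge0; apply: le_trans h _; rewrite le_eqVlt; apply/orP; left; apply/eqP.
by field; rewrite gt_eqF.
Qed.

Lemma nrm_sqn n (x : 'cV[R]_n) c : 0 <= c -> sqn x <= c ^+ 2 -> nrm x <= n%:R * c.
Proof.
move=> c0; rewrite sqnE ler_sqr ?nnegrE ?vnorm_ge0 // => h.
by apply: le_trans (nrm_le_vnorm _) _; apply: ler_wpM2l.
Qed.

(* The functional [sqn w + (be * eps + t) * sqn (Z y)] is of order [eps]: the weight
   [be * eps] absorbs the initial layer of [y], the weight [t] gives decay at time [t]. *)
Lemma tikhonov l n (M : 'M[R]_l) (B : 'M[R]_(l, n)) (D : 'M[R]_n) (K : 'M[R]_(n, l))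
    (a : 'cV[R]_l) (b : 'cV[R]_n) (T : R) : hurwitz D -> 0 < T ->
  exists2 c : R, 0 <= c & forall (eps : R) z y, 0 < eps <= 1 -> z 0 = a -> y 0 = b ->
    der z (fun t => M *m z t + B *m y t) ->
    der y (fun t => eps^-1 *: (D *m y t) + K *m (M *m z t + B *m y t)) ->
    sqn (z T - mexp M T *m a) <= c * eps /\ sqn (y T) <= c * eps.
Proof.
move=> /lyapunov [Z [Zl [al [al0 ZlZ hZ]]]] T0.
pose cn p q (A : 'M[R]_(p, q)) := (nrm A * q%:R) ^+ 2.
have cn0 p q (A : 'M[R]_(p, q)) : 0 <= cn p q A by exact: sqr_ge0.
have yZ (y : 'cV[R]_n) : y = Zl *m (Z *m y) by rewrite mulmxA ZlZ mul1mx.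
pose c1 := 2 * nrm M + 1 + cn _ _ (B *m Zl).
pose cM := sqn a * expR (2 * nrm M * T).
pose c2 := 4 * cn _ _ (Z *m K *m M) * (1 + cM) + 2 * cn _ _ (Z *m K *m B *m Zl).
have cM0 : 0 <= cM by rewrite mulr_ge0 ?sqn_ge0 ?expR_ge0.
have c10 : 0 <= c1 by rewrite !addr_ge0 ?mulr_ge0 ?nrm_ge0.
have c20 : 0 <= c2.
  by apply: addr_ge0; repeat apply: mulr_ge0 => //; rewrite ?cn0 ?addr_ge0.
(* Chosen so that the decay [al / eps] of [q], weighted by [be * eps], outweighs both [c1 * q] from
   the slow equation and the term [q] from differentiating the weight. *)
pose be := (c1 + 1) / al.
have be0 : 0 <= be by apply: divr_ge0; [exact: addr_ge0|exact: ltW].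
pose g := c2 / al; have g0 : 0 <= g by apply: divr_ge0 => //; exact: ltW.
pose c := c1 + g * (be + T) + g.
have beT0 : 0 <= be + T by apply: addr_ge0 => //; exact: ltW.
have c0 : 0 <= c by apply: addr_ge0 => //; apply: addr_ge0 => //; exact: mulr_ge0.
pose bb := g * (be + T).
have bb0 : 0 <= bb by exact: mulr_ge0.
pose q0 := sqn (Z *m b).
pose cE := expR (c * T) * (be * q0 + bb * T).
have q00 : 0 <= q0 by exact: sqn_ge0.
have cE0 : 0 <= cE.
  apply: mulr_ge0; first exact: expR_ge0.
  by apply: addr_ge0; apply: mulr_ge0 => //; exact: ltW.
have cZ0 : 0 <= cn _ _ Zl / T by apply: divr_ge0; [exact: cn0|exact: ltW].
exists (cE * (1 + cn _ _ Zl / T)) => [|eps z y /andP[e0 e1] za y0 hz hy].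
  by apply: mulr_ge0 => //; exact: addr_ge0.
pose w t := z t - mexp M (t - 0) *m a.
have hw : der w (fun t => M *m w t + B *m y t).
  apply: der_eq (derB hz (ode_mexp M 0 a)) => t.
  by rewrite /w mulmxBr addrAC.
pose N t := sqn (w t); pose q t := sqn (Z *m y t).
have N0 t : 0 <= N t by exact: sqn_ge0.
have qt0 t : 0 <= q t by exact: sqn_ge0.
have hN t := der_sqn t hw.
have hq t := der_sqn t (derM Z hy).
pose N' t := 2 * \sum_i w t i 0 * (M *m w t + B *m y t) i 0.
pose q' t := 2 * \sum_i (Z *m y t) i 0 *
  (Z *m (eps^-1 *: (D *m y t) + K *m (M *m z t + B *m y t))) i 0.
have sumD k (u v v' : 'cV[R]_k) :
    \sum_i u i 0 * (v + v') i 0 = \sum_i u i 0 * v i 0 + \sum_i u i 0 * v' i 0.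
  by rewrite -big_split; apply: eq_bigr => i _; rewrite mxE mulrDr.
have N'le t : N' t <= c1 * N t + c1 * q t.
  rewrite /N' sumD mulrDr.
  have h1 := quad_le M (w t).
  have h2 := dot_amgm (w t) (B *m y t) ltr01.
  have h3 : sqn (B *m y t) <= cn _ _ (B *m Zl) * q t.
    by rewrite {1}(yZ (y t)) mulmxA; exact: sqn_mul.
  have n0 := nrm_ge0 M; have b0 := cn0 _ _ (B *m Zl).
  have e2 : 0 <= cn _ _ (B *m Zl) * N t by rewrite mulr_ge0.
  have e3 : 0 <= nrm M * q t by rewrite mulr_ge0.
  rewrite /c1; move: h1 h2 h3 e2 e3 (N0 t) (qt0 t); rewrite -/(N t) invr1.
  move: (cn _ _ _) (nrm M) (N t) (q t) (sqn _) (\sum_i _) (\sum_i _) => *; lra.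
have q'le t : 0 <= t <= T -> q' t <= - (al / eps) * q t + (eps / al) * (c2 * (N t + 1 + q t)).
  move=> /andP[t0 tT].
  pose f := K *m (M *m z t + B *m y t).
  rewrite /q' -/f [Z *m (_ + f)]mulmxDr sumD mulrDr.
  have h1 : \sum_i (Z *m y t) i 0 * (Z *m (eps^-1 *: (D *m y t))) i 0 <= eps^-1 * (- al * q t).
    apply: le_trans (ler_wpM2l _ (hZ (y t))); last by rewrite invr_ge0 ltW.
    rewrite mulr_sumr le_eqVlt; apply/orP; left; apply/eqP/eq_bigr => i _.
    by rewrite -scalemxAr scalemxE mulrCA.
  have ae0 : 0 < al / eps by rewrite divr_gt0.
  (* With the weight [al / eps], half of the decay [2 * al / eps] absorbs the fast part of the
     product, and the remainder is of order [eps]. *)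
  have h2 := dot_amgm (Z *m y t) (Z *m f) ae0.
  have h3 : sqn (Z *m f) <= c2 * (N t + 1 + q t).
    have -> : Z *m f = Z *m K *m M *m z t + Z *m K *m B *m Zl *m (Z *m y t).
      by rewrite /f {1}(yZ (y t)) !mulmxDr !mulmxA.
    apply: le_trans (sqnD _ _) _.
    have k1 := sqn_mul (Z *m K *m M) (z t).
    have k2 := sqn_mul (Z *m K *m B *m Zl) (Z *m y t).
    have k3 : sqn (z t) <= 2 * (N t + cM).
      have -> : z t = w t + mexp M (t - 0) *m a by rewrite /w subrK.
      apply: le_trans (sqnD _ _) _; rewrite ler_pM2l // lerD2l subr0.
      have := ode_growth (ode_mexp M 0 a) t0; rewrite !subr0 mexp0 mul1mx => /le_trans; apply.
      rewrite mulrC; apply: ler_wpM2l; first exact: sqn_ge0.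
      by rewrite ler_expR; apply: ler_wpM2l; rewrite ?mulr_ge0 ?nrm_ge0.
    have k4 : cn _ _ (Z *m K *m M) * sqn (z t) <= cn _ _ (Z *m K *m M) * (2 * (N t + cM)).
      exact: ler_wpM2l.
    move: k1 k2 k4; rewrite -!/(cn _ _ _) -/(q t) /c2.
    have u1 : 0 <= cn _ _ (Z *m K *m M) * (cM * N t) by rewrite mulr_ge0 // mulr_ge0.
    have u2 : 0 <= cn _ _ (Z *m K *m M) * ((1 + cM) * q t) by rewrite mulr_ge0 // mulr_ge0 // addr_ge0.
    have u3 : 0 <= cn _ _ (Z *m K *m B *m Zl) * N t by rewrite mulr_ge0.
    have u4 := cn0 _ _ (Z *m K *m B *m Zl); have u5 := cn0 _ _ (Z *m K *m M).
    move: u1 u2 u3 u4 u5.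
    move: (cn _ _ (Z *m K *m M)) (cn _ _ (Z *m K *m B *m Zl)) (N t) (q t) (sqn _) (sqn _) (sqn _) (cM) => *.
    lra.
  have h4 : (al / eps)^-1 * sqn (Z *m f) <= (eps / al) * (c2 * (N t + 1 + q t)).
    by rewrite invf_div; apply: ler_wpM2l => //; rewrite divr_ge0 // ltW.
  apply: le_trans (lerD (ler_wpM2l _ h1) h2) _ => //.
  apply: le_trans (lerD (lexx _) (lerD (lexx _) h4)) _; rewrite -/(q t) addrA lerD2r.
  rewrite le_eqVlt; apply/orP; left; apply/eqP; field; by rewrite gt_eqF.
pose E t := N t + (be * eps + t) * q t.
have hE t : is_derive t (1 : R) E (N' t + ((be * eps + t) * q' t + q t * 1)).
  have hl : is_derive t (1 : R) (fun u => be * eps + u) 1.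
    by have := isdD (isdC (be * eps) t) (is_derive_id t (1 : R)); rewrite add0r.
  exact: (isdD (hN t) (isdM hl (hq t))).
have hE' t : 0 <= t <= T ->
    N' t + ((be * eps + t) * q' t + q t * 1) <= c * E t + bb * eps.
  move=> tT; have := q'le t tT; have := N'le t; move: tT => /andP[t0 tT] hN' hq'.
  have bt0 : 0 <= be * eps + t by rewrite addr_ge0 // mulr_ge0 // ltW.
  have btT : be * eps + t <= be + T.
    by apply: lerD => //; rewrite ler_piMr.
  have k1 := ler_wpM2l bt0 hq'.
  have eE : eps / al * c2 = eps * g by rewrite /g mulrAC mulrA.
  have k2 : (be * eps + t) * (- (al / eps) * q t) <= - (c1 + 1) * q t.
    have -> : (be * eps + t) * (- (al / eps) * q t) = - ((c1 + 1) * q t) - t * (al / eps) * q t.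
      by rewrite /be; field; rewrite !gt_eqF.
    rewrite mulNr gerBl; do 2!(apply: mulr_ge0 => //).
    by rewrite divr_ge0 // ltW.
  have k3 : (be * eps + t) * (eps / al * (c2 * (N t + 1 + q t))) <=
      g * (be + T) * N t + bb * eps + g * ((be * eps + t) * q t).
    have -> : (be * eps + t) * (eps / al * (c2 * (N t + 1 + q t))) =
      eps * (g * ((be * eps + t) * (N t + 1))) + eps * (g * ((be * eps + t) * q t)).
      by rewrite [eps / al * _]mulrA eE; ring.
    have h1 : eps * (g * ((be * eps + t) * q t)) <= g * ((be * eps + t) * q t).
      by rewrite ler_piMl // mulr_ge0 // mulr_ge0.
    have h2 : eps * (g * ((be * eps + t) * (N t + 1))) <= eps * (g * ((be + T) * (N t + 1))).
      apply: ler_wpM2l; first exact: ltW.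
      by apply: ler_wpM2l => //; apply: ler_wpM2r => //; exact: addr_ge0.
    apply: le_trans (lerD h2 h1) _; rewrite lerD2r /bb.
    have -> : eps * (g * ((be + T) * (N t + 1))) =
      eps * (g * (be + T) * N t) + g * (be + T) * eps by ring.
    by rewrite lerD2r ler_piMl // mulr_ge0 // mulr_ge0.
  rewrite mulr1 /E /c; move: hN' k1 k2 k3; rewrite [(be * eps + t) * (_ + _)]mulrDr => hN' k1 k2 k3.
  have j1 : 0 <= g * N t by rewrite mulr_ge0.
  have j2 : 0 <= c1 * ((be * eps + t) * q t) by rewrite mulr_ge0 // mulr_ge0.
  have j3 : 0 <= g * (be + T) * ((be * eps + t) * q t) by apply: mulr_ge0; exact: mulr_ge0.
  move: hN' k1 k2 k3 j1 j2 j3; rewrite -/bb.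
  move: (N' t) ((be * eps + t) * q' t) (bb * eps) => n1 n2 n3.
  move: ((be * eps + t) * q t) ((be * eps + t) * (- _ * q t)) ((be * eps + t) * (eps / al * _)) => n4 n5 n6.
  move: (g) (N t) (q t) (c1) (be + T) => *; lra.
have := @gronwall R E _ c (bb * eps) T (ltW T0) c0 (mulr_ge0 bb0 (ltW e0)) hE hE'.
have -> : E 0 = be * eps * q0.
  rewrite /E /N /w za subrr mexp0 mul1mx subrr addr0 /q y0.
  by rewrite (_ : sqn 0 = 0) ?add0r // /sqn big1 // => i _; rewrite mxE expr0n.
have -> : expR (c * T) * (be * eps * q0 + bb * eps * T) = cE * eps by rewrite /cE; ring.
rewrite /E => hfin.
have hN1 : N T <= cE * eps.
  by apply: le_trans hfin; rewrite lerDl mulr_ge0 // addr_ge0 ?(ltW T0) // mulr_ge0 // ltW.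
have hq1 : q T <= cE * eps / T.
  rewrite ler_pdivlMr // mulrC; apply: le_trans hfin; apply: ler_wpDl => //.
  by apply: ler_wpM2r => //; rewrite lerDr mulr_ge0 // ltW.
have ce0 : 0 <= cE * eps by rewrite mulr_ge0 // ltW.
split.
  rewrite /N /w subr0 in hN1; apply: le_trans hN1 _.
  by rewrite [leRHS]mulrAC; apply: ler_peMr => //; rewrite lerDl.
rewrite {1}(yZ (y T)); apply: le_trans (sqn_mul _ _) _.
rewrite -/(cn _ _ _) -/(q T); apply: le_trans (ler_wpM2l (cn0 _ _ _) hq1) _.
have -> : cn _ _ Zl * (cE * eps / T) = cE * eps * (cn _ _ Zl / T) by ring.
by rewrite [leRHS]mulrAC; apply: ler_wpM2l => //; rewrite lerDr.
Qed.

End VectorDerivatives.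

(** * Limits as the parameter tends to zero from above *)

Section SmallParameter.
Variable R : realType.

Definition near0 (P : R -> Prop) := exists2 e0 : R, 0 < e0 & forall e, 0 < e < e0 -> P e.

Lemma near0_sub (P Q : R -> Prop) : (forall e, 0 < e -> P e -> Q e) -> near0 P -> near0 Q.
Proof.
move=> PQ [e0 e00 h]; exists e0 => // e he; apply: PQ; last exact: h.
by case/andP: he.
Qed.

Lemma near0_and (P Q : R -> Prop) : near0 P -> near0 Q -> near0 (fun e => P e /\ Q e).
Proof.
move=> [e1 e10 h1] [e2 e20 h2]; exists (Num.min e1 e2); first by rewrite lt_min e10.
by move=> e; rewrite lt_min => /and3P[e0 l1 l2]; split; [apply: h1|apply: h2]; rewrite e0.
Qed.

Lemma near0_seq (T : eqType) (s : seq T) (P : T -> R -> Prop) :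
  (forall x, x \in s -> near0 (P x)) -> near0 (fun e => forall x, x \in s -> P x e).
Proof.
elim: s => [|x s IH] h; first by exists 1.
have [||e0 e00 he] := @near0_and (P x) (fun e => forall y, y \in s -> P y e).
- by apply: h; rewrite inE eqxx.
- by apply: IH => y ys; apply: h; rewrite inE ys orbT.
by exists e0 => // e /he[h1 h2] y; rewrite inE => /orP[/eqP ->|/h2].
Qed.

Definition tends0 m n (G : R -> 'M[R]_(m, n)) (F : 'M[R]_(m, n)) :=
  forall eta, 0 < eta -> near0 (fun e => nrm (G e - F) <= eta).

Lemma tends0_cst m n (F : 'M[R]_(m, n)) : tends0 (fun=> F) F.
Proof. by move=> eta eta0; exists 1 => // e _; rewrite subrr nrm0 ltW. Qed.

Lemma tends0M m n p (G : R -> 'M[R]_(m, n)) (F : 'M[R]_(m, n)) (G' : R -> 'M[R]_(n, p))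
  (F' : 'M[R]_(n, p)) : tends0 G F -> tends0 G' F' -> tends0 (fun e => G e *m G' e) (F *m F').
Proof.
move=> h h' eta eta0.
pose q := nrm F + 1 + (nrm F' + 1).
have q0 : 0 < q by rewrite addr_gt0 // ltr_wpDl ?nrm_ge0.
have d0 : 0 < eta / q by rewrite divr_gt0.
have m0 : 0 < Num.min 1 (eta / q) by rewrite lt_min ltr01.
apply: near0_sub (near0_and (h _ m0) (h' _ m0)) => e _ [].
rewrite !le_min => /andP[h1 h2] /andP[h3 h4].
have -> : G e *m G' e - F *m F' = G e *m (G' e - F') + (G e - F) *m F'.
  by rewrite mulmxBr mulmxBl addrA subrK.
apply: le_trans (nrmD _ _) _.
have -> : eta = (nrm F + 1) * (eta / q) + (eta / q) * (nrm F' + 1).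
  by rewrite [(nrm F + 1) * _]mulrC -mulrDr divfK // gt_eqF.
apply: lerD; last by apply: nrmMle => //; rewrite lerDl.
by apply: nrmMle => //; apply: le_trans (nrm_tri _ F) _; rewrite lerD2l.
Qed.

Lemma tends0_cols m n (G : R -> 'M[R]_(m, n)) F :
  (forall v : 'cV[R]_n, tends0 (fun e => G e *m v) (F *m v)) -> tends0 G F.
Proof.
move=> h eta eta0.
have d0 : 0 < eta / n.+1%:R by rewrite divr_gt0.
apply: near0_sub (near0_seq (s := enum 'I_n) (fun j _ => h (delta_mx j 0) _ d0)) => e _ he.
rewrite /nrm exchange_big /=.
apply: (@le_trans _ _ (\sum_(j < n) eta / n.+1%:R)).
  apply: ler_sum => j _; have := he j; rewrite mem_enum => /(_ isT); apply: le_trans.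
  by rewrite -mulmxBl -colE nrm_cV; apply: ler_sum => i _; rewrite !mxE.
rewrite sumr_const card_ord -[_ *+ n]mulr_natl mulrCA ler_piMr ?(ltW eta0) //.
by rewrite ler_pdivrMr // mul1r ler_nat.
Qed.

(** Fits [tikhonov], whose bound of order eps concerns squared norms. *)
Lemma tends0_sqrt m n (G : R -> 'M[R]_(m, n)) F c : 0 <= c ->
  (forall e, 0 < e <= 1 -> nrm (G e - F) <= c * Num.sqrt e) -> tends0 G F.
Proof.
move=> c0 h eta eta0.
have c1 : 0 < c + 1 by rewrite ltr_wpDl.
exists (Num.min 1 ((eta / (c + 1)) ^+ 2)); first by rewrite lt_min ltr01 exprn_gt0 // divr_gt0.
move=> e; rewrite lt_min => /and3P[e0 e1 e2].
apply: le_trans (h e _) _; first by rewrite e0 ltW.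
apply: (@le_trans _ _ ((c + 1) * (eta / (c + 1)))); last by rewrite mulrC divfK // gt_eqF.
apply: ler_pM; rewrite ?sqrtr_ge0 // ?lerDl //.
have -> : eta / (c + 1) = Num.sqrt ((eta / (c + 1)) ^+ 2).
  by rewrite sqrtr_sqr ger0_norm // divr_ge0 // ltW.
by rewrite ler_wsqrtr // ltW.
Qed.

Lemma tends0_wmat n (X : Type) (A' : R -> X -> 'M[R]_n) (A : X -> 'M[R]_n) (w : seq X) :
  (forall a, List.In a w -> tends0 (A'^~ a) (A a)) -> tends0 (fun e => wmat (A' e) w) (wmat A w).
Proof.
elim: w => [|a w IH] h /=; first exact: tends0_cst.
by apply: tends0M; [apply: IH => b bw; apply: h; right|apply: h; left].
Qed.

End SmallParameter.

Section ExponentialPerturbation.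
Variables (R : realType) (n : nat).

(** The difference w of two trajectories solves w' = A' w + (A' - A) y, a linear equation with a
    forcing of size [nrm (A' - A)]; Gronwall's inequality applies to its square. *)
Lemma mexp_pert (A : 'M[R]_n) t : 0 <= t -> exists2 c, 0 <= c &
  forall A', nrm (A' - A) <= 1 -> nrm (mexp A' t - mexp A t) <= c * nrm (A' - A).
Proof.
move=> t0.
pose cY := expR (2 * nrm A * t).
pose c := 2 * (nrm A + 1) + 1.
have cc0 : 0 <= c by rewrite addr_ge0 // mulr_ge0 // addr_ge0 ?nrm_ge0.
have cY0 : 0 <= cY by exact: expR_ge0.
pose k2 := expR (c * t) * (n%:R ^+ 2 * cY * t).
have k20 : 0 <= k2 by apply: mulr_ge0; [exact: expR_ge0|]; apply: mulr_ge0 => //; apply: mulr_ge0 => //; exact: sqr_ge0.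
pose k := Num.sqrt k2.
have kk : k2 = k ^+ 2 by rewrite sqr_sqrtr.
have k0 : 0 <= k by exact: sqrtr_ge0.
exists (n%:R * (n%:R * k)) => [|A' hA']; first by rewrite !mulr_ge0.
rewrite -mulrA; apply: nrm_le_apply => v.
pose dl := nrm (A' - A); have dl0 : 0 <= dl by exact: nrm_ge0.
pose x u := mexp A' (u - 0) *m v; pose y u := mexp A (u - 0) *m v.
pose w u := x u - y u.
have hw : der w (fun u => A' *m w u + (A' - A) *m y u).
  apply: der_eq (derB (ode_mexp A' 0 v) (ode_mexp A 0 v)) => u.
  by rewrite /w mulmxBr mulmxBl addrA subrK.
have yb u : 0 <= u <= t -> sqn (y u) <= cY * sqn v.
  move=> /andP[u0 ut]; have := ode_growth (ode_mexp A 0 v) u0; rewrite subrr mexp0 mul1mx.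
  move/le_trans; apply; apply: ler_wpM2r; first exact: sqn_ge0.
  by rewrite ler_expR; apply: ler_wpM2l => //; rewrite mulr_ge0 ?nrm_ge0.
pose b := (dl * n%:R) ^+ 2 * (cY * sqn v).
have b0 : 0 <= b by apply: mulr_ge0; [exact: sqr_ge0|apply: mulr_ge0 => //; exact: sqn_ge0].
have := @gronwall R (fun u => sqn (w u)) _ c b t t0 cc0 b0 (fun u => der_sqn u hw).
have -> : sqn (w 0) = 0.
  by rewrite /w /x /y subrr !mexp0 subrr /sqn big1 // => i _; rewrite mxE expr0n.
rewrite add0r => /(_ _) hg.
have : sqn (w t) <= expR (c * t) * (b * t).
  apply: hg => u ut.
  have -> : \sum_i w u i 0 * (A' *m w u + (A' - A) *m y u) i 0 =
    \sum_i w u i 0 * (A' *m w u) i 0 + \sum_i w u i 0 * ((A' - A) *m y u) i 0.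
    by rewrite -big_split; apply: eq_bigr => i _; rewrite (addmxE (A' *m w u)) mulrDr.
  rewrite mulrDr.
  have h1 := quad_le A' (w u).
  have h2 := dot_amgm (w u) ((A' - A) *m y u) ltr01.
  have h3 : sqn ((A' - A) *m y u) <= b.
    apply: le_trans (sqn_mul _ _) _; apply: ler_wpM2l; first exact: sqr_ge0.
    exact: yb.
  have h4 : nrm A' * sqn (w u) <= (nrm A + 1) * sqn (w u).
    apply: ler_wpM2r; first exact: sqn_ge0.
    by apply: le_trans (nrm_tri _ A) _; rewrite lerD2l.
  rewrite invr1 in h2; rewrite /c; move: h1 h2 h3 h4.
  move: (sqn (w u)) (sqn (_ *m _)) (\sum_i _) (\sum_i _) (nrm A') (nrm A) (b) => *; lra.
have -> : expR (c * t) * (b * t) = (k * dl * vnorm v) ^+ 2.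
  by rewrite /b !exprMn -kk /k2 -sqnE; ring.
rewrite /w /x /y subr0 -mulmxBl => h.
apply: le_trans (nrm_sqn _ h) _; first by rewrite !mulr_ge0 ?vnorm_ge0.
rewrite -/dl -!mulrA; do 3!(apply: ler_wpM2l => //).
exact: vnorm_le_nrm.
Qed.

Lemma mexp_scale (A : 'M[R]_n) c t : 0 <= t -> mexp A (c * t) = mexp (c *: A) t.
Proof.
move=> t0; apply/matrixP => i j.
have hx : ode (c *: A) (fun u => mexp A (c * u) *m delta_mx j (0 : 'I_1)).
  move=> u k.
  have := ode_mexp A 0 (delta_mx j (0 : 'I_1)) (c * u) k; rewrite subr0 => h.
  have hs : is_derive u (1 : R) (fun u => c * u) c.
    by have := isdZ c (is_derive_id u (1 : R)); rewrite mulr1.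
  have := @is_derive1_comp R (fun u => (mexp A (u - 0) *m delta_mx j (0 : 'I_1)) k 0) (fun u => c * u) u _ c h hs.
  rewrite -scalemxAl scalemxE mulrC.
  rewrite (_ : _ \o _ = (fun u => (mexp A (c * u) *m delta_mx j (0 : 'I_1)) k 0)) //.
  by apply/funext => v /=; rewrite subr0.
have := ode_mexpE hx t0; rewrite mulr0 mexp0 mul1mx subr0 => /matrixP/(_ i 0).
by rewrite -!colE !mxE.
Qed.

End ExponentialPerturbation.

(** * Selection matrices for the block decomposition *)

Section Blocks.
Variables (R : realType) (d : nat).

(** Rows k, ..., k + p - 1 of the identity. Products with it and its transpose extract and insert
    blocks without casts along d = l + (d - l). *)
Definition sel (k p : nat) : 'M[R]_(p, d) := \matrix_(i, j) ((k + i)%N == j :> nat)%:R.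

Lemma mgetE m n (A : 'M[R]_(m, n)) (a : 'I_m) (b : 'I_n) : mget A a b = A a b.
Proof. by rewrite /mget !valK. Qed.

Lemma sel_mul k p q (Y : 'M[R]_(d, q)) (i : 'I_p) (a : 'I_d) j :
  a = (k + i)%N :> nat -> (sel k p *m Y) i j = Y a j.
Proof.
move=> e; rewrite mxE (bigD1 a) //= big1 ?addr0 => [|b ba].
  by rewrite mxE e eqxx mul1r.
rewrite mxE -e; case: eqP => [ab|_]; last by rewrite mul0r.
by move: ba; rewrite (val_inj ab) eqxx.
Qed.

Lemma trsel_mul k p q (Y : 'M[R]_(p, q)) (i : 'I_p) (a : 'I_d) j :
  a = (k + i)%N :> nat -> ((sel k p)^T *m Y) a j = Y i j.
Proof.
move=> e; rewrite mxE (bigD1 i) //= big1 ?addr0 => [|b bi].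
  by rewrite !mxE e eqxx mul1r.
rewrite !mxE e eqn_add2l; case: eqP => [ab|_]; last by rewrite mul0r.
by move: bi; rewrite (val_inj ab) eqxx.
Qed.

Lemma trsel_mul0 k p q (Y : 'M[R]_(p, q)) (a : 'I_d) j :
  ~~ (k <= a < k + p)%N -> ((sel k p)^T *m Y) a j = 0.
Proof.
move=> ha; rewrite mxE big1 // => i _; rewrite !mxE.
case: eqP => [e|_]; last by rewrite mul0r.
by move: ha; rewrite -e leq_addr ltn_add2l ltn_ord.
Qed.

Lemma mul_sel k p q (Y : 'M[R]_(q, p)) (i : 'I_p) (a : 'I_d) j :
  a = (k + i)%N :> nat -> (Y *m sel k p) j a = Y j i.
Proof. by move=> e; have := trsel_mul Y^T j e; rewrite -trmx_mul !mxE. Qed.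

Lemma mul_sel0 k p q (Y : 'M[R]_(q, p)) (a : 'I_d) j :
  ~~ (k <= a < k + p)%N -> (Y *m sel k p) j a = 0.
Proof. by move=> e; have := trsel_mul0 Y^T j e; rewrite -trmx_mul !mxE. Qed.

Lemma mul_trsel k p q (Y : 'M[R]_(q, d)) (i : 'I_p) (a : 'I_d) j :
  a = (k + i)%N :> nat -> (Y *m (sel k p)^T) j i = Y j a.
Proof. by move=> e; rewrite -[Y in LHS]trmxK -trmx_mul mxE (sel_mul _ _ e) mxE. Qed.

Lemma sel_block k p c q (W : 'M[R]_(p, q)) (a b : 'I_d) :
  ((sel k p)^T *m W *m sel c q) a b =
  if [&& k <= a, a < k + p, c <= b & b < c + q]%N then mget W (a - k) (b - c) else 0.
Proof.
have [/andP[ka ap]|ha] := boolP (k <= a < k + p)%N; last first.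
  by rewrite -mulmxA trsel_mul0 //; case: ifP => // /and4P[ka ap _ _]; rewrite ka ap in ha.
have [/andP[cb bq]|hb] := boolP (c <= b < c + q)%N; last first.
  by rewrite mul_sel0 // !andbF.
have ip : (a - k < p)%N by rewrite ltn_subLR.
have jq : (b - c < q)%N by rewrite ltn_subLR.
rewrite ka ap /= (mul_sel _ _ (i := Ordinal jq)) /= ?subnKC //.
rewrite (trsel_mul _ _ (i := Ordinal ip)) /= ?subnKC //.
by rewrite -mgetE.
Qed.

Lemma subblkE (Y : 'M[R]_d) r c p q : (r + p <= d)%N -> (c + q <= d)%N ->
  subblk Y r c p q = sel r p *m Y *m (sel c q)^T.
Proof.
move=> rp cq; apply/matrixP => i j; rewrite mxE.
have ai : (r + i < d)%N by rewrite (leq_trans _ rp) // ltn_add2l.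
have bj : (c + j < d)%N by rewrite (leq_trans _ cq) // ltn_add2l.
rewrite (mul_trsel _ _ (a := Ordinal bj)) // (sel_mul _ _ (a := Ordinal ai)) //.
by rewrite -mgetE.
Qed.

Lemma sel_trsel k p c q (i : 'I_p) (j : 'I_q) : (k + p <= d)%N ->
  (sel k p *m (sel c q)^T) i j = ((c + j)%N == (k + i)%N :> nat)%:R.
Proof.
move=> kp; have ai : (k + i < d)%N by rewrite (leq_trans _ kp) // ltn_add2l.
by rewrite (sel_mul _ _ (a := Ordinal ai)) // !mxE.
Qed.

Variable l : nat.
Hypothesis ld : (l <= d)%N.
Let I1 := sel 0 l.
Let I2 := sel l (d - l).

Lemma selI11 : I1 *m I1^T = 1%:M.
Proof. by apply/matrixP => i j; rewrite sel_trsel // !add0n mxE eq_sym. Qed.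

Lemma selI22 : I2 *m I2^T = 1%:M.
Proof. by apply/matrixP => i j; rewrite sel_trsel ?subnKC // eqn_add2l mxE eq_sym. Qed.

Lemma selI12 : I1 *m I2^T = 0.
Proof.
apply/matrixP => i j; rewrite sel_trsel // add0n [RHS]mxE.
by rewrite gtn_eqF // (leq_trans (ltn_ord i)) // leq_addr.
Qed.

Lemma selI21 : I2 *m I1^T = 0.
Proof. by rewrite -[LHS]trmxK trmx_mul trmxK selI12 trmx0. Qed.

Lemma selI : I1^T *m I1 + I2^T *m I2 = 1%:M.
Proof.
apply/matrixP => a b; rewrite -(mulmx1 I1^T) -(mulmx1 I2^T) mxE !sel_block !subn0 add0n subnKC //.
have mg1 p (x y : nat) : (x < p)%N -> (y < p)%N -> mget (1%:M : 'M[R]_p) x y = (x == y)%:R.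
  by move=> xp yp; rewrite (mgetE _ (Ordinal xp) (Ordinal yp)) mxE.
rewrite !ltn_ord /= [RHS]mxE.
have [al|la] := ltnP a l; have [bl|lb] := ltnP b l; rewrite /= ?addr0 ?add0r.
- by rewrite mg1.
- by case: eqP => // e; move: al; rewrite e ltnNge lb.
- by case: eqP => // e; move: bl; rewrite -e ltnNge la.
- rewrite mg1 ?ltn_sub2r ?(leq_ltn_trans la) //.
  by rewrite -(eqn_add2r l) !subnK.
Qed.

End Blocks.

Lemma hurwitz_unit (R : realType) n (D : 'M[R]_n) : hurwitz D -> D \in unitmx.
Proof.
move=> h; rewrite unitmxE unitfE; apply/negP => /eqP d0.
suff : complex.Re (0 : R[i]) < 0 by rewrite ltxx.
apply: h; have -> : (0 : R[i]) = real_complex R 0 by [].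
by rewrite fmorph_root rootE horner_coef0 char_poly_det d0 mulr0.
Qed.

Lemma sandwich_mul (R : realType) d l (T : 'M[R]_d) (I : 'M[R]_(l, d)) (E1 E2 : 'M[R]_l) :
  T \in unitmx -> I *m I^T = 1%:M ->
  (invmx T *m I^T *m E1 *m I *m T) *m (invmx T *m I^T *m E2 *m I *m T) =
  invmx T *m I^T *m (E1 *m E2) *m I *m T.
Proof.
by move=> Tu II; rewrite !mulmxA (mulmxK Tu) -[_ *m I *m I^T]mulmxA II mulmx1.
Qed.

Section Mode.
Variables (R : realType) (d : nat).
Notation mode := (nat * 'M[R]_d * 'M[R]_d * 'M[R]_d)%type.
Variable s : mode.
Let l := m_l s.
Hypothesis ld : (l <= d)%N.
Hypothesis Pu : m_P s \in unitmx.
Hypothesis DH : hurwitz (blkD s).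

Let I1 : 'M[R]_(l, d) := sel R d 0 l.
Let I2 : 'M[R]_(d - l, d) := sel R d l (d - l).
Let X := LPinv s.
Let A : 'M[R]_l := blkA s.
Let B : 'M[R]_(l, d - l) := blkB s.
Let C : 'M[R]_(d - l, l) := blkC s.
Let D : 'M[R]_(d - l) := blkD s.
Let W : 'M[R]_(d - l, l) := invmx D *m C.
Let M : 'M[R]_l := Mred s.
Let P := m_P s.
Let T := Tmat s.

Lemma blkA_E : A = I1 *m X *m I1^T. Proof. by rewrite /A /blkA subblkE. Qed.
Lemma blkB_E : B = I1 *m X *m I2^T. Proof. by rewrite /B /blkB subblkE // subnKC. Qed.
Lemma blkC_E : C = I2 *m X *m I1^T. Proof. by rewrite /C /blkC subblkE // subnKC. Qed.
Lemma blkD_E : D = I2 *m X *m I2^T. Proof. by rewrite /D /blkD subblkE // subnKC. Qed.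

Let L := 1%:M + I2^T *m W *m I1.

Lemma Tmat_E : T = L *m P.
Proof.
rewrite /T /Tmat; congr (_ *m _); apply/matrixP => i j.
rewrite /L mxE [RHS]mxE [1%:M i j]mxE sel_block subn0 /= add0n subnKC // ltn_ord /=.
rewrite -/l; have [il|li] := ltnP i l => /=; first by rewrite addr0.
have [jl|lj] := ltnP j l => /=; last by rewrite addr0.
rewrite (_ : (i == j) = false) ?add0r //.
by apply/negP => /eqP e; move: jl; rewrite -e ltnNge li.
Qed.

Lemma I1L : I1 *m L = I1.
Proof. by rewrite mulmxDr mulmx1 !mulmxA selI12 // !mul0mx addr0. Qed.

Lemma I2L : I2 *m L = I2 + W *m I1.
Proof. by rewrite mulmxDr mulmx1 !mulmxA selI22 // mul1mx. Qed.

Lemma LI2 : L *m I2^T = I2^T.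
Proof. by rewrite mulmxDl mul1mx -!mulmxA selI12 // !mulmx0 addr0. Qed.

Lemma L_inv : L *m (1%:M - I2^T *m W *m I1) = 1%:M.
Proof. by rewrite mulmxBr mulmx1 -(mulmxA I2^T) (mulmxA L) LI2 /L (mulmxA I2^T) addrK. Qed.

Lemma L_unit : L \in unitmx.
Proof. by case/mulmx1_unit: L_inv. Qed.

Lemma T_unit : T \in unitmx.
Proof. by rewrite Tmat_E unitmx_mul L_unit. Qed.

Lemma Tinv_E : invmx T = invmx P *m (1%:M - I2^T *m W *m I1).
Proof.
apply: (can_inj (mulKmx T_unit)); rewrite mulmxV ?T_unit // Tmat_E -(mulmxA L) mulKVmx //.
by rewrite L_inv.
Qed.

Lemma I1T : I1 *m T = I1 *m P.
Proof. by rewrite Tmat_E mulmxA I1L. Qed.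

Lemma sel_split n (Y : 'M[R]_(d, n)) : Y = I1^T *m (I1 *m Y) + I2^T *m (I2 *m Y).
Proof. by rewrite !mulmxA -mulmxDl selI // mul1mx. Qed.


Lemma Lam_E : m_Lam s = X *m P.
Proof. by rewrite /X /LPinv mulmxKV. Qed.

Lemma X_I1 : I1 *m X = A *m I1 + B *m I2.
Proof. by rewrite blkA_E blkB_E -!mulmxA -!mulmxDr selI // mulmx1. Qed.

Lemma X_I2 : I2 *m X = C *m I1 + D *m I2.
Proof. by rewrite blkC_E blkD_E -!mulmxA -!mulmxDr selI // mulmx1. Qed.

Lemma DW : D *m W = C.
Proof. by rewrite /W mulKVmx //; exact: hurwitz_unit. Qed.

Lemma Eeps_E eps : Eeps d eps l = I1^T *m I1 + eps *: (I2^T *m I2).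
Proof.
apply/matrixP => a b; rewrite -(mulmx1 I1^T) -(mulmx1 I2^T) addmxE scalemxE !sel_block.
rewrite !subn0 add0n subnKC // mxE !ltn_ord /=.
have mg1 p (x y : nat) : (x < p)%N -> (y < p)%N -> mget (1%:M : 'M[R]_p) x y = (x == y)%:R.
  by move=> xp yp; rewrite (mgetE _ (Ordinal xp) (Ordinal yp)) mxE.
have [al|la] := ltnP a l; have [bl|lb] := ltnP b l; rewrite /= ?mulr0 ?addr0 ?add0r.
- by rewrite mg1 //= -[a == b]/(a == b :> nat); case: eqP.
- by case: eqP => // e; move: al; rewrite e ltnNge lb.
- by case: eqP => // e; move: bl; rewrite -e ltnNge la.
- rewrite mg1 ?ltn_sub2r ?(leq_ltn_trans la) //.
  by rewrite -(eqn_add2r l) !subnK // -[a == b]/(a == b :> nat); case: eqP; rewrite ?mulr1 ?mulr0.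
Qed.

Definition Einv (eps : R) : 'M[R]_d := I1^T *m I1 + eps^-1 *: (I2^T *m I2).

Lemma Eeps_inv (eps : R) : eps != 0 -> Eeps d eps l *m Einv eps = 1%:M.
Proof.
move=> e0; rewrite Eeps_E /Einv mulmxDr !mulmxDl -!scalemxAl -!scalemxAr.
rewrite -!mulmxA (mulmxA I1 I1^T) (mulmxA I2 I2^T) (mulmxA I1 I2^T) (mulmxA I2 I1^T).
rewrite selI11 // selI22 // selI12 // selI21 // !mul1mx !mul0mx !mulmx0 !scaler0 addr0 add0r.
by rewrite scalerA divff // scale1r selI.
Qed.

Lemma Eeps_unit (eps : R) : eps != 0 -> Eeps d eps l \in unitmx.
Proof. by move=> /Eeps_inv/mulmx1_unit[]. Qed.

Definition Heps (eps : R) : 'M[R]_d := invmx (Eeps d eps l *m P) *m m_Lam s.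

Lemma Heps_E eps : eps != 0 -> Heps eps = invmx P *m Einv eps *m m_Lam s.
Proof.
move=> e0; rewrite /Heps; congr (_ *m _).
have EPu : Eeps d eps l *m P \in unitmx by rewrite unitmx_mul Eeps_unit.
apply: (can_inj (mulKmx EPu)); rewrite mulmxV //.
by rewrite -mulmxA (mulmxA P) mulmxV // mul1mx Eeps_inv.
Qed.

Lemma PH eps : eps != 0 -> P *m Heps eps = Einv eps *m X *m P.
Proof. by move=> e0; rewrite Heps_E // Lam_E !mulmxA mulmxV // mul1mx. Qed.

Lemma I1Einv eps : I1 *m Einv eps = I1.
Proof.
by rewrite mulmxDr mulmxA selI11 // mul1mx -scalemxAr mulmxA selI12 // mul0mx scaler0 addr0.
Qed.

Lemma I2Einv eps : I2 *m Einv eps = eps^-1 *: I2.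
Proof.
by rewrite mulmxDr mulmxA selI21 // mul0mx add0r -scalemxAr mulmxA selI22 // mul1mx.
Qed.

(** [y] is the deviation of the second block of [P *m x] from its quasi-steady value [- W *m z].
    This removes [C] from the fast equation and turns the slow matrix into [M]. *)
Lemma fast_slow (eps : R) (x : 'cV[R]_d) : eps != 0 -> let z := I1 *m (P *m x) in let y := I2 *m (T *m x) in
  I1 *m (P *m (Heps eps *m x)) = M *m z + B *m y /\
  I2 *m (T *m (Heps eps *m x)) = eps^-1 *: (D *m y) + W *m (M *m z + B *m y).
Proof.
move=> e0 z y.
have zE : I1 *m (P *m x) = z by [].
have PHx : P *m (Heps eps *m x) = Einv eps *m (X *m (P *m x)).
  by rewrite (mulmxA P (Heps eps)) PH // -(mulmxA _ P) -(mulmxA _ X).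
have TE n (Y : 'M[R]_(d, n)) : I2 *m (T *m Y) = I2 *m (P *m Y) + W *m (I1 *m (P *m Y)).
  by rewrite Tmat_E -(mulmxA L) (mulmxA I2 L) I2L mulmxDl -(mulmxA W).
have z2 : I2 *m (P *m x) = y - W *m z by rewrite /y TE addrK.
have hz1 : I1 *m (X *m (P *m x)) = A *m z + B *m (y - W *m z).
  by rewrite (mulmxA I1 X) X_I1 mulmxDl -(mulmxA A) -(mulmxA B) zE z2.
have hz2 : I2 *m (X *m (P *m x)) = C *m z + D *m (y - W *m z).
  by rewrite (mulmxA I2 X) X_I2 mulmxDl -(mulmxA C) -(mulmxA D) zE z2.
have h1 : I1 *m (P *m (Heps eps *m x)) = M *m z + B *m y.
  rewrite PHx (mulmxA I1 (Einv eps)) I1Einv hz1 mulmxBr addrA addrAC; congr (_ + _).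
  by rewrite /M /Mred -/A -/B -/C -/D mulmxBl /W !mulmxA.
split=> //; rewrite TE h1; congr (_ + _).
rewrite PHx (mulmxA I2 (Einv eps)) I2Einv -scalemxAl hz2 mulmxBr (mulmxA D W) DW.
by rewrite addrCA subrr addr0.
Qed.

(** At time 0 this is a projection of rank l and not the identity, because the fast component has
    already relaxed; convergence to it holds for positive times only. *)
Definition Fbar (t : R) : 'M[R]_d := invmx T *m I1^T *m mexp M t *m I1 *m T.

Lemma Fbar_lim t : 0 < t -> tends0 (fun e => mexp (Heps e) t) (Fbar t).
Proof.
move=> t0; apply: tends0_cols => v.
have [c c0 hc] := tikhonov M B W (I1 *m (P *m v)) (I2 *m (T *m v)) DH t0.
pose k := nrm (invmx T) * (nrm I1^T * (l%:R * Num.sqrt c) + nrm I2^T * ((d - l)%:R * Num.sqrt c)).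
have k0 : 0 <= k.
  by rewrite mulr_ge0 ?nrm_ge0 // addr_ge0 // mulr_ge0 ?nrm_ge0 // mulr_ge0 ?sqrtr_ge0.
apply: (@tends0_sqrt _ _ _ _ _ k k0) => e e01; have /andP[e0 e1] := e01.
have e0' : e != 0 by rewrite gt_eqF.
pose x u := mexp (Heps e) (u - 0) *m v.
pose z u := I1 *m (P *m x u); pose y u := I2 *m (T *m x u).
have hx : der x (fun u => Heps e *m x u) := ode_mexp (Heps e) 0 v.
have x0 : x 0 = v by rewrite /x subrr mexp0 mul1mx.
have [||||h1 h2] := hc e z y e01.
- by rewrite /z x0.
- by rewrite /y x0.
- by apply: der_eq (derM I1 (derM P hx)) => u; have [] := fast_slow (x u) e0'.
- by apply: der_eq (derM I2 (derM T hx)) => u; have [] := fast_slow (x u) e0'.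
have xE : mexp (Heps e) t *m v = x t by rewrite /x subr0.
have -> : mexp (Heps e) t *m v - Fbar t *m v = invmx T *m
    (I1^T *m (z t - mexp M t *m (I1 *m (P *m v))) + I2^T *m y t).
  rewrite xE (mulmxBr I1^T) addrAC (mulmxBr (invmx T)).
  have -> : I1^T *m z t + I2^T *m y t = T *m x t.
    by rewrite [RHS]sel_split (mulmxA I1) I1T -mulmxA.
  rewrite mulKmx ?T_unit //; congr (_ - _).
  by rewrite /Fbar (mulmxA I1) -I1T !mulmxA.
have se : 0 <= Num.sqrt c * Num.sqrt e by rewrite mulr_ge0 ?sqrtr_ge0.
have ce : c * e = (Num.sqrt c * Num.sqrt e) ^+ 2 by rewrite exprMn !sqr_sqrtr // ltW.
rewrite ce in h1 h2; have {}h1 := nrm_sqn se h1; have {}h2 := nrm_sqn se h2.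
rewrite /k -mulrA; apply: nrmMle => //; apply: le_trans (nrmD _ _) _.
rewrite mulrDl -!mulrA; apply: lerD; exact: nrmMle.
Qed.

Lemma FbarD t u : 0 <= t -> 0 <= u -> Fbar (t + u) = Fbar u *m Fbar t.
Proof.
by move=> t0 u0; rewrite /Fbar mexpD // sandwich_mul ?T_unit ?selI11.
Qed.

Definition Hhat : 'M[R]_d := invmx T *m diag0D s *m T.

Lemma diag0D_E : diag0D s = I2^T *m D *m I2.
Proof.
apply/matrixP => a b; rewrite sel_block mxE subnKC // !ltn_ord /= !andbT.
by [].
Qed.

(** The block [D^{-1} C] of [T] cancels in the conjugation, which exhibits [Hhat] as the limit of
    [eps *: Heps eps]. *)
Lemma Hhat_E : Hhat = invmx P *m (I2^T *m (I2 *m m_Lam s)).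
Proof.
have e : D *m (I2 *m L) = I2 *m X.
  by rewrite I2L mulmxDr (mulmxA D W) DW X_I2 addrC.
have eT : diag0D s *m T = T *m (invmx P *m (I2^T *m (I2 *m m_Lam s))).
  rewrite diag0D_E Tmat_E -(mulmxA L P) (mulKVmx Pu) (mulmxA L) LI2.
  rewrite -(mulmxA (I2^T *m D)) (mulmxA I2 L) -(mulmxA I2^T D) (mulmxA D) e.
  by rewrite Lam_E (mulmxA I2 X).
by rewrite /Hhat -(mulmxA (invmx T)) eT (mulKmx T_unit).
Qed.

Definition Fhat (t : R) : 'M[R]_d := mexp Hhat t.

(** In the fast time the generator is [e *: Heps e], which differs from [Hhat] by exactly [e *: N],
    so continuity of the exponential suffices. *)
Lemma Fhat_lim t : 0 <= t -> tends0 (fun e => mexp (Heps e) (e * t)) (Fhat t).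
Proof.
move=> t0; have [c c0 hc] := mexp_pert Hhat t0.
pose N := invmx P *m (I1^T *m (I1 *m m_Lam s)).
pose q := nrm N + 1; have q0 : 0 < q by rewrite ltr_wpDl ?nrm_ge0.
have c1 : 0 < c + 1 by rewrite ltr_wpDl.
move=> eta eta0; exists (Num.min q^-1 (eta / ((c + 1) * q))).
  by rewrite lt_min invr_gt0 q0 divr_gt0 // mulr_gt0.
move=> e; rewrite lt_min => /and3P[e0 e1 e2].
rewrite mexp_scale //.
have eH : e *: Heps e - Hhat = e *: N.
  have e0' : e != 0 by rewrite gt_eqF.
  have eE : e *: Einv e = e *: (I1^T *m I1) + I2^T *m I2.
    by rewrite /Einv scalerDr scalerA divff // scale1r.
  rewrite Heps_E // Hhat_E -(mulmxA _ (Einv e)) scalemxAr scalemxAl eE /N [RHS]scalemxAr -mulmxBr.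
  congr (_ *m _).
  by rewrite mulmxDl -scalemxAl -(mulmxA I1^T) -(mulmxA I2^T) addrK.
have ne : nrm (e *: N) <= e * q.
  rewrite nrmZ ger0_norm ?(ltW e0) //; apply: ler_wpM2l; first exact: ltW.
  by rewrite lerDl.
apply: le_trans (hc _ _) _; rewrite eH.
  by apply: le_trans ne _; rewrite -ler_pdivlMr // div1r ltW.
apply: le_trans (ler_wpM2l c0 ne) _.
apply: (@le_trans _ _ ((c + 1) * (e * q))).
  by apply: ler_wpM2r; rewrite ?lerDl // mulr_ge0 // ltW.
have cq0 : 0 < (c + 1) * q by exact: mulr_gt0.
by rewrite mulrCA -ler_pdivlMr // ltW.
Qed.

End Mode.

(** * Bounds on the compact set of modes *)

Section CompactBounds.
Variable R : realType.

(** By A'^-1 - A^-1 = - A'^-1 (A' - A) A^-1, the difference is at most half of [nrm (invmx A')],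
    which can be moved to the other side. *)
Lemma invmx_pert n (A A' : 'M[R]_n) : A \in unitmx -> A' \in unitmx ->
  nrm (A' - A) * nrm (invmx A) <= 2^-1 ->
  nrm (invmx A') <= 2 * nrm (invmx A) /\
  nrm (invmx A' - invmx A) <= 2 * nrm (invmx A) * nrm (A' - A) * nrm (invmx A).
Proof.
move=> Au Au' h.
have e : invmx A' - invmx A = - (invmx A' *m (A' - A) *m invmx A).
  rewrite mulmxBr mulVmx // mulmxBl mul1mx -mulmxA mulmxV // mulmx1 opprB //.
have h1 : nrm (invmx A' - invmx A) <= nrm (invmx A') * nrm (A' - A) * nrm (invmx A).
  by rewrite e nrmN; apply: nrmMle => //; exact: nrmM.
have h2 : nrm (invmx A') <= 2 * nrm (invmx A).
  have := nrm_tri (invmx A') (invmx A).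
  have : nrm (invmx A') * nrm (A' - A) * nrm (invmx A) <= nrm (invmx A') * 2^-1.
    by rewrite -mulrA; apply: ler_wpM2l; rewrite ?nrm_ge0.
  move: h1; lra.
split=> //; apply: le_trans h1 _.
by rewrite -[leLHS]mulrA -[leRHS]mulrA; apply: ler_wpM2r => //; rewrite mulr_ge0 ?nrm_ge0.
Qed.

Lemma locally_bounded (X : topologicalType) (K : set X) (g : X -> R) : compact K ->
  (forall x, K x -> exists c, \forall y \near x, K y -> g y <= c) ->
  exists2 c, 0 <= c & forall x, K x -> g x <= c.
Proof.
move=> /compact_near_coveringP cK h.
have : \forall c \near +oo, K `<=` [set x | K x -> g x <= c].
  apply: (cK _ _ (fun c x => K x -> g x <= c)) => x /h[c0 hc0].
  exists ([set y | K y -> g y <= c0], [set c | c0 <= c]).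
    by split => //=; exact: (nbhs_pinfty_ge (num_real _)).
  by move=> [y c] /= [hy hc] Ky; apply: le_trans hc; exact: hy.
move=> hK; have [c [hc c0]] : exists c, (K `<=` [set x | K x -> g x <= c]) /\ 0 <= c.
  have [c [h1 h2]] := filter_ex (filterI hK (nbhs_pinfty_ge (num_real 0))).
  by exists c.
by exists c => // x Kx; exact: hc.
Qed.

Lemma near_mx m n (A : 'M[R]_(m, n)) (e : R) : 0 < e -> \forall A' \near A, nrm (A' - A) < e.
Proof.
move=> e0; apply/nbhs_ballP; exists (e / (m * n).+1%:R) => /=; first by rewrite divr_gt0.
move=> A'; rewrite -ball_normE /= => h.
apply: (@le_lt_trans _ _ ((m * n)%:R * `|A - A'|)).
  rewrite nrmBC; apply: nrm_le_entry => i j.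
  rewrite [leRHS]/Num.Def.normr /= mx_normrE.
  by apply: (@le_bigmax _ _ _ 0 (fun ij : 'I_m * 'I_n => `|(A - A') ij.1 ij.2|) (i, j)).
apply: (@le_lt_trans _ _ ((m * n).+1%:R * `|A - A'|)); first by rewrite ler_wpM2r // ler_nat.
by rewrite mulrC -ltr_pdivlMr.
Qed.

Variable d : nat.
Notation mode := (nat * 'M[R]_d * 'M[R]_d * 'M[R]_d)%type.

(** The first component is discrete, so the block sizes are locally constant and nearby modes have
    comparable blocks. *)
Lemma near_mode (s : mode) (e : R) : 0 < e -> \forall s' \near s,
  [/\ m_l s' = m_l s, nrm (m_P s' - m_P s) < e, nrm (m_Lam s' - m_Lam s) < e &
      nrm (m_R s' - m_R s) < e].
Proof.
move=> e0; case: s => [[[l P] Lam] Rm].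
have hl : \forall l' \near l, l' = l by [].
exists ([set s' : nat * 'M[R]_d * 'M[R]_d | [/\ m_l (s', Rm) = l, nrm (s'.1.2 - P) < e &
  nrm (s'.2 - Lam) < e]], [set R' | nrm (R' - Rm) < e]); last first.
  by move=> [[[l' P'] Lam'] R'] [] [] /=.
split=> /=; last exact: near_mx.
exists ([set s' : nat * 'M[R]_d | s'.1 = l /\ nrm (s'.2 - P) < e],
  [set L' | nrm (L' - Lam) < e]); last by move=> [[l' P'] Lam'] [] [].
split=> /=; last exact: near_mx.
exists ([set l' | l' = l], [set P' | nrm (P' - P) < e]); last by move=> [].
by split=> //=; exact: near_mx.
Qed.


Lemma small_div (a : R) : 0 <= a -> exists2 e, 0 < e & forall b, 0 <= b < e -> b * a <= 2^-1.
Proof.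
move=> a0; have a1 : 0 < 2 * (a + 1) by rewrite mulr_gt0 // ltr_wpDl.
exists (2 * (a + 1))^-1 => [|b /andP[b0 be]]; first by rewrite invr_gt0.
apply: (@le_trans _ _ ((2 * (a + 1))^-1 * (a + 1))).
  by apply: ler_pM => //; [exact: ltW|rewrite lerDl].
by rewrite invfM -mulrA mulVf ?mulr1 // gt_eqF // ltr_wpDl.
Qed.

Lemma LPinv_pert (P Lam : 'M[R]_d) : P \in unitmx -> exists e c : R, [/\ 0 < e, 0 <= c &
  forall dl P' Lam', P' \in unitmx -> 0 <= dl < e -> nrm (P' - P) < dl -> nrm (Lam' - Lam) < dl ->
    nrm (Lam' *m invmx P' - Lam *m invmx P) <= c * dl].
Proof.
move=> Pu; have [e e0 he] := small_div (nrm_ge0 (invmx P)).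
pose q := nrm (invmx P); have q0 : 0 <= q by exact: nrm_ge0.
exists e, (2 * q + nrm Lam * (2 * q * q)); split=> //.
  by rewrite addr_ge0 // ?mulr_ge0 ?nrm_ge0 // mulr_ge0.
move=> dl P' Lam' Pu' /andP[dl0 dle] hP hL.
have [|h1 h2] := invmx_pert Pu Pu'.
  by apply: he; rewrite nrm_ge0 (lt_trans hP).
have -> : Lam' *m invmx P' - Lam *m invmx P =
    (Lam' - Lam) *m invmx P' + Lam *m (invmx P' - invmx P).
  by rewrite mulmxBl mulmxBr addrA subrK.
apply: le_trans (nrmD _ _) _.
have -> : (2 * q + nrm Lam * (2 * q * q)) * dl = dl * (2 * q) + nrm Lam * (2 * q * dl * q) by ring.
apply: lerD; first by apply: nrmMle => //; exact: ltW.
apply: nrmMle => //; apply: le_trans h2 _; apply: ler_wpM2r => //.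
by apply: ler_wpM2l; [exact: mulr_ge0|exact: ltW].
Qed.

Theorem K_bounds (K : set mode) : good_K K -> D_Hurwitz K -> exists2 c, 0 <= c &
  forall s, K s -> [/\ nrm (m_P s) <= c, nrm (invmx (m_P s)) <= c, nrm (m_Lam s) <= c,
    nrm (m_R s) <= c & nrm (invmx (blkD s)) <= c].
Proof.
move=> [Kc Kg] KD.
have [|c1 c10 h1] := @locally_bounded _ K (fun s => nrm (m_P s)) Kc.
  move=> s Ks; exists (nrm (m_P s) + 1); apply: filterS (near_mode s ltr01) => s' [_ h _ _] _.
  by apply: le_trans (nrm_tri _ (m_P s)) _; rewrite lerD2l ltW.
have [|c2 c20 h2] := @locally_bounded _ K (fun s => nrm (m_Lam s)) Kc.
  move=> s Ks; exists (nrm (m_Lam s) + 1); apply: filterS (near_mode s ltr01) => s' [_ _ h _] _.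
  by apply: le_trans (nrm_tri _ (m_Lam s)) _; rewrite lerD2l ltW.
have [|c3 c30 h3] := @locally_bounded _ K (fun s => nrm (m_R s)) Kc.
  move=> s Ks; exists (nrm (m_R s) + 1); apply: filterS (near_mode s ltr01) => s' [_ _ _ h] _.
  by apply: le_trans (nrm_tri _ (m_R s)) _; rewrite lerD2l ltW.
have [|c4 c40 h4] := @locally_bounded _ K (fun s => nrm (invmx (m_P s))) Kc.
  move=> s Ks; have [_ _ Pu] := Kg s Ks.
  have [e e0 he] := small_div (nrm_ge0 (invmx (m_P s))).
  exists (2 * nrm (invmx (m_P s))); apply: filterS (near_mode s e0) => s' [_ h _ _] Ks'.
  have [_ _ Pu'] := Kg s' Ks'.
  by have [|//] := invmx_pert Pu Pu'; apply: he; rewrite nrm_ge0.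
have [|c5 c50 h5] := @locally_bounded _ K (fun s => nrm (invmx (blkD s))) Kc.
  move=> s Ks; have [l1 ld Pu] := Kg s Ks.
  have ld' : (m_l s <= d)%N by rewrite (leq_trans ld) // leq_subr.
  have Du := hurwitz_unit (KD s Ks).
  have [e1 [c [e10 c0 hLP]]] := LPinv_pert (m_Lam s) Pu.
  pose S := sel R d (m_l s) (d - m_l s).
  pose k := nrm S * c * nrm S^T * nrm (invmx (blkD s)).
  have k0 : 0 <= k by rewrite !mulr_ge0 ?nrm_ge0.
  have [e2 e20 he2] := small_div k0.
  pose dl := Num.min e1 e2 / 2.
  have m0 : 0 < Num.min e1 e2 by rewrite lt_min e10.
  have dl0 : 0 < dl by rewrite divr_gt0.
  have : dl < Num.min e1 e2 by rewrite /dl; lra.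
  rewrite lt_min => /andP[dl1 dl2].
  exists (2 * nrm (invmx (blkD s))); apply: filterS (near_mode s dl0) => s' [el hP hL _] Ks'.
  have [_ _ Pu'] := Kg s' Ks'.
  have hX := hLP dl _ _ Pu' (introT andP (conj (ltW dl0) dl1)) hP hL.
  have Du' := hurwitz_unit (KD s' Ks').
  (* The blocks of [s'] and [s] have a common type only once the equality of their sizes is
     substituted. *)
  case: s' el Ks' hP hL Pu' hX Du' => [[[l' P'] Lam'] R'] el; change (l' = m_l s) in el; subst l'.
  move=> Ks' hP hL Pu' hX Du'.
  have [|//] := invmx_pert Du Du'.
  rewrite {1}/blkD {1}/blkD !subblkE ?subnKC //= -/S.
  rewrite -mulmxBl -mulmxBr.
  apply: le_trans (he2 dl _); last by rewrite (ltW dl0).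
  have -> : dl * k = nrm S * (c * dl) * nrm S^T * nrm (invmx (blkD s)) by rewrite /k; ring.
  apply: ler_wpM2r; first exact: nrm_ge0.
  by apply: nrmMle => //; exact: nrmMle.
exists (c1 + c2 + c3 + c4 + c5) => [|s Ks]; first by rewrite !addr_ge0.
move: (h1 s Ks) (h2 s Ks) (h3 s Ks) (h4 s Ks) (h5 s Ks) => {}h1 {}h2 {}h3 {}h4 {}h5.
by split; lra.
Qed.

End CompactBounds.

(** * Trajectories of the perturbed systems *)

Lemma fin_bound (R : realType) (T : eqType) (s : seq T) (f : T -> R) :
  exists2 c, 0 < c & forall x, x \in s -> f x <= c.
Proof.
elim: s => [|x s [c c0 IH]]; first by exists 1.
exists (Num.max c (f x)) => [|y]; first by rewrite lt_max c0.
by rewrite inE le_max => /orP[/eqP ->|/IH ->//]; rewrite lexx orbT.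
Qed.

(** Letter number i is read off the first i + 1 words, which contain more than i letters since no
    word is empty. *)
Lemma stream_of_words (X : eqType) (u : nat -> seq X) : (forall k, u k <> [::]) ->
  exists a : nat -> X, forall k, flatten (mkseq u k) = mkseq a (size (flatten (mkseq u k))).
Proof.
move=> u0; have [a0 [w0 u0E]] : exists a0 w0, u 0%N = a0 :: w0.
  by case E : (u 0%N) => [|a w]; [case: (u0 0%N)|exists a, w].
have flS k : flatten (mkseq u k.+1) = flatten (mkseq u k) ++ u k.
  by rewrite mkseqS flatten_rcons.
have szf k : (k <= size (flatten (mkseq u k)))%N.
  elim: k => [//|k IH]; rewrite flS size_cat -addn1; apply: leq_add => //.
  by rewrite lt0n; apply/eqP => /size0nil; exact: u0.
have szle k j : (size (flatten (mkseq u k)) <= size (flatten (mkseq u (k + j))))%N.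
  elim: j => [|j IH]; first by rewrite addn0.
  by rewrite addnS flS size_cat (leq_trans IH) // leq_addr.
have nthS k j i : (i < size (flatten (mkseq u k)))%N ->
    nth a0 (flatten (mkseq u (k + j))) i = nth a0 (flatten (mkseq u k)) i.
  move=> ik; elim: j => [|j IH]; first by rewrite addn0.
  by rewrite addnS flS nth_cat IH (leq_trans ik (szle k j)).
exists (fun i => nth a0 (flatten (mkseq u i.+1)) i) => k.
apply: (@eq_from_nth _ a0) => [|i ik]; first by rewrite size_mkseq.
rewrite nth_mkseq //; have [ki|ik'] := leqP k i.+1.
  by rewrite -(subnKC ki) nthS.
by rewrite -(subnKC (ltnW ik')) nthS // (leq_trans _ (szf _)).
Qed.

Section Growth.
Variables (R : realType) (d : nat).
Notation mode := (nat * 'M[R]_d * 'M[R]_d * 'M[R]_d)%type.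

(* The rate [r] may be negative, unlike in [EU]. *)
Definition Grows (S : swsys R d) (K : set mode) (tau r : R) : Prop :=
  exists2 c, 0 < c & exists nsw ts sg, admissible K tau nsw ts sg /\
    exists x : forall k, R -> 'cV[R]_(sdim _ _ S (sg k)),
      [/\ is_traj _ _ S nsw ts sg x, x 0%N 0 != 0 &
          forall k t, 0 <= t -> inpiece nsw ts k t ->
            c * expR (r * t) * vnorm (x 0%N 0) <= vnorm (x k t)].

Variable K : set mode.
Hypothesis Kg : good_K K.
(** A letter of duration t is run by the perturbed system during the time [ka * t]: [ka] is 1 for
    the slow limit and [ep] for the fast one. *)
Variables (tau ep ka : R).
Hypothesis ep0 : 0 < ep.
Hypothesis ka0 : 0 < ka.
Hypothesis ka_tau : forall t, tau <= t -> tau <= ka * t.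

Let H (s : mode) : 'M[R]_d := Heps s ep.

Lemma Sigma_eps_solves s x : K s -> ode (H s) x ->
  solves R d (Eeps d ep (m_l s) *m m_P s) (m_Lam s) x.
Proof.
move=> Ks hx; have [_ ld Pu] := (Kg.2 s Ks).
have ld' : (m_l s <= d)%N by rewrite (leq_trans ld) // leq_subr.
apply: ode_solves => //.
by rewrite unitmx_mul Pu andbT Eeps_unit // gt_eqF.
Qed.

Lemma nrm_vnorm_le (v w : 'cV[R]_d) c : 0 <= c -> c * nrm v <= nrm w ->
  c / d.+1%:R * vnorm v <= vnorm w.
Proof.
move=> c0 h; rewrite mulrAC ler_pdivrMr //.
apply: le_trans (ler_wpM2l c0 (vnorm_le_nrm v)) _; apply: le_trans h _.
apply: le_trans (nrm_le_vnorm w) _; rewrite mulrC.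
by apply: ler_wpM2l; rewrite ?vnorm_ge0 // ler_nat.
Qed.

Lemma mexp_pow (A : 'M[R]_d) t k : 0 <= t -> mexp A (t * k%:R) = mpow (mexp A t) k.
Proof.
move=> t0; elim: k => [|k IH]; first by rewrite mulr0 mexp0.
by rewrite -natr1 mulrDr mulr1 mexpD ?mulr_ge0 // IH mpowS.
Qed.

(** Growth is known at the sampling times only. The next one is at most [ka * N] after t, and the
    flow until then is bounded by [Ce], so the state at t cannot be much smaller than the next
    sample. *)
Lemma const_grow s (u : nat -> nat) (x : 'cV[R]_d) (c r : R) N : K s -> x != 0 -> 0 < c ->
  (forall k, (0 < u k <= N)%N) ->
  (forall k, c * expR (r * (\sum_(i < k) u i)%N%:R) <=
     nrm (mpow (mexp (H s) ka) (\sum_(i < k) u i)%N *m x)) ->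
  Grows (Sigma_eps d ep) K tau (r / ka).
Proof.
move=> Ks x0 c0 uN hu.
pose S k := (\sum_(i < k) u i)%N.
have SS k : S k.+1 = (S k + u k)%N by rewrite /S big_ord_recr.
have Sk k : (k <= S k)%N.
  by elim: k => [//|k IH]; rewrite SS -addn1 leq_add //; have /andP[] := uN k.
pose Ce := d%:R ^+ 2 * expR (nrm (H s) * (ka * N%:R)) + 1.
have Ce0 : 0 < Ce by rewrite ltr_wpDl // mulr_ge0 ?expR_ge0.
have nx : 0 < nrm x by rewrite nrm_gt0.
(* The exponential covers the passage from [S n] to [t / ka], which are at most N apart, whatever
   the sign of [r]. *)
pose c' := c / (Ce * nrm x) * expR (- (`|r| * N%:R)).
have Cx0 : 0 < Ce * nrm x by exact: mulr_gt0.
have c'0 : 0 < c' by rewrite mulr_gt0 ?expR_gt0 // divr_gt0.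
exists (c' / d.+1%:R); first by rewrite divr_gt0.
exists (Some 0%N), (fun=> 0), (fun=> s); split.
  by split.
pose y t := mexp (H s) (t - 0) *m x.
have y0 : y 0 = x by rewrite /y subrr mexp0 mul1mx.
exists (fun _ t => y t); split=> /=.
- split=> // k _; apply: Sigma_eps_solves => //; exact: ode_mexp.
- by rewrite y0.
move=> _ t t0 _; rewrite y0 [c' / _ * _]mulrAC.
apply: nrm_vnorm_le; first by rewrite mulr_ge0 ?expR_ge0 // ltW.
have ex : exists n, t <= ka * (S n)%:R.
  have := archi_boundP (divr_ge0 t0 (ltW ka0)); set n := Num.bound _ => hn.
  exists n; rewrite mulrC -ler_pdivrMr //; apply: le_trans (ltW hn) _.
  by rewrite ler_nat Sk.
case: (ex_minnP ex) => n tn nmin.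
have gap : ka * (S n)%:R - t <= ka * N%:R.
  case: n tn nmin => [|n] tn nmin.
    by rewrite /S big_ord0 mulr0 sub0r; apply: (@le_trans _ _ 0); rewrite ?oppr_le0 // mulr_ge0 // ltW.
  have : ka * (S n)%:R <= t.
    by rewrite leNgt; apply/negP => /ltW/nmin; rewrite ltnn.
  have : ka * (S n.+1)%:R <= ka * (S n)%:R + ka * N%:R.
    rewrite -mulrDr ler_pM2l // -natrD ler_nat SS leq_add2l; by have /andP[] := uN n.
  lra.
have gap0 : 0 <= ka * (S n)%:R - t by rewrite subr_ge0.
have hy : nrm (y (ka * (S n)%:R)) <= Ce * nrm (y t).
  have -> : y (ka * (S n)%:R) = mexp (H s) (ka * (S n)%:R - t) *m y t.
    by rewrite /y mulmxA -mexpD ?subr_ge0 // !subr0 addrC subrK.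
  apply: nrmMle => //; apply: le_trans (mexp_bound _ gap0) _.
  rewrite /Ce; apply: ler_wpDr => //; apply: ler_wpM2l; first exact: exprn_ge0.
  by rewrite ler_expR; apply: ler_wpM2l; rewrite ?nrm_ge0.
have hS : c * expR (r * (S n)%:R) <= Ce * nrm (y t).
  by apply: le_trans hy; rewrite /y subr0 mexp_pow ?(ltW ka0) //; exact: hu.
have he : expR (r / ka * t) * expR (- (`|r| * N%:R)) <= expR (r * (S n)%:R).
  rewrite -expRD ler_expR.
  have -> : r * (S n)%:R = r / ka * t + r * ((ka * (S n)%:R - t) / ka).
    by field; rewrite gt_eqF.
  rewrite lerD2l; apply: (@le_trans _ _ (- (`|r| * ((ka * (S n)%:R - t) / ka)))).
    rewrite lerN2; apply: ler_wpM2l => //.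
    by rewrite ler_pdivrMr // [N%:R * _]mulrC.
  rewrite -mulNr; apply: ler_wpM2r; first by rewrite divr_ge0 // ltW.
  by rewrite lerNl -normrN ler_norm.
have -> : c' * expR (r / ka * t) * nrm x =
   c * (expR (r / ka * t) * expR (- (`|r| * N%:R))) / Ce.
  by rewrite /c'; field; rewrite !gt_eqF.
rewrite ler_pdivrMr // [nrm _ * Ce]mulrC; apply: le_trans hS.
by rewrite ler_pM2l.
Qed.


Notation letter := (mode * R)%type.
Definition letter_ok (t0 : R) (a : letter) : Prop := 0 < a.2 /\ t0 <= a.2.
Definition letter_mode (a : letter) : mode := a.1.
Definition letter_len (a : letter) : R := `|a.2|.

Let A' (a : letter) : 'M[R]_d := m_R a.1 *m mexp (H a.1) (ka * a.2).

Notation lb := (fun a : letter => Some (letter_mode a)).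

(** The lower bound, given at the ends of words, is carried back to the ends of letters through the
    finitely many suffixes of the words, and then to all times through the bounded flow and jump of
    one letter. *)
Lemma letters_grow (ws : seq (seq letter)) (u : nat -> seq letter) (x : 'cV[R]_d) (c r r0 : R) :
  (forall w, w \in ws -> w <> [::] /\ inH letter_mode (letter_ok tau) K w) ->
  x != 0 -> 0 < c -> r0 <= r -> (forall k, u k \in ws) ->
  (forall k, wok lb lb None (flatten (mkseq u k))) ->
  (forall k, c * expR (r * wlen letter_len (flatten (mkseq u k))) <=
     nrm (wmat A' (flatten (mkseq u k)) *m x)) ->
  Grows (Sigma_eps d ep) K tau (r0 / ka).
Proof.
move=> hws x0 c0 r0r uws hok hu.
have u0 k : u k <> [::] by have [] := hws _ (uws k).
have [a ha] := stream_of_words u0.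
pose N k := size (flatten (mkseq u k)).
have flS k : flatten (mkseq u k.+1) = flatten (mkseq u k) ++ u k.
  by rewrite mkseqS flatten_rcons.
have NS k : N k.+1 = (N k + size (u k))%N by rewrite /N flS size_cat.
have Nk k : (k <= N k)%N.
  elim: k => [//|k IH]; rewrite NS -addn1 leq_add //.
  by rewrite lt0n; apply/eqP => /size0nil; exact: u0.
have aws n : a n \in flatten ws.
  have : a n \in flatten (mkseq u n.+1).
    by rewrite ha; apply/mapP; exists n => //; rewrite mem_iota /= add0n; exact: Nk.
  by move=> /flattenP[w /mapP[k _ ->] h]; apply/flattenP; exists (u k).
have letterP b : b \in flatten ws -> letter_ok tau b /\ K b.1.
  by move=> /flattenP[w /hws[_ hw] /hw].
have a_pos n : 0 < (a n).2 by have [[]] := letterP _ (aws n).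
have a_tau n : tau <= (a n).2 by have [[]] := letterP _ (aws n).
have aK n : K (a n).1 by have [] := letterP _ (aws n).
have [Lm Lm0 hLm] := fin_bound (flatten ws) (fun b => b.2).
(* Only finitely many letters occur, so their durations are bounded below and the switching times
   tend to infinity. *)
have [Li Li0 hLi] := fin_bound (flatten ws) (fun b => b.2^-1).
have [LR LR0 hLR] := fin_bound (flatten ws) (fun b => nrm (m_R b.1)).
have [LH LH0 hLH] := fin_bound (flatten ws) (fun b => nrm (H b.1)).
pose sufs := flatten [seq [seq drop i w | i <- iota 0 (size w).+1] | w <- ws].
have [Ls Ls0 hLs] := fin_bound sufs (fun w => nrm (wmat A' w)).
have [Ll Ll0 hLl] := fin_bound sufs (fun w => wlen letter_len w).
have sufP i w : w \in ws -> drop i w \in sufs.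
  move=> wws; apply/flattenP; exists [seq drop i w | i <- iota 0 (size w).+1].
    by apply/mapP; exists w.
  have [iw|wi] := leqP i (size w); first by apply/mapP; exists i => //; rewrite mem_iota.
  apply/mapP; exists (size w); first by rewrite mem_iota /= add0n.
  by rewrite drop_size drop_oversize // ltnW.
pose len n := \sum_(i < n) (a i).2.
have lenS n : len n.+1 = len n + (a n).2 by rewrite /len big_ord_recr.
have len_w n : wlen letter_len (mkseq a n) = len n.
  elim: n => [|n IH]; first by rewrite /len big_ord0.
  by rewrite mkseqS -cats1 wlen_cat IH lenS /= addr0 /letter_len gtr0_norm.
pose Z n := wmat A' (mkseq a n) *m x.
have ZS n : Z n.+1 = A' (a n) *m Z n.
  by rewrite /Z mkseqS -cats1 wmat_cat /= mul1mx mulmxA.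
have len_ge n : n%:R <= Li * len n.
  elim: n => [|n IH]; first by rewrite /len big_ord0 mulr0.
  rewrite lenS mulrDr -natr1; apply: lerD => //.
  rewrite -ler_pdivrMr // div1r; exact: hLi.
have len0 n : 0 <= len n by apply: sumr_ge0 => i _; exact: ltW.
pose cb := c / Ls * expR (- (`|r| * Ll)).
have cb0 : 0 < cb by rewrite mulr_gt0 ?expR_gt0 // divr_gt0.
have Zlow n : cb * expR (r * len n) <= nrm (Z n).
  have ex : exists k, (n <= N k)%N by exists n; exact: Nk.
  case: (ex_minnP ex) => k nk kmin.
  have [w ws_w [NE lE]] : exists2 w, w \in sufs &
      Z (N k) = wmat A' w *m Z n /\ len (N k) = len n + wlen letter_len w.
    have [w ws_w wE] : exists2 w, w \in sufs & mkseq a (N k) = mkseq a n ++ w.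
      case: k nk kmin => [|k] nk kmin.
        move: nk; rewrite /N /= leqn0 => /eqP ->.
        by exists [::] => //; rewrite -(drop_size (u 0%N)); exact: sufP.
      have kn : (N k < n)%N by rewrite ltnNge; apply/negP => /kmin; rewrite ltnn.
      exists (drop (n - N k) (u k)); first exact: sufP.
      rewrite -ha -(cat_take_drop n (flatten (mkseq u k.+1))); congr (_ ++ _).
        rewrite ha; apply: (@eq_from_nth _ (a 0%N)) => [|i].
          by rewrite size_take !size_mkseq; case: ltnP => // h; apply/eqP; rewrite eqn_leq nk h.
        rewrite size_take size_mkseq -/(N _) => hi.
        have hin : (i < n)%N by move: hi; have [h1|h1] := ltnP n (N k.+1) => // h2; exact: leq_trans h2 h1.
        by rewrite nth_take // !nth_mkseq // (leq_trans hin).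
      by rewrite flS drop_cat -/(N k) ltnNge (ltnW kn).
    exists w => //; split; first by rewrite /Z wE wmat_cat mulmxA.
    by rewrite -!len_w wE wlen_cat.
  have h1 : c * expR (r * len (N k)) <= Ls * nrm (Z n).
    apply: le_trans (_ : nrm (Z (N k)) <= _).
      by have := hu k; rewrite ha len_w.
    by rewrite NE; apply: nrmMle => //; exact: hLs.
  have h2 : expR (r * len n) * expR (- (`|r| * Ll)) <= expR (r * len (N k)).
    rewrite -expRD ler_expR lE mulrDr lerD2l.
    have l0 : 0 <= wlen letter_len w by apply: wlen_ge0 => b; exact: normr_ge0.
    apply: (@le_trans _ _ (- (`|r| * wlen letter_len w))).
      by rewrite lerN2; apply: ler_wpM2l => //; exact: hLl.
    rewrite -mulNr; apply: ler_wpM2r => //.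
    by rewrite lerNl -normrN ler_norm.
  have -> : cb * expR (r * len n) = c * (expR (r * len n) * expR (- (`|r| * Ll))) / Ls.
    by rewrite /cb; ring.
  rewrite ler_pdivrMr // [nrm _ * Ls]mulrC; apply: le_trans h1.
  by rewrite ler_pM2l.
pose Ce := LR * (d%:R ^+ 2 * expR (LH * (ka * Lm)) + 1).
have Ce0 : 0 < Ce by rewrite mulr_gt0 // ltr_wpDl // mulr_ge0 ?expR_ge0.
have nx : 0 < nrm x by rewrite nrm_gt0.
pose c' := cb / (Ce * nrm x) * expR (- (`|r| * Lm)).
have Cx0 : 0 < Ce * nrm x by exact: mulr_gt0.
have c'0 : 0 < c' by rewrite mulr_gt0 ?expR_gt0 // divr_gt0.
pose ts n := ka * len n.
have tsS n : ts n.+1 = ts n + ka * (a n).2 by rewrite /ts lenS mulrDr.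
exists (c' / d.+1%:R); first by rewrite divr_gt0.
exists None, ts, (fun n => (a n).1); split.
  split.
  - by rewrite /ts /len big_ord0 mulr0.
  - by move=> k _; exact: aK.
  - move=> k _; rewrite tsS; split.
    + by rewrite ltrDl mulr_gt0.
    + by rewrite lerD2l; exact: ka_tau.
    (* The prefix with k + 2 letters contains the adjacent letters k and k + 1, whose modes [wok]
       separates. *)
    + have := hok k.+2; rewrite ha -/(N _).
      rewrite -(subnKC (Nk k.+2)) /mkseq iotaD map_cat add0n => /wok_cat[+ _].
      rewrite -/(mkseq a k.+2) !mkseqS -!cats1 -catA => /wok_cat[_] /=.
      by move=> [_ [h _]] e; apply: h; rewrite /letter_mode e.
  - move=> _ b; have := archi_boundP (mulr_ge0 (normr_ge0 (b / ka)) (ltW Li0)).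
    set n := Num.bound _ => hn; exists n.
    have : `|b / ka| * Li < Li * len n by apply: lt_le_trans hn (len_ge n).
    rewrite mulrC ltr_pM2l // => h.
    rewrite /ts mulrC -ltr_pdivrMr //; apply: le_lt_trans h; exact: ler_norm.
pose y n t := mexp (H (a n).1) (t - ts n) *m Z n.
have y_end n : y n.+1 (ts n.+1) = m_R (a n).1 *m y n (ts n.+1).
  rewrite /y subrr mexp0 mul1mx ZS tsS addrAC subrr add0r.
  by rewrite /A' mulmxA.
exists y; split=> /=.
- split=> /= k _; last exact: y_end.
  by apply: Sigma_eps_solves => //; exact: ode_mexp.
- by rewrite /y /ts /len big_ord0 mulr0 subrr mexp0 mul1mx /Z mul1mx.
move=> k t t0 [_ tk /(_ I) tk1].
have -> : y 0%N 0 = x.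
  by rewrite /y /ts /len big_ord0 mulr0 subrr mexp0 mul1mx /Z mul1mx.
rewrite [c' / _ * _]mulrAC.
apply: nrm_vnorm_le; first by rewrite mulr_ge0 ?expR_ge0 // ltW.
have gap0 : 0 <= ts k.+1 - t by rewrite subr_ge0 ltW.
have gap1 : ts k.+1 - t <= ka * Lm.
  have : ka * (a k).2 <= ka * Lm by rewrite ler_pM2l //; exact: hLm.
  rewrite tsS; lra.
have h1 : nrm (Z k.+1) <= Ce * nrm (y k t).
  have -> : Z k.+1 = m_R (a k).1 *m (mexp (H (a k).1) (ts k.+1 - t) *m y k t).
    rewrite /y [mexp _ (ts k.+1 - t) *m _]mulmxA -mexpD ?subr_ge0 ?(ltW tk1) //.
    by rewrite addrC addrA subrK ZS /A' -mulmxA tsS [ts k + _]addrC addrK.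
  rewrite /Ce -mulrA; apply: nrmMle; first exact: hLR.
  apply: nrmMle => //; apply: le_trans (mexp_bound _ gap0) _.
  apply: ler_wpDr => //; apply: ler_wpM2l; first exact: exprn_ge0.
  by rewrite ler_expR; apply: ler_pM; rewrite ?nrm_ge0 //; exact: hLH.
have h2 := le_trans (Zlow k.+1) h1.
have he : expR (r0 / ka * t) * expR (- (`|r| * Lm)) <= expR (r * len k.+1).
  rewrite -expRD ler_expR.
  have -> : r * len k.+1 = r * (t / ka) + r * ((ts k.+1 - t) / ka).
    by rewrite /ts; field; rewrite gt_eqF.
  apply: lerD.
    by rewrite mulrAC -mulrA; apply: ler_wpM2r => //; rewrite divr_ge0 // ltW.
  apply: (@le_trans _ _ (- (`|r| * ((ts k.+1 - t) / ka)))).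
    rewrite lerN2; apply: ler_wpM2l => //.
    by rewrite ler_pdivrMr // [Lm * _]mulrC.
  rewrite -mulNr; apply: ler_wpM2r; first by rewrite divr_ge0 // ltW.
  by rewrite lerNl -normrN ler_norm.
have -> : c' * expR (r0 / ka * t) * nrm x =
   cb * (expR (r0 / ka * t) * expR (- (`|r| * Lm))) / Ce.
  by rewrite /c'; field; rewrite !gt_eqF.
rewrite ler_pdivrMr // [nrm _ * Ce]mulrC; apply: le_trans h2.
by rewrite ler_pM2l.
Qed.

End Growth.

(** * From unbounded products of the limit flow to growth of the perturbed systems *)

Section MainGrowth.
Variables (R : realType) (d : nat).
Notation mode := (nat * 'M[R]_d * 'M[R]_d * 'M[R]_d)%type.
Notation letter := (mode * R)%type.
Variables (K : set mode) (tau : R) (F : mode -> R -> 'M[R]_d) (ka : R -> R) (cR cF csw rho : R).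
Hypothesis Kg : good_K K.
Hypothesis cR0 : 0 <= cR.
Hypothesis cF0 : 0 <= cF.
Hypothesis csw0 : 0 <= csw.
Hypothesis R_bdd : forall s, K s -> nrm (m_R s) <= cR.
Hypothesis F_semi : forall s t u, K s -> 0 <= t -> 0 <= u -> F s (t + u) = F s u *m F s t.
Hypothesis F_bdd : forall s t, K s -> 0 <= t <= 1 -> nrm (F s t) <= cF.
Hypothesis ka0 : forall e, 0 < e -> 0 < ka e.
Hypothesis ka_tau : forall e t, 0 < e -> tau <= t -> tau <= ka e * t.
Hypothesis F_lim : forall s t, K s -> 0 < t -> tends0 (fun e => mexp (Heps s e) (ka e * t)) (F s t).
Let B (a : letter) := m_R a.1 *m F a.1 a.2.
Notation lb := (fun a : letter => Some (letter_mode a)).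
Notation inK := (inH (@letter_mode R d) (letter_ok tau) K).
Notation len := (wlen (@letter_len R d)).
Hypothesis short_bdd : forall w, inK w -> wok lb lb None w -> len w <= 1 -> nrm (wmat B w) <= csw.
(** The extra factor [F s t] is the letter still unfinished when the growth is observed. *)
Hypothesis unbounded : forall r c, r < rho -> exists w s t,
  [/\ inK w, wok lb lb None w, K s, 0 <= t & c * expR (r * (len w + t)) < nrm (F s t *m wmat B w)].

Lemma tends0_mpow n (G : R -> 'M[R]_n) A k : tends0 G A -> tends0 (fun e => mpow (G e) k) (mpow A k).
Proof. by move=> h; elim: k => [|k IH]; [exact: tends0_cst|exact: tends0M]. Qed.

Lemma single_mode_growth s r' mu : K s -> mu < r' -> ~ power_rate_bdd (F s 1) r' ->
  near0 (fun e => Grows (Sigma_eps d e) K tau (mu / ka e)).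
Proof.
move=> Ks mur nb; have [N [eta [eta0 hN]]] := power_growth mur nb.
have hn : near0 (fun e => forall k, k \in iota 0 N.+1 ->
    nrm (mpow (mexp (Heps s e) (ka e)) k - mpow (F s 1) k) <= eta).
  apply: near0_seq => k _; apply: tends0_mpow eta0.
  by have := F_lim Ks ltr01; under eq_fun do rewrite mulr1.
apply: near0_sub hn => e e0 he.
have [|u [x [c [x0 c0 uN hu]]]] := hN (mexp (Heps s e) (ka e)).
  by move=> k kN; apply: he; rewrite mem_iota.
exact: (const_grow Kg tau e0 (ka0 e0) Ks x0 c0 uN hu).
Qed.

(** The factor [F s 0] stays, since for the slow limit it is only a projection. *)
Lemma F_pow s k : K s -> F s k%:R = mpow (F s 1) k *m F s 0.
Proof.
move=> Ks; elim: k => [|k IH]; first by rewrite mul1mx.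
by rewrite -natr1 F_semi // IH mpowS mulmxA.
Qed.

(** [power_rate_unif] handles the integer part of t for all modes at once; the fractional part costs
    a factor [cF] and [expR |r'|]. *)
Lemma uniform_rate r r' : r < r' -> (forall s, K s -> power_rate_bdd (F s 1) r) ->
  exists2 c, 0 <= c & forall s t, K s -> 0 <= t -> nrm (F s t) <= c * expR (r' * t).
Proof.
move=> rr' hb.
have [||c hc] := @power_rate_unif R d (fun A => exists2 s, K s & A = F s 1) cF r r' rr'.
- by move=> _ [s Ks ->]; apply: F_bdd => //; rewrite ler01 lexx.
- by move=> _ [s Ks ->]; exact: hb.
exists (cF * (`|c| * cF) * expR `|r'|) => [|s t Ks t0].
  by rewrite !mulr_ge0 ?expR_ge0.
pose k := Num.truncn t; have /andP[kt tk] := truncn_itv t0.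
have tE : t = k%:R + (t - k%:R) by rewrite addrC subrK.
have tk0 : 0 <= t - k%:R by rewrite subr_ge0.
have tk1 : t - k%:R <= 1 by move: tk; rewrite -natr1 -/k; lra.
rewrite {1}tE F_semi // F_pow //.
have h0 : nrm (F s 0) <= cF by apply: F_bdd => //; rewrite lexx ler01.
have h1 : nrm (F s (t - k%:R)) <= cF by apply: F_bdd => //; rewrite tk0 tk1.
have h2 : nrm (mpow (F s 1) k) <= `|c| * expR (r' * k%:R).
  apply: le_trans (hc _ _ k) _; first by exists s.
  by apply: ler_wpM2r; rewrite ?expR_ge0 ?ler_norm.
apply: le_trans (nrmMle h1 (nrmMle h2 h0)) _.
have h3 : expR (r' * k%:R) <= expR `|r'| * expR (r' * t).
  rewrite -expRD ler_expR -lerBlDr -mulrBr.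
  apply: le_trans (ler_norm _) _; rewrite normrM [`|_ - _|]distrC (ger0_norm tk0).
  exact: ler_piMr.
have -> : cF * (`|c| * expR (r' * k%:R) * cF) = cF * (`|c| * cF) * expR (r' * k%:R) by ring.
rewrite -[leRHS]mulrA; apply: ler_wpM2l h3.
by rewrite !mulr_ge0.
Qed.

(* Either a constant signal already grows, or the flows of the single modes are
   uniformly bounded at a rate below [rho] and [word_growth] provides the words. *)
Theorem main_growth mu : mu < rho -> near0 (fun e => Grows (Sigma_eps d e) K tau (mu / ka e)).
Proof.
(* [r3] is the rate at which single modes are tested and [r4] the uniform rate that follows; both
   lie strictly between [mu] and [rho]. *)
move=> murho; pose r3 := (2 * mu + rho) / 3; pose r4 := (mu + 2 * rho) / 3.
have m3 : mu < r3 by rewrite /r3; lra.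
have r34 : r3 < r4 by rewrite /r3 /r4; lra.
have r4rho : r4 < rho by rewrite /r4; lra.
have [[s [Ks nb]]|h] := pselect (exists s, K s /\ ~ power_rate_bdd (F s 1) r3).
  exact: single_mode_growth Ks m3 nb.
have hb s : K s -> power_rate_bdd (F s 1) r3.
  by move=> Ks; apply: contrapT => nb; apply: h; exists s.
have [ca ca0 hca] := uniform_rate r34 hb.
have letter_len_ge0 (a : letter) : 0 <= letter_len a by exact: normr_ge0.
have [|||ws [eta [eta0 hws hA]]] := @word_growth R d _ _ (@letter_mode R d) (@letter_len R d) B
   (letter_ok tau) letter_len_ge0 K r4 rho (cR * ca) csw r4rho (mulr_ge0 cR0 ca0) csw0.
- move=> [s t] [/= t0 _] Ks; rewrite /B /letter_len gtr0_norm //= -mulrA.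
  by apply: nrmMle; [exact: R_bdd|apply: hca => //; exact: ltW].
- by move=> w aw okw; apply: short_bdd.
(* A bound on complete words, combined with the one on the unfinished letter, would contradict
   [unbounded]; the larger of [r] and [r4] serves as a common rate. *)
- move=> r rrho /(bddH_mono letter_len_ge0 (r := r) (s := Num.max r r4)) hbd.
  have [|c c_ge0 hc] := bddH_ge0 letter_len_ge0 (hbd _); first by rewrite le_max lexx.
  have [|w [s [t [aw okw Ks t0]]]] := unbounded (r := Num.max r r4) (ca * c).
    by rewrite gt_max rrho r4rho.
  apply/negP; rewrite -leNgt; apply: le_trans (nrmMle (hca s t Ks t0) (hc w aw okw)) _.
  rewrite mulrDr expRD.
  have -> : ca * expR (r4 * t) * (c * expR (Num.max r r4 * len w)) =
    ca * c * (expR (Num.max r r4 * len w) * expR (r4 * t)) by ring.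
  apply: ler_wpM2l; first exact: mulr_ge0.
  apply: ler_wpM2l; first exact: expR_ge0.
  by rewrite ler_expR; apply: ler_wpM2r => //; rewrite le_max lexx orbT.
pose A' e (a : letter) := m_R a.1 *m mexp (Heps a.1 e) (ka e * a.2).
have hn : near0 (fun e => forall w, w \in ws -> nrm (wmat (A' e) w - wmat B w) <= eta).
  apply: near0_seq => w wws; have [_ hw] := hws w wws.
  apply: tends0_wmat eta0 => a aw; have {}aw : a \in w.
    elim: (w) aw => //= b v IH [->|/IH bv]; first by rewrite inE eqxx.
    by rewrite inE bv orbT.
  have [[a0 _] Ka] := hw a aw.
  by apply: tends0M; [exact: tends0_cst|exact: F_lim].
apply: near0_sub hn => e e0 he.
have [u [x [c [x0 c0 uws hok hu]]]] := hA (A' e) he.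
apply: (letters_grow Kg e0 (ka0 e0) (fun t => ka_tau e0) (ws := ws) (u := u) (x := x) (c := c) (r := r4)) => //.
exact/ltW/(lt_trans m3).
Qed.

End MainGrowth.

(** * Lyapunov exponents *)

Section Lyapunov.
Variables (R : realType) (d : nat).
Notation mode := (nat * 'M[R]_d * 'M[R]_d * 'M[R]_d)%type.
Variables (S : swsys R d) (K : set mode) (tau : R).

Lemma Grows_EU r : 0 < r -> Grows S K tau r -> EU S K tau.
Proof.
move=> r0 [c c0 [nsw [ts [sg [adm [x [tr x0 hx]]]]]]].
exists c, r; split=> //; exists nsw, ts, sg; split=> //; exists x; split=> //.
Qed.

Lemma EU_Grows : EU S K tau -> exists2 r, 0 < r & Grows S K tau r.
Proof.
move=> [c [r [c0 r0 [nsw [ts [sg [adm [x [tr x0 hx]]]]]]]]].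
exists r => //; exists c => //; exists nsw, ts, sg; split=> //; exists x; split=> //.
Qed.

Lemma inpiece_ex nsw ts sg t : admissible K tau nsw ts sg -> 0 <= t -> exists k, inpiece nsw ts k t.
Proof.
move=> [ts0 _ tsS unb] t0.
have [N ndef] : exists N, forall k, (N < k)%N -> ~ (active nsw k /\ ts k <= t).
  case: nsw {unb}(unb) tsS => [N|] unb tsS.
    by exists N => k Nk [] /=; rewrite leqNgt Nk.
  have [N tN] := unb erefl t.
  have mono i j : ts i <= ts (i + j)%N.
    elim: j => [|j IH]; first by rewrite addn0.
    by rewrite addnS (le_trans IH) // ltW //; have [] := tsS (i + j)%N I.
  exists N => k Nk [_]; apply/negP; rewrite -ltNge; apply: lt_le_trans tN _.
  by rewrite -(subnKC (ltnW Nk)); exact: mono.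
pose P k := `[< active nsw k /\ ts k <= t >].
have P0 : exists k, P k by exists 0%N; apply/asboolP; rewrite ts0; split=> //; case: (nsw).
have Pb k : P k -> (k <= N)%N.
  by move=> /asboolP h; rewrite leqNgt; apply/negP => /ndef; apply.
case: (ex_maxnP P0 Pb) => k /asboolP[ak tk] kmax.
exists k; split=> // hk; rewrite ltNge; apply/negP => tk1.
have /kmax : P k.+1 by apply/asboolP; split=> //; case: (nsw) hk.
by rewrite ltnn.
Qed.

Lemma solvesZ n (L A : 'M[R]_n) (y : R -> 'cV[R]_n) a :
  solves R n L A y -> solves R n L A (fun t => a *: y t).
Proof.
move=> hy t; have [hd he] := hy t.
have hder i : is_derive t (1 : R) (fun u => (a *: y u) i 0) (a * 'D_1 (fun u => y u i 0) t).
  rewrite (_ : (fun u => (a *: y u) i 0) = (fun u => a * y u i 0)).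
    by apply: isdZ; exact: derivableP.
  by apply/funext => u; rewrite mxE.
split=> [i|]; first exact: ex_derive.
have -> : dvec R n (fun u => a *: y u) t = a *: dvec R n y t.
  apply/matrixP => i j; rewrite ord1 !mxE !derive1E.
  by have h := hder i; rewrite derive_val.
by rewrite -!scalemxAr he.
Qed.

Lemma Grows_flownorm r : Grows S K tau r -> exists2 c, 0 < c & forall t, 0 <= t ->
  exists nsw ts sg, admissible K tau nsw ts sg /\
    ((c * expR (r * t))%:E <= flownorm R d S nsw ts sg t)%E.
Proof.
move=> [c c0 [nsw [ts [sg [adm [x [[tr1 tr2] x0 hx]]]]]]].
exists c => // t t0; exists nsw, ts, sg; split=> //.
have [k hk] := inpiece_ex adm t0.
have v0 : 0 < vnorm (x 0%N 0) by rewrite lt_neqAle vnorm_ge0 andbT eq_sym vnorm_eq0.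
pose a := (vnorm (x 0%N 0))^-1; have a0 : 0 < a by rewrite invr_gt0.
apply: (@le_trans _ _ (vnorm (a *: x k t))%:E).
  rewrite lee_fin vnormZ gtr0_norm //; have := hx k t t0 hk.
  by rewrite -ler_pdivlMr // -/a [vnorm _ * a]mulrC.
apply: ereal_sup_ubound; exists (fun k t => a *: x k t), k; split=> //.
- split=> [j aj|j hj]; first by apply: solvesZ; exact: tr1.
  by rewrite tr2 // -scalemxAr.
- by rewrite vnormZ gtr0_norm // mulVf // gt_eqF.
Qed.

(** The constant of the lower bound contributes [ln c / t], which becomes smaller than any [e] at
    late times. *)
Lemma Grows_lyap r : Grows S K tau r -> (r%:E <= lyap S K tau)%E.
Proof.
move=> /Grows_flownorm[c c0 hc]; apply: le_ereal_inf_tmp => _ [T /= T0 <-].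
apply/lee_addgt0Pr => e e0.
pose t := Num.max T (`|ln c| / e).
have tT : T <= t by rewrite le_max lexx.
have t0 : 0 < t by exact: lt_le_trans tT.
have te : `|ln c| / e <= t by rewrite le_max lexx orbT.
have [nsw [ts [sg [adm hf]]]] := hc t (ltW t0).
have h1 : (r%:E <= elog (flownorm R d S nsw ts sg t) * (t^-1)%:E + e%:E)%E.
  case: (flownorm R d S nsw ts sg t) hf => [f| |] /=; last by rewrite leeNy_eq.
    rewrite lee_fin => hf; have f0 : 0 < f.
      by apply: lt_le_trans hf; rewrite mulr_gt0 // expR_gt0.
    rewrite gt_eqF // -EFinM -EFinD lee_fin -lerBlDr -[leRHS]/(ln f / t) ler_pdivlMr //.
    apply: (@le_trans _ _ (ln (c * expR (r * t)))); last by rewrite ler_ln ?posrE ?mulr_gt0 ?expR_gt0.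
    rewrite lnM ?posrE ?expR_gt0 // expRK mulrBl addrC lerD2r.
    rewrite lerNl; apply: le_trans (_ : `|ln c| <= _); first by rewrite -normrN ler_norm.
    by rewrite mulrC -ler_pdivrMr.
  by move=> _; rewrite gt0_mulye ?lte_fin ?invr_gt0 // addye // leey.
apply: le_trans h1 _; rewrite leeD2r //.
apply: le_trans (ereal_sup_ubound _); last by exists t.
by apply: ereal_sup_ubound; exists nsw, ts, sg.
Qed.

Lemma lyap_gt rho : (rho%:E < lyap S K tau)%E -> forall T, 0 < T ->
  exists t nsw ts sg (x : forall k, R -> 'cV[R]_(sdim _ _ S (sg k))) k,
  T <= t /\ [/\ admissible K tau nsw ts sg, is_traj R d S nsw ts sg x, vnorm (x 0%N 0) <= 1,
      inpiece nsw ts k t & expR (rho * t) < vnorm (x k t)].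
Proof.
move=> hl T T0.
set g := fun t : R => ereal_sup [set r : \bar R | exists nsw ts sg, admissible K tau nsw ts sg /\
   r = (elog (flownorm R d S nsw ts sg t) * (t^-1)%:E)%E].
have : (rho%:E < ereal_sup [set g t | t in [set t : R | (T <= t)%R]])%E.
  by apply: lt_le_trans hl _; apply: ereal_inf_lbound; exists T.
move=> /ereal_sup_gt[_ [t /= Tt <-]] /ereal_sup_gt[_ [nsw [ts [sg [adm ->]]]]] hf.
have t0 : 0 < t by exact: lt_le_trans Tt.
have : ((expR (rho * t))%:E < flownorm R d S nsw ts sg t)%E.
  case E : (flownorm R d S nsw ts sg t) hf => [f| |] /=; last first.
  - by rewrite gt0_mulNye ?lte_fin ?invr_gt0.
  - by rewrite ltry.
  have [->|f0] := eqVneq f 0; first by rewrite gt0_mulNye ?lte_fin ?invr_gt0.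
  (* [ln] is informative on positive reals only. The supremum is finite, hence taken over a nonempty
     set of norms, and so it is nonnegative. *)
  have fge : 0 <= f.
    have [v [hv]] : exists v : R, 0 <= v /\ (v%:E <= flownorm R d S nsw ts sg t)%E.
      have hlt : ((f - 1)%:E < flownorm R d S nsw ts sg t)%E by rewrite E lte_fin; lra.
      have [_ [x [k [tr x1 ip ->]]] _] := ereal_sup_gt hlt.
      exists (vnorm (x k t)); split; first exact: vnorm_ge0.
      by apply: ereal_sup_ubound; exists x, k.
    by rewrite E lee_fin; exact: le_trans.
  have fgt : 0 < f by rewrite lt_neqAle eq_sym f0.
  rewrite -EFinM lte_fin ltr_pdivlMr // => h.
  by rewrite lte_fin -[f in ltRHS]lnK ?posrE // ltr_expR.
move=> /ereal_sup_gt[_ [x [k [tr x1 ip ->]]]]; rewrite lte_fin => h.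
by exists t, nsw, ts, sg, x, k.
Qed.
End Lyapunov.

(** * Words of total duration at most 1 *)

Section ShortWords.
Variables (R : realType) (n : nat).

Lemma nrm_wmat (X : eqType) (B : X -> 'M[R]_n) b (w : seq X) :
  (forall a, a \in w -> nrm (B a) <= b) -> nrm (wmat B w) <= nrm (1%:M : 'M[R]_n) * b ^+ size w.
Proof.
elim: w => [|a w IH] h /=; first by rewrite expr0 mulr1.
rewrite exprSr mulrA; apply: nrmMle; last by apply: h; rewrite mem_head.
by apply: IH => x xw; apply: h; rewrite inE xw orbT.
Qed.

Lemma wlen_ge (X : eqType) (wt : X -> R) (w : seq X) a : (forall a, 0 <= wt a) ->
  a \in w -> wt a <= wlen wt w.
Proof.
move=> wt0; elim: w => //= x w IH; rewrite inE => /orP[/eqP ->|/IH h].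
  by rewrite lerDl wlen_ge0.
by apply: le_trans h _; rewrite lerDr.
Qed.

Lemma size_wlen (X : eqType) (wt : X -> R) (w : seq X) tau :
  (forall a, a \in w -> tau <= wt a) -> tau * (size w)%:R <= wlen wt w.
Proof.
elim: w => [|a w IH] h /=; first by rewrite mulr0.
rewrite -natr1 mulrDr mulr1 addrC; apply: lerD; first by apply: h; rewrite mem_head.
by apply: IH => x xw; apply: h; rewrite inE xw orbT.
Qed.

Lemma Xi_nrm (Y : set 'M[R]_n) : Xi_bounded Y -> exists2 C, 0 <= C &
  forall s : seq 'M[R]_n, (forall Y0, Y0 \in s -> Y Y0) ->
    nrm (foldr (fun A B => A *m B) 1%:M s) <= C.
Proof.
move=> [C hC]; exists ((n * n)%:R * `|C|) => [|s hs]; first by rewrite mulr_ge0.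
apply: nrm_le_entry => i j; set A := foldr _ _ s.
have v1 : vnorm (delta_mx j 0 : 'cV[R]_n) <= 1.
  rewrite /vnorm (bigD1 j) //= big1 => [|k kj].
    by rewrite addr0 mxE !eqxx expr1n sqrtr1.
  by rewrite mxE (negPf kj) expr0n.
have : (vnorm (A *m (delta_mx j 0 : 'cV[R]_n)) <= C).
  rewrite -lee_fin; apply: le_trans (hC s hs); apply: ereal_sup_ubound.
  by exists (delta_mx j 0).
rewrite -colE => h; apply: le_trans (ler_norm C); apply: le_trans h.
by have := vnorm_entry (col j A) i; rewrite mxE.
Qed.

(* Multiplying by the product of a word [u] of letters [Y] makes the induction work:
   a letter [Y a *m (1 + Dl a)] either extends [u] or splits the product in two. *)
Lemma short_words (X : eqType) (wt : X -> R) (Y Dl : X -> 'M[R]_n) (ok : X -> Prop) C c0 :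
  0 <= C -> 0 <= c0 ->
  (forall u, (forall a, a \in u -> ok a) -> nrm (foldr (fun A B => A *m B) 1%:M (map Y u)) <= C) ->
  (forall a, ok a -> wt a <= 1 -> nrm (Dl a) <= c0 * wt a) -> (forall a, 0 <= wt a) ->
  forall w, (forall a, a \in w -> ok a) -> wlen wt w <= 1 ->
  nrm (wmat (fun a => Y a *m (1%:M + Dl a)) w) <= C * expR (C * c0).
Proof.
move=> C0 c00 hY hD wt0 w okw w1; set B := fun a => _.
pose yp u := foldr (fun A B => A *m B) (1%:M : 'M[R]_n) (map Y u).
have key : forall v u, (forall a, a \in v -> ok a) -> (forall a, a \in v -> wt a <= 1) ->
    (forall a, a \in u -> ok a) -> nrm (wmat B v *m yp u) <= C * expR (C * c0 * wlen wt v).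
  elim=> [|a v IH] u okv wv oku /=.
    by rewrite mul1mx mulr0 expR0 mulr1; exact: hY.
  have oka : ok a by apply: okv; rewrite mem_head.
  have okv' x : x \in v -> ok x by move=> xv; apply: okv; rewrite inE xv orbT.
  have wv' x : x \in v -> wt x <= 1 by move=> xv; apply: wv; rewrite inE xv orbT.
  have -> : wmat B v *m B a *m yp u =
      wmat B v *m yp (a :: u) + wmat B v *m yp [:: a] *m (Dl a *m yp u).
    by rewrite /B /yp /= mulmxDr !mulmx1 mulmxDr mulmxDl !mulmxA.
  have h1 : nrm (wmat B v *m yp (a :: u)) <= C * expR (C * c0 * wlen wt v).
    by apply: IH => // x; rewrite inE => /orP[/eqP ->|/oku].
  have h2 : nrm (wmat B v *m yp [:: a]) <= C * expR (C * c0 * wlen wt v).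
    by apply: IH => // x; rewrite inE => /eqP ->.
  have h3 : nrm (Dl a *m yp u) <= c0 * wt a * C.
    by apply: nrmMle; [apply: hD => //; apply: wv; rewrite mem_head|exact: hY].
  apply: le_trans (nrmD _ _) _; apply: le_trans (lerD h1 (nrmMle h2 h3)) _.
  rewrite mulrDr expRD.
  have -> : C * expR (C * c0 * wlen wt v) + C * expR (C * c0 * wlen wt v) * (c0 * wt a * C) =
    C * expR (C * c0 * wlen wt v) * (1 + C * c0 * wt a) by ring.
  rewrite [expR _ * expR (_ * wlen _ _)]mulrC mulrA; apply: ler_wpM2l.
    by rewrite mulr_ge0 ?expR_ge0.
  exact: expR_ge1Dx.
have hw : forall a, a \in w -> wt a <= 1 by move=> a aw; apply: le_trans w1; exact: wlen_ge.
have := key w [::] okw hw (fun _ => ltac:(by [])); rewrite /yp /= mulmx1 => h.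
apply: le_trans h _; apply: ler_wpM2l => //; rewrite ler_expR.
by apply: ler_piMr => //; exact: mulr_ge0.
Qed.

(** Gronwall's inequality with rate 0 acts as a mean value inequality on each entry, up to sign. *)
Lemma mexp_lip (A : 'M[R]_n) t : 0 <= t <= 1 ->
  nrm (mexp A t - 1%:M) <= (n * n)%:R * (nrm A * (n%:R ^+ 2 * expR (nrm A))) * t.
Proof.
move=> /andP[t0 t1]; rewrite -mulrA; apply: nrm_le_entry => i j.
set b := nrm A * _.
have b0 : 0 <= b by rewrite !mulr_ge0 ?nrm_ge0 ?expR_ge0 ?exprn_ge0.
have hd u : 0 <= u <= t -> `|(A *m mexp A u) i j| <= b.
  move=> /andP[u0 ut]; apply: le_trans (nrm_entry _ _ _) _; apply: nrmMle => //.
  apply: le_trans (mexp_bound _ u0) _; apply: ler_wpM2l; first exact: exprn_ge0.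
  by rewrite ler_expR; apply: ler_piMr; rewrite ?nrm_ge0 // (le_trans ut).
have key (a : R) : `|a| = 1 -> a * (mexp A t - 1%:M) i j <= b * t.
  move=> a1.
  pose f u := a * (mexp A u i j - (1%:M : 'M[R]_n) i j).
  have hf u : is_derive u (1 : R) f (a * ((A *m mexp A u) i j - 0)).
    apply: isdZ; exact: (isdB (mexp_derive _ _ _ _) (isdC _ _)).
  have hb u : 0 <= u <= t -> a * ((A *m mexp A u) i j - 0) <= 0 * f u + b.
    move=> hu; rewrite mul0r add0r subr0; apply: le_trans (ler_norm _) _.
    by rewrite normrM a1 mul1r; exact: hd.
  have := gronwall t0 (lexx 0) b0 hf hb; rewrite /f mexp0 subrr mulr0 add0r mul0r expR0 mul1r.
  by rewrite (_ : (mexp A t - 1%:M) i j = mexp A t i j - (1%:M : 'M[R]_n) i j) // !mxE.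
rewrite ler_norml; apply/andP; split.
  by have := key (-1) (normrN1 _); rewrite mulN1r lerNl.
by have := key 1 (normr1 _); rewrite mul1r.
Qed.

End ShortWords.

Section ModeBounds.
Variables (R : realType) (d : nat).
Notation mode := (nat * 'M[R]_d * 'M[R]_d * 'M[R]_d)%type.

Lemma nrm_sel k p : (p <= d)%N -> nrm (sel R d k p) <= (d * d)%:R.
Proof.
move=> pd; apply: (@le_trans _ _ ((p * d)%:R * 1)); last by rewrite mulr1 ler_nat leq_mul2r pd orbT.
by apply: nrm_le_entry => i j; rewrite mxE; case: eqP; rewrite ?normr1 ?normr0.
Qed.

Lemma nrm_trsel k p : (p <= d)%N -> nrm (sel R d k p)^T <= (d * d)%:R.
Proof.
move=> pd; apply: (@le_trans _ _ ((d * p)%:R * 1)); last by rewrite mulr1 ler_nat leq_mul2l pd orbT.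
by apply: nrm_le_entry => i j; rewrite !mxE; case: eqP; rewrite ?normr1 ?normr0.
Qed.

Lemma mode_bounds (K : set mode) : good_K K -> D_Hurwitz K -> exists2 b, 0 <= b &
  forall s, K s -> [/\ nrm (Tmat s) <= b, nrm (invmx (Tmat s)) <= b, nrm (Mred s) <= b,
    nrm (Hhat s) <= b & nrm (m_R s) <= b].
Proof.
move=> Kg DH; have [c c0 hc] := K_bounds Kg DH.
pose q : R := (d * d)%:R; have q0 : 0 <= q by [].
pose bb := q * (c * c) * q; have bb0 : 0 <= bb by rewrite /bb !mulr_ge0.
pose n1 := nrm (1%:M : 'M[R]_d); have n10 : 0 <= n1 by exact: nrm_ge0.
pose wW := q * (c * bb) * q; have wW0 : 0 <= wW by rewrite /wW !mulr_ge0.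
pose bM := bb + bb * c * bb; have bM0 : 0 <= bM by rewrite addr_ge0 // !mulr_ge0.
pose bT := (n1 + wW) * c; have bT0 : 0 <= bT by rewrite mulr_ge0 ?addr_ge0.
pose bI := c * (n1 + wW); have bI0 : 0 <= bI by rewrite mulr_ge0 ?addr_ge0.
pose bH := c * (q * (q * c)); have bH0 : 0 <= bH by rewrite !mulr_ge0.
exists (bT + bI + bM + bH + c) => [|s Ks]; first by do 4!apply: addr_ge0 => //.
have [hP hPi hL hR hD] := hc s Ks; have [_ ld1 Pu] := Kg.2 s Ks.
have ld : (m_l s <= d)%N by rewrite (leq_trans ld1) // leq_subr.
have ld2 : (d - m_l s <= d)%N by exact: leq_subr.
have Ds := DH s Ks.
have hX : nrm (LPinv s) <= c * c by exact: nrmMle.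
have hA : nrm (blkA s) <= bb.
  by rewrite blkA_E //; apply: nrmMle (nrm_trsel _ _) => //; apply: nrmMle hX; exact: nrm_sel.
have hB : nrm (blkB s) <= bb.
  by rewrite blkB_E //; apply: nrmMle (nrm_trsel _ _) => //; apply: nrmMle hX; exact: nrm_sel.
have hC : nrm (blkC s) <= bb.
  by rewrite blkC_E //; apply: nrmMle (nrm_trsel _ _) => //; apply: nrmMle hX; exact: nrm_sel.
pose W := invmx (blkD s) *m blkC s.
have hW : nrm ((sel R d (m_l s) (d - m_l s))^T *m W *m sel R d 0 (m_l s)) <= wW.
  apply: nrmMle; last exact: nrm_sel.
  by apply: nrmMle; [exact: nrm_trsel|exact: nrmMle].
have hT : nrm (Tmat s) <= bT.
  rewrite Tmat_E //; apply: nrmMle => //; apply: le_trans (nrmD _ _) _; exact: lerD.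
have hTi : nrm (invmx (Tmat s)) <= bI.
  by rewrite Tinv_E //; apply: nrmMle => //; apply: le_trans (nrmB _ _) _; exact: lerD.
have hM : nrm (Mred s) <= bM.
  by apply: le_trans (nrmB _ _) _; apply: lerD => //; apply: nrmMle => //; exact: nrmMle.
have hH : nrm (Hhat s) <= bH.
  rewrite Hhat_E //; apply: nrmMle => //; apply: nrmMle; first exact: nrm_trsel.
  by apply: nrmMle => //; exact: nrm_sel.
by clearbody bT bI bM bH; split; lra.
Qed.

End ModeBounds.

(** * Trajectories of a limit system as words acting on the full space *)

Section Embedding.
Variables (R : realType) (d : nat).
Notation mode := (nat * 'M[R]_d * 'M[R]_d * 'M[R]_d)%type.
Variables (S : swsys R d) (K : set mode) (tau : R) (F : mode -> R -> 'M[R]_d).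
Variables (emb : forall s, 'M[R]_(d, sdim R d S s)) (prj : forall s, 'M[R]_(sdim R d S s, d)) (b : R).
Hypothesis b0 : 0 <= b.
Hypothesis S_dim : forall s, K s -> (sdim R d S s <= d)%N.
Hypothesis prj_emb : forall s, K s -> prj s *m emb s = 1%:M.
Hypothesis emb_bdd : forall s, K s -> nrm (emb s) <= b.
Hypothesis prj_bdd : forall s, K s -> nrm (prj s) <= b.
Hypothesis emb_flow : forall s y t u, K s -> solves R _ (sLm R d S s) (sAm R d S s) y -> t <= u ->
  emb s *m y u = F s (u - t) *m (emb s *m y t).
(** The two jumps need only agree after the next flow: for the slow system they differ by a fast
    component, which [Fbar] annihilates. *)
Hypothesis emb_jump : forall s s' u, K s -> K s' -> 0 <= u ->
  F s' u *m (emb s' *m sJm R d S s' s) = F s' u *m (m_R s *m emb s).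
Let B (a : mode * R) := m_R a.1 *m F a.1 a.2.
Notation lb := (fun a : mode * R => Some (letter_mode a)).
Notation inK := (inH (@letter_mode R d) (letter_ok tau) K).
Notation len := (wlen (@letter_len R d)).

Let word (ts : nat -> R) (sg : nat -> mode) k := mkseq (fun j => (sg j, ts j.+1 - ts j)) k.

Lemma word_traj nsw ts sg x : admissible K tau nsw ts sg -> is_traj R d S nsw ts sg x ->
  forall k u, active nsw k -> ts k <= u ->
  emb (sg k) *m x k u = F (sg k) (u - ts k) *m (wmat B (word ts sg k) *m (emb (sg 0%N) *m x 0%N 0)).
Proof.
move=> [ts0 sgK tsS _] [tr1 tr2]; elim=> [|k IH] u ak tu.
  rewrite ts0 in tu *; rewrite mul1mx; apply: emb_flow => //; [exact: sgK|exact: tr1].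
have hk : hasnext nsw k by case: (nsw) ak.
have ak' : active nsw k by case: (nsw) ak => //= N; exact: ltnW.
have [tk _ _] := tsS k hk.
have -> : wmat B (word ts sg k.+1) = B (sg k, ts k.+1 - ts k) *m wmat B (word ts sg k).
  by rewrite /word mkseqS -cats1 wmat_cat /= mul1mx.
rewrite (emb_flow (sgK _ ak) (tr1 _ ak) tu) tr2 // (mulmxA (emb _)) (mulmxA (F _ _)).
rewrite emb_jump ?subr_ge0 //; [|exact: sgK|exact: sgK].
rewrite -!mulmxA IH // ?(ltW tk) //; congr (_ *m _).
Qed.

Lemma word_adm nsw ts sg k : admissible K tau nsw ts sg -> active nsw k ->
  [/\ inK (word ts sg k), wok lb lb None (word ts sg k) & len (word ts sg k) = ts k].
Proof.
move=> [ts0 sgK tsS _]; elim: k => [|k IH] ak; first by rewrite ts0; split.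
have hk : hasnext nsw k by case: (nsw) ak.
have ak' : active nsw k by case: (nsw) ak => //= N; exact: ltnW.
have [tk tauk _] := tsS k hk; have [h1 h2 h3] := IH ak'.
have wS : word ts sg k.+1 = word ts sg k ++ [:: (sg k, ts k.+1 - ts k)] by rewrite /word mkseqS -cats1.
rewrite wS; split.
- apply/inH_cat; split=> // a; rewrite inE => /eqP ->; split; last exact: sgK.
  by rewrite /letter_ok /= subr_gt0; split=> //; rewrite lerBrDl.
- apply: wok_catI => //; split=> //.
  case: k ak hk {wS tk tauk h1 h2 h3 IH} ak' => [|k] ak hk ak'; first by [].
  rewrite /word mkseqS -cats1 /wlast foldl_cat /= => -[e].
  have hk' : hasnext nsw k by case: (nsw) ak'.
  by have [_ _] := tsS k hk'; apply.
- by rewrite wlen_cat h3 /= addr0 /letter_len /= gtr0_norm ?subr_gt0 // addrC subrK.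
Qed.

Lemma lyap_words (rho r c : R) : (rho%:E < lyap S K tau)%E -> r < rho ->
  exists w s t, [/\ inK w, wok lb lb None w, K s, 0 <= t &
    c * expR (r * (len w + t)) < nrm (F s t *m wmat B w)].
Proof.
move=> hl rrho.
pose C := b * (b * d%:R); have C0 : 0 <= C by rewrite !mulr_ge0.
have rr : 0 < rho - r by rewrite subr_gt0.
(* From this time on, [(rho - r) * t] exceeds the prescribed constant [c] times the embedding
   constants, so the gap between the rates absorbs them. *)
pose T := (`|c| * (C + 1)) / (rho - r) + 1.
have T0 : 0 < T by rewrite ltr_wpDl // divr_ge0 // ?(ltW rr) // mulr_ge0 // addr_ge0.
have [t [nsw [ts [sg [x [k [Tt [adm tr x1 ip hx]]]]]]]] := lyap_gt hl T0.
have [ak tk _] := ip.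
have [h1 h2 h3] := word_adm adm ak.
have [ts0 sgK tsS _] := adm.
have a0 : active nsw 0 by case: (nsw).
exists (word ts sg k), (sg k), (t - ts k); split=> //; [exact: sgK|by rewrite subr_ge0|].
rewrite h3 addrC subrK; set N := nrm _.
have N0 : 0 <= N by exact: nrm_ge0.
have hN : expR (rho * t) < (C + 1) * N + 0.
  apply: lt_le_trans hx _; apply: le_trans (vnorm_le_nrm _) _.
  have -> : x k t = prj (sg k) *m (F (sg k) (t - ts k) *m wmat B (word ts sg k) *m (emb (sg 0%N) *m x 0%N 0)).
    by rewrite -[F _ _ *m _ *m _]mulmxA -(word_traj adm tr) // mulmxA prj_emb ?mul1mx //; exact: sgK.
  have hx0 : nrm (x 0%N 0) <= d%:R.
    apply: le_trans (nrm_le_vnorm _) _; apply: (@le_trans _ _ ((sdim R d S (sg 0%N))%:R * 1)).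
      exact: ler_wpM2l.
    by rewrite mulr1 ler_nat; apply: S_dim; exact: sgK.
  have hn : nrm (prj (sg k) *m (F (sg k) (t - ts k) *m wmat B (word ts sg k) *m (emb (sg 0%N) *m x 0%N 0))) <= b * (N * (b * d%:R)).
    apply: nrmMle; first by apply: prj_bdd; exact: sgK.
    by apply: nrmMle => //; apply: nrmMle => //; apply: emb_bdd; exact: sgK.
  apply: le_trans hn _; rewrite addr0 mulrDl mul1r.
  have -> : b * (N * (b * d%:R)) = C * N by rewrite /C; ring.
  by rewrite lerDl.
have C1 : 0 < C + 1 by rewrite ltr_wpDl.
rewrite -(ltr_pM2l C1); rewrite addr0 in hN; apply: le_lt_trans hN.
apply: (@le_trans _ _ (expR ((rho - r) * t) * expR (r * t))); last first.
  by rewrite -expRD mulrBl subrK.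
rewrite mulrA; apply: ler_wpM2r; first exact: expR_ge0.
apply: (@le_trans _ _ (1 + (rho - r) * t)); last exact: expR_ge1Dx.
have h : `|c| * (C + 1) <= (rho - r) * t.
  by rewrite [leRHS]mulrC -ler_pdivrMr //; apply: le_trans Tt; rewrite /T lerDl.
have hc : (C + 1) * c <= `|c| * (C + 1) by rewrite mulrC; apply: ler_wpM2r (ler_norm _); exact: ltW.
clearbody C T; lra.
Qed.

End Embedding.

(** * The two limit systems *)

Section LimitSystems.
Variables (R : realType) (d : nat).
Notation mode := (nat * 'M[R]_d * 'M[R]_d * 'M[R]_d)%type.

Lemma eq_wmat_in (X : eqType) n (A A' : X -> 'M[R]_n) w :
  (forall a, a \in w -> A a = A' a) -> wmat A w = wmat A' w.
Proof.
elim: w => //= a w IH h; rewrite h ?mem_head // IH // => x xw.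
by apply: h; rewrite inE xw orbT.
Qed.

Lemma ode_mulmx m n (A : 'M[R]_n) (A' : 'M[R]_m) (G : 'M[R]_(m, n)) y :
  G *m A = A' *m G -> ode A y -> ode A' (fun t => G *m y t).
Proof.
move=> e hy t i; rewrite mulmxA -e -mulmxA mxE.
rewrite (_ : (fun u => (G *m y u) i 0) = (fun u => \sum_j G i j * y u j 0)).
  by apply: isd_sum => j; apply: isdZ; exact: hy.
by apply/funext => u; rewrite mxE.
Qed.

Lemma solves1_ode n (A : 'M[R]_n) y : solves R n 1%:M A y -> ode A y.
Proof. by move=> h; have := solves_ode h (unitmx1 _ _); rewrite invmx1 mul1mx. Qed.

Lemma sandwich_mulmx l p (T : 'M[R]_d) (I : 'M[R]_(l, d)) (E : 'M[R]_l) (v : 'M[R]_(l, p)) :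
  T \in unitmx -> I *m I^T = 1%:M ->
  invmx T *m I^T *m E *m I *m T *m (invmx T *m I^T *m v) = invmx T *m I^T *m (E *m v).
Proof.
move=> Tu II; rewrite -!mulmxA (mulmxA T) mulmxV // mul1mx (mulmxA I) II.
by rewrite mul1mx.
Qed.

Lemma sandwich_jump l p (T Rs Ti : 'M[R]_d) (I : 'M[R]_(l, d)) (E : 'M[R]_l) (J : 'M[R]_(d, p)) :
  T \in unitmx -> I *m I^T = 1%:M ->
  invmx T *m I^T *m E *m I *m T *m (invmx T *m I^T *m (I *m (T *m Rs *m Ti) *m J)) =
  invmx T *m I^T *m E *m I *m T *m (Rs *m (Ti *m J)).
Proof. by move=> Tu II; rewrite sandwich_mulmx // !mulmxA. Qed.

Variable K : set mode.
Hypothesis Kg : good_K K.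
Hypothesis DH : D_Hurwitz K.

Let ld s : K s -> (m_l s <= d)%N.
Proof. by move=> Ks; have [_ h _] := Kg.2 s Ks; rewrite (leq_trans h) // leq_subr. Qed.
Let Pu s : K s -> m_P s \in unitmx.
Proof. by move=> Ks; have [] := Kg.2 s Ks. Qed.
Let Tu s (Ks : K s) : Tmat s \in unitmx := T_unit (ld Ks) (Pu Ks).

Notation I1 s := (sel R d 0 (m_l s)).
Notation inK tau := (inH (@letter_mode R d) (letter_ok tau) K).
Notation len := (wlen (@letter_len R d)).
Let B (F : mode -> R -> 'M[R]_d) (a : mode * R) := m_R a.1 *m F a.1 a.2.
Definition short_bounded (F : mode -> R -> 'M[R]_d) tau := exists2 csw, 0 <= csw &
  forall w, inK tau w -> len w <= 1 -> nrm (wmat (B F) w) <= csw.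

Lemma letter_len_ge0 (a : mode * R) : 0 <= letter_len a. Proof. exact: normr_ge0. Qed.

(** A word of duration at most 1 has at most 1 / tau letters, each of bounded norm. *)
Lemma short_dwell F tau cR cF : 0 < tau -> (forall s, K s -> nrm (m_R s) <= cR) ->
  (forall s t, K s -> 0 <= t <= 1 -> nrm (F s t) <= cF) -> short_bounded F tau.
Proof.
move=> tau0 hR hF; pose N := Num.bound tau^-1; pose b := `|cR * cF| + 1.
have b1 : 1 <= b by rewrite lerDr.
exists (nrm (1%:M : 'M[R]_d) * b ^+ N) => [|w hw w1].
  by rewrite mulr_ge0 ?nrm_ge0 // exprn_ge0 // (le_trans ler01).
have hb a : a \in w -> nrm (B F a) <= b.
  move=> aw; have [[a0 _] Ka] := hw a aw.
  have a1 := le_trans (wlen_ge letter_len_ge0 aw) w1.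
  rewrite /letter_len gtr0_norm // in a1.
  apply: (@le_trans _ _ (cR * cF)); last by rewrite /b ler_wpDr // ler_norm.
  by apply: nrmMle; [exact: hR|apply: hF => //; rewrite (ltW a0)].
apply: le_trans (nrm_wmat hb) _; apply: ler_wpM2l; first exact: nrm_ge0.
apply: ler_weXn2l => //.
have hs : tau * (size w)%:R <= 1.
  apply: le_trans w1; apply: size_wlen => a aw; have [[a0 at0] _] := hw a aw.
  by apply: le_trans at0 _; exact: ler_norm.
rewrite -(ler_nat R); apply: ltW; apply: le_lt_trans (archi_boundP _); last by rewrite invr_ge0 ltW.
by rewrite -[leRHS]div1r ler_pdivlMr // mulrC.
Qed.

(** Each letter is a jump matrix [Y] followed on its right by a factor within order t of the
    identity, so the bound on products of [Y] passes to short words by [short_words]. *)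
Lemma short_Xi F (Y : mode -> 'M[R]_d) (Dl : mode -> R -> 'M[R]_d) c0 : 0 <= c0 ->
  Xi_bounded [set Y s | s in K] ->
  (forall s t, K s -> 0 < t -> m_R s *m F s t = Y s *m (1%:M + Dl s t)) ->
  (forall s t, K s -> 0 < t <= 1 -> nrm (Dl s t) <= c0 * t) -> short_bounded F 0.
Proof.
move=> c00 /Xi_nrm[C C0 hC] hF hD; exists (C * expR (C * c0)) => [|w hw w1].
  by rewrite mulr_ge0 ?expR_ge0.
rewrite (@eq_wmat_in _ _ (B F) (fun a => Y a.1 *m (1%:M + Dl a.1 a.2))); last first.
  by move=> a aw; have [[a0 _] Ka] := hw a aw; exact: hF.
apply: (@short_words R d _ (@letter_len R d) (fun a => Y a.1) (fun a => Dl a.1 a.2)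
  (fun a => K a.1 /\ 0 < a.2) C c0) => //.
- move=> u hu; apply: hC => _ /mapP[a au ->]; exists a.1 => //.
  by have [] := hu a au.
- by move=> [s t] /= [Ks t0]; rewrite /letter_len /= gtr0_norm // => t1; apply: hD; rewrite // t0.
- exact: letter_len_ge0.
- by move=> a /hw[[a0 _] Ka].
Qed.

Lemma unit_time_bounds n (A : 'M[R]_n) b t : (n <= d)%N -> nrm A <= b -> 0 <= t <= 1 ->
  nrm (mexp A t) <= d%:R ^+ 2 * expR b /\
  nrm (mexp A t - 1%:M) <= (d * d)%:R * (b * (d%:R ^+ 2 * expR b)) * t.
Proof.
move=> nd Ab /andP[t0 t1].
have n2 : (n%:R : R) ^+ 2 <= d%:R ^+ 2 by rewrite lerXn2r ?nnegrE // ler_nat.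
split.
  apply: le_trans (mexp_bound _ t0) _; apply: ler_pM; rewrite ?exprn_ge0 ?expR_ge0 //.
  rewrite ler_expR; apply: le_trans Ab; apply: ler_piMr => //; exact: nrm_ge0.
have t01 : 0 <= t <= 1 by rewrite t0.
apply: le_trans (mexp_lip _ t01) _; apply: ler_wpM2r => //.
apply: ler_pM => //; first by rewrite !mulr_ge0 ?nrm_ge0 ?expR_ge0 ?exprn_ge0.
  by rewrite ler_nat leq_mul.
apply: ler_pM => //; first exact: nrm_ge0.
by apply: ler_pM; rewrite ?exprn_ge0 ?expR_ge0 ?ler_expR.
Qed.

Lemma Fbar_bounds : exists cF, 0 <= cF /\ forall s t, K s -> 0 <= t <= 1 ->
  nrm (Fbar s t) <= cF /\ nrm (Fbar s t - Fbar s 0) <= cF * t.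
Proof.
have [b b0 hb] := mode_bounds Kg DH.
pose q : R := (d * d)%:R; have q0 : 0 <= q by [].
pose e1 := d%:R ^+ 2 * expR b; have e10 : 0 <= e1 by rewrite mulr_ge0 ?expR_ge0 ?exprn_ge0.
pose e2 := q * (b * e1); have e20 : 0 <= e2 by rewrite !mulr_ge0.
pose c1 := b * q * e1 * q * b; pose c2 := b * q * e2 * q * b.
have c10 : 0 <= c1 by rewrite !mulr_ge0.
have c20 : 0 <= c2 by rewrite !mulr_ge0.
exists (c1 + c2); split; first by rewrite addr_ge0.
move=> s t Ks t01; have [hT hTi hM _ _] := hb s Ks.
have [h1 h2] := unit_time_bounds (ld Ks) hM t01.
have /andP[t0 t1] := t01.
have hs (E : 'M[R]_(m_l s)) c : nrm E <= c ->
    nrm (invmx (Tmat s) *m (I1 s)^T *m E *m I1 s *m Tmat s) <= b * q * c * q * b.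
  move=> hE; pose h := nrmMle (nrmMle hTi (nrm_trsel R 0 (ld Ks))) hE.
  exact: nrmMle (nrmMle h (nrm_sel R 0 (ld Ks))) hT.
split; first by apply: le_trans (hs _ _ h1) _; rewrite lerDl.
have -> : Fbar s t - Fbar s 0 =
    invmx (Tmat s) *m (I1 s)^T *m (mexp (Mred s) t - 1%:M) *m I1 s *m Tmat s.
  by rewrite /Fbar mexp0 mulmxBr !mulmxBl.
apply: le_trans (hs _ _ h2) _.
have -> : b * q * (e2 * t) * q * b = c2 * t by rewrite /c2; ring.
by rewrite mulrDl lerDr mulr_ge0.
Qed.

Lemma Fbar0 s : K s -> Fbar s 0 = invmx (Tmat s) *m diagI0 R d (m_l s) *m Tmat s.
Proof.
move=> Ks; rewrite /Fbar mexp0 mulmx1 -(mulmxA (invmx _)); congr (_ *m _ *m _).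
apply/matrixP => i j; rewrite -(mulmx1 (I1 s)^T) sel_block mxE !add0n !subn0 /=.
case: ifP => [/andP[il jl]|].
  rewrite (mgetE _ (Ordinal il) (Ordinal jl)) mxE -!val_eqE /= il andbT.
  by case: eqP.
by case: eqP => // -> /=; rewrite andbb => ->.
Qed.

Lemma growth_bar tau rho mu : short_bounded (@Fbar R d) tau ->
  (rho%:E < lyap (Sigma_bar d) K tau)%E -> mu < rho ->
  near0 (fun e => Grows (Sigma_eps d e) K tau mu).
Proof.
move=> [csw csw0 hsw] hl murho.
have [b b0 hb] := mode_bounds Kg DH; have [cF [cF0 hF]] := Fbar_bounds.
pose q : R := (d * d)%:R; have q0 : 0 <= q by [].
have h : near0 (fun e => Grows (Sigma_eps d e) K tau (mu / (fun=> 1) e)).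
  apply: (@main_growth R d K tau (@Fbar R d) _ b cF csw rho) => //.
  - by move=> s Ks; have [] := hb s Ks.
  - by move=> s t u Ks t0 u0; apply: FbarD => //; [exact: ld|exact: Pu].
  - by move=> s t Ks /(hF s t Ks)[].
  - by move=> e t _; rewrite mul1r.
  - move=> s t Ks t0; under eq_fun do rewrite mul1r.
    by apply: Fbar_lim => //; [exact: ld|exact: Pu|exact: DH].
  - by move=> w hw _; exact: hsw.
  move=> r c rrho.
  apply: (@lyap_words R d (Sigma_bar d) K tau (@Fbar R d) (fun s => invmx (Tmat s) *m (I1 s)^T)
    (fun s => I1 s *m Tmat s) (b * q + q * b) _ _ _ _ _ _ _ rho) => //.
  - by rewrite addr_ge0 // mulr_ge0.
  - by move=> s Ks /=; rewrite mulmxA -(mulmxA (I1 s)) mulmxV ?Tu // mulmx1 selI11 //; exact: ld.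
  - move=> s Ks; have [_ hTi _ _ _] := hb s Ks.
    apply: le_trans (nrmMle hTi (nrm_trsel R 0 (ld Ks))) _; by rewrite lerDl mulr_ge0.
  - move=> s Ks; have [hT _ _ _ _] := hb s Ks.
    apply: le_trans (nrmMle (nrm_sel R 0 (ld Ks)) hT) _; by rewrite lerDr mulr_ge0.
  - move=> s y t u Ks /solves1_ode/ode_mexpE hy tu; rewrite (hy _ _ tu) /Fbar.
    by rewrite sandwich_mulmx ?Tu ?selI11 // ld.
  - move=> s s' u Ks Ks' u0 /=; rewrite /ulblk subblkE ?add0n ?ld // /Fbar.
    by apply: sandwich_jump; rewrite ?Tu ?selI11 // ld.
by apply: near0_sub h => e _; rewrite divr1.
Qed.

Lemma Fhat_bounds : exists cF, 0 <= cF /\ forall s t, K s -> 0 <= t <= 1 ->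
  nrm (Fhat s t) <= cF /\ nrm (Fhat s t - 1%:M) <= cF * t.
Proof.
have [b b0 hb] := mode_bounds Kg DH.
pose e1 := d%:R ^+ 2 * expR b; have e10 : 0 <= e1 by rewrite mulr_ge0 ?expR_ge0 ?exprn_ge0.
pose e2 := (d * d)%:R * (b * e1); have e20 : 0 <= e2 by rewrite !mulr_ge0.
exists (e1 + e2); split; first by rewrite addr_ge0.
move=> s t Ks t01; have [_ _ _ hH _] := hb s Ks.
have [h1 h2] := unit_time_bounds (leqnn d) hH t01.
have /andP[t0 t1] := t01.
split; first by apply: le_trans h1 _; rewrite lerDl.
by apply: le_trans h2 _; rewrite mulrDl lerDr mulr_ge0.
Qed.

Lemma growth_hat rho mu : short_bounded (@Fhat R d) 0 ->
  (rho%:E < lyap (Sigma_hat d) K 0)%E -> mu < rho ->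
  near0 (fun e => Grows (Sigma_eps d e) K 0 (mu / e)).
Proof.
move=> [csw csw0 hsw] hl murho.
have [b b0 hb] := mode_bounds Kg DH; have [cF [cF0 hF]] := Fhat_bounds.
apply: (@main_growth R d K 0 (@Fhat R d) id b cF csw rho) => //.
- by move=> s Ks; have [] := hb s Ks.
- by move=> s t u Ks t0 u0; exact: mexpD.
- by move=> s t Ks /(hF s t Ks)[].
- by move=> e t e0 t0; rewrite mulr_ge0 // ltW.
- by move=> s t Ks t0; apply: Fhat_lim => //; [exact: ld|exact: Pu|exact: DH|exact: ltW].
- by move=> w hw _; exact: hsw.
move=> r c rrho.
apply: (@lyap_words R d (Sigma_hat d) K 0 (@Fhat R d) (fun s => invmx (Tmat s)) (@Tmat R d)
   b _ _ _ _ _ _ _ rho) => //.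
- by move=> s Ks; rewrite mulmxV ?Tu.
- by move=> s Ks; have [] := hb s Ks.
- by move=> s Ks; have [] := hb s Ks.
- move=> s y t u Ks /solves1_ode hy tu.
  have e : invmx (Tmat s) *m diag0D s = Hhat s *m invmx (Tmat s).
    by rewrite /Hhat mulmxK ?Tu.
  exact: ode_mexpE (ode_mulmx e hy) tu.
- move=> s s' u Ks Ks' u0 /=; congr (_ *m _).
  by rewrite -(mulmxA (Tmat s')) mulKmx ?Tu.
Qed.

Lemma short_bar_dwell tau : 0 < tau -> short_bounded (@Fbar R d) tau.
Proof.
move=> tau0; have [b b0 hb] := mode_bounds Kg DH; have [cF [cF0 hF]] := Fbar_bounds.
apply: (short_dwell (cR := b) (cF := cF)) => //.
- by move=> s Ks; have [] := hb s Ks.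
- by move=> s t Ks /(hF s t Ks)[].
Qed.

(** Since [Fbar s 0] is a left unit for [Fbar s t], the letter equals [m_R s *m Fbar s 0] times
    [1 + (Fbar s t - Fbar s 0)], and [m_R s *m Fbar s 0] is an element of [Rbarset K]. *)
Lemma short_bar0 : Xi_bounded (Rbarset K) -> short_bounded (@Fbar R d) 0.
Proof.
move=> hX; have [cF [cF0 hF]] := Fbar_bounds.
apply: (@short_Xi _ (fun s => m_R s *m invmx (Tmat s) *m diagI0 R d (m_l s) *m Tmat s)
  (fun s t => Fbar s t - Fbar s 0) cF) => //.
- move=> s t Ks t0; have FF u : 0 <= u -> Fbar s 0 *m Fbar s u = Fbar s u.
    by move=> u0; rewrite -FbarD ?addr0 //; [exact: ld|exact: Pu].
  have -> : m_R s *m invmx (Tmat s) *m diagI0 R d (m_l s) *m Tmat s = m_R s *m Fbar s 0.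
    by rewrite Fbar0 // !(mulmxA (m_R s)).
  rewrite -(mulmxA (m_R s)) mulmxDr mulmx1 mulmxBr.
  by rewrite !FF ?(ltW t0) // addrC subrK.
- by move=> s t Ks /andP[t0 t1]; have [] := hF s t Ks; rewrite ?(ltW t0).
Qed.

Lemma short_hat : Xi_bounded (Rset K) -> short_bounded (@Fhat R d) 0.
Proof.
move=> hX; have [cF [cF0 hF]] := Fhat_bounds.
apply: (@short_Xi _ (@m_R R d) (fun s t => Fhat s t - 1%:M) cF) => //.
- by move=> s t Ks t0; rewrite addrC subrK.
- by move=> s t Ks /andP[t0 t1]; have [] := hF s t Ks; rewrite ?(ltW t0).
Qed.

End LimitSystems.

(** * Lower limits in the extended reals *)

Section Limits.
Variable R : realType.
Local Open Scope ereal_scope.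

Lemma ereal_between (x y : \bar R) : x < y -> exists r : R, x < r%:E < y.
Proof.
case: x y => [x| |] [y| |] //.
- rewrite lte_fin => xy; exists ((x + y) / 2)%R; rewrite !lte_fin; apply/andP; lra.
- by move=> _; exists (x + 1)%R; rewrite lte_fin ltrDl ltr01 ltry.
- by move=> _; exists (y - 1)%R; rewrite lte_fin gtrBl ltr01 ltNyr.
- by move=> _; exists 0%R; rewrite ltry ltNyr.
Qed.

Lemma le_liminf0 (h : R -> \bar R) x : near0 (fun e => x <= h e) -> x <= liminf0 h.
Proof.
move=> [e0 e00 he]; apply: le_trans (ereal_sup_ubound _); last by exists e0.
by apply: le_ereal_inf_tmp => _ [e /= hee <-]; exact: he.
Qed.

Lemma le_of_lt_liminf0 L (h : R -> \bar R) :
  (forall rho mu : R, rho%:E < L -> (mu < rho)%R -> near0 (fun e => mu%:E <= h e)) ->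
  L <= liminf0 h.
Proof.
move=> hL; rewrite leNgt; apply/negP => /ereal_between[mu /andP[h1 h2]].
have [rho /andP[r1 r2]] := ereal_between h2.
by have := le_liminf0 (hL rho mu r2 r1); rewrite leNgt h1.
Qed.

End Limits.

(** Instability at rate r bounds the exponent of the limit system below by r, which leaves room for
    r / 2 as [rho] and r / 4 as [mu]. *)
Lemma EU_near0 (R : realType) (d : nat) (S : swsys R d) K tau (G : R -> R -> Prop) :
  (forall rho mu, (rho%:E < lyap S K tau)%E -> mu < rho -> near0 (G mu)) ->
  EU S K tau -> exists2 mu, 0 < mu & near0 (G mu).
Proof.
move=> hG /EU_Grows[r r0 /Grows_lyap hr]; exists (r / 4); first by rewrite divr_gt0.
apply: (hG (r / 2)); last by lra.
by apply: lt_le_trans hr; rewrite lte_fin; lra.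
Qed.

Theorem theorem1 (R : realType) (d : nat) (K : set (nat * 'M[R]_d * 'M[R]_d * 'M[R]_d)) :
  (2 <= d)%N -> good_K K -> D_Hurwitz K ->
  (* (1) positive dwell time *)
  (forall tau : R, 0 < tau ->
     (lyap (Sigma_bar d) K tau <= liminf0 (fun eps => lyap (Sigma_eps d eps) K tau))%E /\
     (EU (Sigma_bar d) K tau ->
        exists eps0 : R, 0 < eps0 /\
          forall eps : R, 0 < eps < eps0 -> EU (Sigma_eps d eps) K tau)) /\
  (* (2) zero dwell time, bounded jumps *)
  (Xi_bounded (Rset K) -> Xi_bounded (Rbarset K) ->
     (lyap (Sigma_bar d) K 0 <= liminf0 (fun eps => lyap (Sigma_eps d eps) K 0))%E /\
     (EU (Sigma_bar d) K 0 ->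
        exists eps0 : R, 0 < eps0 /\
          forall eps : R, 0 < eps < eps0 -> EU (Sigma_eps d eps) K 0)) /\
  (* (3) the boundary-layer system *)
  (Xi_bounded (Rset K) ->
     (lyap (Sigma_hat d) K 0 <=
        maxe 0%E (liminf0 (fun eps => eps%:E * lyap (Sigma_eps d eps) K 0)))%E /\
     (EU (Sigma_hat d) K 0 ->
        exists c eps0 : R, [/\ 0 < c, 0 < eps0 &
          forall eps : R, 0 < eps < eps0 ->
            EU (Sigma_eps d eps) K 0 /\ ((c / eps)%:E <= lyap (Sigma_eps d eps) K 0)%E])).
Proof.
move=> _ Kg DH.
(* Parts (1) and (2) differ only in the reason why words of duration at most 1 are bounded. *)
have bar tau : short_bounded K (@Fbar R d) tau ->
    (lyap (Sigma_bar d) K tau <= liminf0 (fun eps => lyap (Sigma_eps d eps) K tau))%E /\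
    (EU (Sigma_bar d) K tau -> exists eps0 : R, 0 < eps0 /\
       forall eps : R, 0 < eps < eps0 -> EU (Sigma_eps d eps) K tau).
  move=> hs; split.
    apply: le_of_lt_liminf0 => rho mu hl hmu.
    by apply: near0_sub (growth_bar Kg DH hs hl hmu) => e _; exact: Grows_lyap.
  move=> /(EU_near0 (fun rho mu => growth_bar Kg DH hs (rho := rho) (mu := mu)))[mu mu0 [e0 e00 he]].
  by exists e0; split=> // e /he; exact: Grows_EU.
split; first by move=> tau tau0; exact: bar _ (short_bar_dwell Kg DH tau0).
split; first by move=> _ hX; exact: bar _ (short_bar0 Kg DH hX).
move=> /(short_hat Kg DH) hs; split.
  rewrite le_max; apply/orP; right; apply: le_of_lt_liminf0 => rho mu hl hmu.
  apply: near0_sub (growth_hat Kg DH hs hl hmu) => e e0 /Grows_lyap h.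
  have -> : mu%:E = (e%:E * (mu / e)%:E)%E by rewrite -EFinM mulrCA divff ?mulr1 // gt_eqF.
  by apply: lee_wpmul2l => //; rewrite lee_fin ltW.
move=> /(EU_near0 (fun rho mu => growth_hat Kg DH hs (rho := rho) (mu := mu)))[mu mu0 [e0 e00 he]].
exists mu, e0; split=> // e hee; have e_gt0 : 0 < e by case/andP: hee.
by split; [apply: Grows_EU (he e hee); exact: divr_gt0|exact: Grows_lyap (he e hee)].
Qed.
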